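(* Let $n \in\{2,3\}$, let $\Lambda$ be an operator as in the context with eigenvalues $\{\lambda_k\}_{k\in\mathcal{I}}$ of $-\Lambda$ and $\lambda_0=0$, and let $\mathcal{L} = \Delta_r + \frac{1}{|x|^2}\Lambda$. Put \[ M_n = \max_{k \in \mathcal{I} \setminus \{0\}} (\lambda_k + \mathbf{R}_n)^{-2}. \] Then for all admissible $f$, \[ \left\| \frac{1}{|x|^2} \Lambda f \right\|_{2}^2 \leq \big( 1 - \mathbf{R}_n \sqrt{M_n}\big)^2 \|\mathcal{L} f\|^{2}_{2}. \] Moreover, if $M_n = (\lambda_{k_0} + \mathbf{R}_n)^{-2}$ for some $k_0\in\mathcal{I}\setminus\{0\}$ with $\lambda_{k_0} > -\mathbf{R}_n$, then the constant $( 1 - \mathbf{R}_n \sqrt{M_n})^2$ is best possible, i.e. it cannot be replaced by any smaller constant.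
   Context: $\|\cdot\|_2$ denotes the norm of $L^2(\mathbb{R}^n)$ (Lebesgue measure). $\mathbf{R}_n = \frac{n(n-4)}{4}$. The radial derivative is $\partial_r = \frac{x}{|x|}\cdot\nabla$ and the radial Laplacian is $\Delta_r f = \partial_r^2 f + \frac{n-1}{|x|}\partial_r f$. $-\Lambda$ is a non-negative self-adjoint operator on $L^2(\mathbb{S}^{n-1})$ whose spectrum is purely discrete, consisting of isolated eigenvalues $\{\lambda_k\}_{k\in\mathcal{I}}$ which may only accumulate at infinity; zero is assumed to be an eigenvalue of $-\Lambda$ and is denoted $\lambda_0=0$ (with index $0\in\mathcal{I}$). $\Lambda$ acts on functions on $\mathbb{R}^n\setminus\{0\}$ through the angular variable $x/|x|$. If $\lambda_k=-\mathbf{R}_n$ for some $k\in\mathcal{I}\setminus\{0\}$, then $M_n=+\infty$, the constant is infinite and the inequality is void. Admissible functions: writing $f(r,\theta)=f(r\theta)$ for $r>0$, $\theta\in\mathbb{S}^{n-1}$, $f$ is admissible if $r\mapsto f(r,\cdot)$ is a smooth compactly supported map from $(0,\infty)$ to $L^2(\mathbb{S}^{n-1})$, $f(r,\cdot)$ lies in the domain of $\Lambda$ for every $r>0$, and $r\mapsto\Lambda f(r,\cdot)$ is square-integrable as an $L^2(\mathbb{S}^{n-1})$-valued function. In particular, every $f(x)=g(|x|)u(x/|x|)$ with $g\in C_0^\infty((0,\infty))$ and $u$ an eigenfunction of $-\Lambda$ is admissible. *)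

(* Defs.v *)
From HB Require Import structures.
From mathcomp Require Import all_boot all_order all_algebra.
From mathcomp Require Import all_classical all_reals all_analysis.
From mathcomp Require Import measurable_realfun complex.

Set Implicit Arguments.
Unset Strict Implicit.
Unset Printing Implicit Defensive.
Import Order.TTheory GRing.Theory Num.Theory numFieldNormedType.Exports.

Local Open Scope classical_set_scope.
Local Open Scope ring_scope.

Notation Eucl R n := (n.-tuple (measurableTypeR R)).

Section EuclideanSpace.
Variable R : realType.

Definition tcons (n : nat) (p : measurableTypeR R * (Eucl R n)) : Eucl R n.+1 :=
  [tuple of p.1 :: p.2].

Lemma measurable_tcons n : measurable_fun setT (@tcons n).
Proof. exact: measurable_cons. Qed.

Section step.
Variables (n : nat)
  (m : {sigma_finite_measure set (Eucl R n) -> \bar R}).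

Definition leb_step : set (Eucl R n.+1) -> \bar R :=
  pushforward (lebesgue_measure \x m)%E (@tcons n).

Let mt := @measurable_tcons n.
Let step0 : leb_step set0 = 0%E. Proof. exact: measure0. Qed.
Let step_ge0 A : (0 <= leb_step A)%E. Proof. exact: measure_ge0. Qed.
Let step_sigma_additive : semi_sigma_additive leb_step.
Proof. exact: measure_semi_sigma_additive. Qed.
HB.instance Definition _ := isMeasure.Build _ _ _ leb_step
  step0 step_ge0 step_sigma_additive.

Let step_sigma_finite : sigma_finite setT leb_step.
Proof.
have /sigma_finiteP[F [TF ndF Foo]] := sigma_finiteT (@lebesgue_measure R).
have /sigma_finiteP[G [TG ndG Goo]] := sigma_finiteT m.
exists (fun k => [set x | F k (thead x) /\ G k [tuple of behead x]]).
  apply/seteqP; split=> // x _.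
  have [i _ Fi] : (\bigcup_i F i) (thead x) by rewrite -TF.
  have [j _ Gj] : (\bigcup_i G i) [tuple of behead x] by rewrite -TG.
  exists (maxn i j) => //; split.
    by move: Fi; exact/subsetPset/ndF/leq_maxl.
  by move: Gj; exact/subsetPset/ndG/leq_maxr.
move=> k; have [mF Fk] := Foo k; have [mG Gk] := Goo k; split.
  have -> : [set x | F k (thead x) /\ G k [tuple of behead x]] =
      (@tnth n.+1 _ ^~ ord0) @^-1` F k `&`
      (fun x : Eucl R n.+1 => [tuple of behead x]) @^-1` G k by [].
  apply: measurableI; rewrite -[X in measurable X]setTI.
    exact: measurable_tnth.
  exact: measurable_behead.
rewrite /leb_step /pushforward.
rewrite (_ : _ @^-1` _ = F k `*` G k); last first.
  apply/seteqP; split=> -[a b] /=; rewrite theadE.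
    by move=> [? ?]; split => //; rewrite (_ : b = [tuple of behead (a :: b)])//; exact: val_inj.
  by move=> [? ?]; split => //; rewrite (_ : [tuple of behead (a :: b)] = b)//; exact: val_inj.
by rewrite product_measure1E// lte_mul_pinfty// ge0_fin_numE.
Qed.

HB.instance Definition _ := Measure_isSigmaFinite.Build _ _ _ leb_step
  step_sigma_finite.
End step.

(* Lebesgue measure on R^n, as an iterated product of [lebesgue_measure]. *)
Fixpoint lebesgue_eucl (n : nat) : {sigma_finite_measure set (Eucl R n) -> \bar R} :=
  if n is n'.+1 then leb_step (lebesgue_eucl n') else \d_[tuple of [::]].

Definition enorm n (x : Eucl R n) : R := Num.sqrt (\sum_(i < n) tnth x i ^+ 2).

Definition dilate n (r : R) (x : Eucl R n) : Eucl R n := [tuple r * tnth x i | i < n].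

Definition direction n (x : Eucl R n) : Eucl R n := dilate (enorm x)^-1 x.

Definition punctured_ball n : set (Eucl R n) := [set x | 0 < enorm x < 1].

Lemma measurable_enorm n : measurable_fun setT (@enorm n).
Proof.
rewrite (_ : @enorm n = fun x => (\sum_(i < n) tnth x i ^+ 2) `^ 2^-1); last first.
  by apply/funext=> x; rewrite powR12_sqrt// sumr_ge0// => i _; exact: sqr_ge0.
apply: (measurableT_comp (measurable_powR 2^-1)).
apply: (@measurable_sum _ _ _ _ _ _ (fun i (x : Eucl R n) => tnth x i ^+ 2)) => i.
apply: (@measurable_funX _ _ _ _ (fun x : Eucl R n => tnth x i)).
exact: measurable_tnth.
Qed.

Lemma measurable_direction n : measurable_fun setT (@direction n).
Proof.
apply/measurable_fun_tnthP => i.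
rewrite (_ : _ \o _ = fun x => (enorm x) `^ (-1) * tnth x i); last first.
  by apply/funext => x /=; rewrite tnth_mktuple powR_inv1// sqrtr_ge0.
apply: measurable_funM; last exact: measurable_tnth.
exact: (measurableT_comp (measurable_powR _) (@measurable_enorm n)).
Qed.

Lemma measurable_punctured_ball n : measurable (@punctured_ball n).
Proof.
rewrite (_ : @punctured_ball n = @enorm n @^-1` `]0, 1[); last first.
  by apply/seteqP; split=> x /=; rewrite in_itv.
by rewrite -[X in measurable X]setTI; apply: measurable_enorm.
Qed.

Definition cone_measure n : set (Eucl R n) -> \bar R :=
  pushforward (mrestr (lebesgue_eucl n) (@measurable_punctured_ball n))
              (@direction n).

Section cone_measure_is_measure.
Variable n : nat.
Let md := @measurable_direction n.
Let cone0 : @cone_measure n set0 = 0%E. Proof. exact: measure0. Qed.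
Let cone_ge0 A : (0 <= @cone_measure n A)%E. Proof. exact: measure_ge0. Qed.
Let cone_sigma_additive : semi_sigma_additive (@cone_measure n).
Proof. exact: measure_semi_sigma_additive. Qed.
HB.instance Definition _ := isMeasure.Build _ _ _ (@cone_measure n)
  cone0 cone_ge0 cone_sigma_additive.
End cone_measure_is_measure.

(* The surface measure of the unit sphere S^(n-1), obtained by coning:
   sigma(A) = n * Leb {x : 0 < |x| < 1 and x / |x| \in A}.  It is a measure on
   R^n carried by the sphere, so an element of L^2(S^(n-1)) is represented by
   a function on R^n whose values off the sphere are irrelevant. *)
Definition surface_measure n : {measure set (Eucl R n) -> \bar R} :=
  mscale n%:R%:nng (@cone_measure n).

End EuclideanSpace.

Notation "\sigma_( R , n )" := (@surface_measure R n)
  (at level 0, format "\sigma_( R ,  n )").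

Section L2.
Context d (T : measurableType d) (R : realType).
Variable mu : {measure set T -> \bar R}.

Definition cmeasurable (u : T -> R[i]) : Prop :=
  measurable_fun setT (fun x => complex.Re (u x)) /\
  measurable_fun setT (fun x => complex.Im (u x)).

Definition l2norm (u : T -> R[i]) : \bar R :=
  ('N[mu]_2%:E [EFin \o (@Normc.normc R \o u)])%E.

(* Square-integrable functions; L^2(mu) is this set modulo [%[ae mu]]. *)
Definition L2 : set (T -> R[i]) :=
  [set u | cmeasurable u /\ (l2norm u < +oo)%E].

Definition inner (u v : T -> R[i]) : R[i] :=
  let w x := u x * (v x)^* in
  Complex (\int[mu]_x complex.Re (w x)) (\int[mu]_x complex.Im (w x)).

(* A possibly unbounded operator on L^2(mu): its domain and its action, given
   on representatives; [app] is only meaningful on [dom]. *)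
Record l2op := L2Op { dom : set (T -> R[i]); app : (T -> R[i]) -> T -> R[i] }.

Definition oppop (A : l2op) : l2op := L2Op (dom A) (fun u x => - app A u x).

Definition linear_operator (A : l2op) : Prop :=
  [/\ dom A `<=` L2 /\ (forall u, dom A u -> L2 (app A u)),
      (forall u v, dom A u -> cmeasurable v -> u = v %[ae mu] ->
         dom A v /\ app A u = app A v %[ae mu]) &
      (forall (c : R[i]) u v, dom A u -> dom A v ->
         dom A (fun x => c * u x + v x) /\
         app A (fun x => c * u x + v x)
           = (fun x => c * app A u x + app A v x) %[ae mu])].

Definition densely_defined (A : l2op) : Prop :=
  forall u, L2 u -> forall e : R, 0 < e ->
    exists2 v, dom A v & (l2norm (fun x => u x - v x)%R < e%:E)%E.

(* A = A^*: v lies in the domain of the adjoint, with image w, exactly when it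
   lies in the domain of A, with image w. *)
Definition selfadjoint (A : l2op) : Prop :=
  [/\ linear_operator A, densely_defined A &
      forall v w, L2 v -> L2 w ->
        (forall u, dom A u -> inner (app A u) v = inner u w) <->
        (dom A v /\ app A v = w %[ae mu])].

Definition nonneg_operator (A : l2op) : Prop :=
  forall u, dom A u -> 0 <= inner (app A u) u.

(* z is in the resolvent set when A - z maps the domain bijectively onto
   L^2(mu) with bounded inverse; the bound entails injectivity. *)
Definition resolvent_set (A : l2op) : set R[i] :=
  [set z |
    (forall w, L2 w -> exists2 u, dom A u &
       (fun x => app A u x - z * u x) = w %[ae mu]) /\
    (exists c : R, forall u, dom A u ->
       (l2norm u <= c%:E * l2norm (fun x => app A u x - z * u x)%R)%E)].

Definition spectrum (A : l2op) : set R[i] := ~` resolvent_set A.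

Definition eigenvalue (A : l2op) (z : R[i]) : Prop :=
  exists u, [/\ dom A u, ~ (u = (fun=> 0) %[ae mu]) &
    app A u = (fun x => z * u x) %[ae mu]].

(* The family lam enumerates the spectrum, which consists of eigenvalues, only
   finitely many of them in any bounded region: they are isolated and can only
   accumulate at infinity. *)
Definition discrete_spectrum (A : l2op) (I : Type) (lam : I -> R) : Prop :=
  [/\ spectrum A = [set (lam k)%:C%C | k in setT],
      (forall k, eigenvalue A (lam k)%:C%C) &
      (forall b : R, finite_set [set l | range lam l /\ `|l| <= b])].

End L2.

Section Admissible.
Variables (R : realType) (n : nat).
Local Notation E := (Eucl R n).
Local Notation sigma := \sigma_(R, n).

(* f(r, .) as an element of L^2(S^(n-1)) *)
Definition slice (f : E -> R[i]) (r : R) : E -> R[i] :=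
  fun theta => f (dilate r theta).

Definition L2slices (f : E -> R[i]) : Prop :=
  cmeasurable f /\ forall r, 0 < r -> L2 sigma (slice f r).

(* g represents the derivative of the L^2(S^(n-1))-valued map r |-> f(r, .). *)
Definition is_radial_derivative (f g : E -> R[i]) : Prop :=
  L2slices g /\ forall r, 0 < r ->
    l2norm sigma (fun theta =>
      (h^-1)%:C%C * (slice f (r + h) theta - slice f r theta) - slice g r theta)
      @[h --> 0^'] --> 0%E.

(* The derivative is a class modulo null sets; a representative is chosen. *)
Definition radial_derivative (f : E -> R[i]) : E -> R[i] :=
  xget (fun=> 0) [set g | is_radial_derivative f g].

Definition radial_smooth (f : E -> R[i]) : Prop :=
  L2slices f /\
  forall k, is_radial_derivative (iter k radial_derivative f)
                                 (iter k.+1 radial_derivative f).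

Definition radially_compactly_supported (f : E -> R[i]) : Prop :=
  exists a b : R, 0 < a /\
    forall r, 0 < r -> ~ (a <= r <= b) -> slice f r = (fun=> 0) %[ae sigma].

Definition radial_laplacian (f : E -> R[i]) : E -> R[i] := fun x =>
  radial_derivative (radial_derivative f) x
  + ((n%:R - 1) / enorm x)%:C%C * radial_derivative f x.

Variable Lam : l2op E R.

(* g represents r |-> Lam f(r, .).  Such a g, jointly measurable, exists
   exactly when that L^2(S^(n-1))-valued map is measurable. *)
Definition is_angular_action (f g : E -> R[i]) : Prop :=
  cmeasurable g /\
  {ae lebesgue_measure, forall r, 0 < r ->
     app Lam (slice f r) = slice g r %[ae sigma]}.

Definition angular_action (f : E -> R[i]) : E -> R[i] :=
  xget (fun=> 0) [set g | is_angular_action f g].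

Definition admissible (f : E -> R[i]) : Prop :=
  [/\ radial_smooth f, radially_compactly_supported f,
      (forall r, 0 < r -> dom Lam (slice f r)),
      is_angular_action f (angular_action f) &
      (\int[lebesgue_measure]_(r in `]0%R, +oo[)
         l2norm sigma (slice (angular_action f) r) ^+ 2 < +oo)%E].

(* |x|^-2 Lam f *)
Definition weighted_angular_action (f : E -> R[i]) : E -> R[i] := fun x =>
  (enorm x ^- 2)%:C%C * angular_action f x.

Definition Lop (f : E -> R[i]) : E -> R[i] := fun x =>
  radial_laplacian f x + weighted_angular_action f x.

End Admissible.

Definition Rellich (R : realType) (n : nat) : R := n%:R * (n%:R - 4) / 4.

(* In [\bar R], 0^-1 is +oo, so the value is +oo as soon as some lam k with
   k <> o equals - Rellich R n.  Otherwise the supremum is a maximum, because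
   the lam k accumulate at infinity only. *)
Definition Mmax (R : realType) (n : nat) (I : Type) (o : I) (lam : I -> R) :
    \bar R :=
  ereal_sup [set ((lam k + Rellich R n)%:E ^+ 2)^-1%E | k in [set k | k <> o]].

(* Main.v *)
(** Put A = - Lam, V = |x|^-2 f and rho = - R_n, so that 0 <= rho <= 2. In the variable t = ln r the
    unitary dilation group turns Delta_r f + R_n V into W V := V'' + 2 V', hence
    L f = W V - (A - rho) V. Since d/dt is skew-adjoint and commutes with A,
      - 2 <W V, (A - rho) V> + |W V|^2
        = 2 <V', A V'> - 2 rho |V'|^2 + |V''|^2 + 4 |V'|^2 >= 0,
    which gives |(A - rho) V| <= |L f|. No regularity of r |-> A f(r, .) is available, so t-derivatives
    are replaced by difference quotients of the dilation group, and W V is recovered in the limit.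
    The eigenvalue 0 = lam o and the gap |lam k - rho| >= 1 / sqrt M_n for k <> o then bound |A V| by
    (1 - R_n sqrt M_n) |(A - rho) V|, slice by slice.

    For sharpness take f = r^((4 - n) / 2) X (eps ln r) u, with u an eigenfunction for lam k0 and X a
    bump function. As eps -> 0 the terms of L f where X is differentiated become negligible, and
    |A V| / |L f| tends to lam k0 / (lam k0 + R_n) = 1 - R_n sqrt M_n. *)

Require Import Defs.
From mathcomp Require Import all_boot all_order all_algebra.
From mathcomp Require Import all_classical all_reals all_analysis.
From mathcomp Require Import measurable_realfun complex ring lra.
Set Implicit Arguments. Unset Strict Implicit. Unset Printing Implicit Defensive.
Import Order.TTheory GRing.Theory Num.Theory numFieldNormedType.Exports.

Local Open Scope classical_set_scope.
Local Open Scope ring_scope.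

(** * The real inner product of L^2 *)

Section RealInnerProduct.
Context d (T : measurableType d) (R : realType).
Variable mu : {measure set T -> \bar R}.
Implicit Types (u v w : T -> R[i]) (a b : R).

(** Only self-adjointness and the location of the spectrum are known, so no eigenfunction expansion
    or functional calculus is used: the spectral estimate is the nonnegativity of a quadratic
    polynomial in A whose roots bound an interval free of spectrum. In place of <V', A V'> stands
    <V_h - V, A (V_h - V)>, with V_h the dilated V; it is nonnegative slice by slice. The resulting
    difference inequality is exact for every step 0 < h <= 1, so only the radial part, smooth in r,
    has to converge as h tends to 0. That convergence is reduced to real functions: everything is
    paired with a vector e of L^2(S^(n-1)), Taylor's formula gives a bound proportional to |e|, and
    e is then taken to be the error itself. The range 0 <= rho <= 2 comes from the dimension: rho =
    1 for n = 2 and rho = 3/4 for n = 3. Radial derivatives and A f(r, .) are chosen representatives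
    of classes, so identities hold on slices up to null sets; inner products on R^n are compared by
    polarization, which leaves only nonnegative integrands for polar coordinates. *)

Definition rdot (z w : R[i]) : R :=
  complex.Re z * complex.Re w + complex.Im z * complex.Im w.

(** Every scalar in the estimates is real, so the real part of [inner] suffices; it is a symmetric
    bilinear form over R. *)
Definition rip u v : R := \int[mu]_x rdot (u x) (v x).

(** Extended real values make it meaningful outside L^2 and let Tonelli's theorem integrate it over
    radii. *)
Definition l2sq u : \bar R := \int[mu]_x (rdot (u x) (u x))%:E.

Lemma rdotE (z w : R[i]) : complex.Re (z * w^*) = rdot z w.
Proof. by case: z => a b; case: w => c e /=; rewrite mulrN opprK. Qed.

Lemma rdotC (z w : R[i]) : rdot z w = rdot w z.
Proof. by rewrite /rdot mulrC [in X in _ + X]mulrC. Qed.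

Lemma rdotDl (z w t : R[i]) : rdot (z + w) t = rdot z t + rdot w t.
Proof. by case: z => ? ?; case: w => ? ?; case: t => ? ?; rewrite /rdot /=; ring. Qed.

Lemma rdotZl a (z w : R[i]) : rdot (a%:C%C * z) w = a * rdot z w.
Proof. by case: z => ? ?; case: w => ? ?; rewrite /rdot /=; ring. Qed.

Lemma rdot_ge0 (z : R[i]) : 0 <= rdot z z.
Proof. by rewrite /rdot -!expr2 addr_ge0 ?sqr_ge0. Qed.

Lemma rdot_eq0 (z : R[i]) : rdot z z = 0 -> z = 0.
Proof.
case: z => a b /eqP; rewrite /rdot /= -!expr2 paddr_eq0 ?sqr_ge0//.
by rewrite !sqrf_eq0 => /andP[/eqP -> /eqP ->].
Qed.

Lemma rdot_normc (z : R[i]) : Normc.normc z ^+ 2 = rdot z z.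
Proof.
by case: z => a b /=; rewrite sqr_sqrtr ?addr_ge0 ?sqr_ge0// /rdot /= !expr2.
Qed.

Lemma normr_rdot_le (z w : R[i]) : `|rdot z w| <= rdot z z + rdot w w.
Proof.
case: z => a b; case: w => c e; rewrite ler_norml /rdot /=; apply/andP; split.
  suff : 0 <= (a + c) ^+ 2 + (b + e) ^+ 2 + a ^+ 2 + b ^+ 2 + c ^+ 2 + e ^+ 2 by nra.
  by rewrite !addr_ge0 ?sqr_ge0.
suff : 0 <= (a - c) ^+ 2 + (b - e) ^+ 2 + a ^+ 2 + b ^+ 2 + c ^+ 2 + e ^+ 2 by nra.
by rewrite !addr_ge0 ?sqr_ge0.
Qed.

Lemma Re_inner u v : complex.Re (inner mu u v) = rip u v.
Proof. by apply: eq_Rintegral => x _; exact: rdotE. Qed.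

Lemma cmeasurable_lin (c : R[i]) u v :
  cmeasurable u -> cmeasurable v -> cmeasurable (c *: u + v).
Proof.
case: c => a b [ru iu] [rv iv]; split.
  rewrite (_ : (fun _ => _) = fun x => a * complex.Re (u x) - b * complex.Im (u x) + complex.Re (v x)).
    by apply: measurable_funD => //; apply: measurable_funB; exact: measurable_funM.
  by apply/funext => x /=; rewrite -[_ x]/((a +i* b)%C * u x + v x); case: (u x) => ? ?; case: (v x).
rewrite (_ : (fun _ => _) = fun x => a * complex.Im (u x) + b * complex.Re (u x) + complex.Im (v x)).
  by apply: measurable_funD => //; apply: measurable_funD; exact: measurable_funM.
by apply/funext => x /=; rewrite -[_ x]/((a +i* b)%C * u x + v x); case: (u x) => ? ?; case: (v x) => ? ? /=; ring.
Qed.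

Lemma cmeasurable0 : cmeasurable (0 : T -> R[i]).
Proof. by split; exact: measurable_cst. Qed.

Lemma cmeasurableD u v : cmeasurable u -> cmeasurable v -> cmeasurable (u + v).
Proof. by move=> mu_ mv; rewrite -[u]scale1r; exact: cmeasurable_lin. Qed.

Lemma cmeasurableZ (c : R[i]) u : cmeasurable u -> cmeasurable (c *: u).
Proof. by move=> mu_; rewrite -[X in cmeasurable X]addr0; exact: cmeasurable_lin mu_ cmeasurable0. Qed.

Lemma cmeasurable_mulr (a : T -> R) u : measurable_fun setT a -> cmeasurable u ->
  cmeasurable (fun x => (a x)%:C%C * u x).
Proof.
move=> ma [ru iu]; split.
  rewrite (_ : (fun _ => _) = fun x => a x * complex.Re (u x)); last first.
    by apply/funext => x; case: (u x) => ? ? /=; ring.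
  exact: measurable_funM.
rewrite (_ : (fun _ => _) = fun x => a x * complex.Im (u x)); last first.
  by apply/funext => x; case: (u x) => ? ? /=; ring.
exact: measurable_funM.
Qed.

Lemma measurable_rdot u v : cmeasurable u -> cmeasurable v ->
  measurable_fun setT (fun x => rdot (u x) (v x)).
Proof.
by move=> [ru iu] [rv iv]; apply: measurable_funD; exact: measurable_funM.
Qed.

Lemma l2sq_ge0 u : (0 <= l2sq u)%E.
Proof. by apply: integral_ge0 => x _; rewrite lee_fin rdot_ge0. Qed.

Lemma l2norm_sqr u : (l2norm mu u ^+ 2 = l2sq u)%E.
Proof.
have n0 : (0 <= l2norm mu u)%E by exact: Lnorm_ge0.
transitivity (l2norm mu u `^ 2)%E.
  case: (l2norm mu u) n0 => [r|_|//]; last by rewrite poweRyr// mulyy.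
  by rewrite lee_fin => r0; rewrite poweR_EFin powR_mulrn// -EFin_expe.
rewrite poweR_Lnorm//; apply: eq_integral => x _.
by rewrite abse_EFin poweR_EFin powR_mulrn// real_normK ?num_real// rdot_normc.
Qed.

Lemma L2P u : L2 mu u <-> cmeasurable u /\ (l2sq u < +oo)%E.
Proof.
have n0 : (0 <= l2norm mu u)%E by exact: Lnorm_ge0.
split=> -[mu_ oo]; split=> //.
  by rewrite -l2norm_sqr -(ge0_fin_numE (sqre_ge0 _)) fin_numX// ge0_fin_numE.
move: oo n0; rewrite -l2norm_sqr; case: (l2norm mu u) => //.
by move=> r _ _; exact: ltry.
Qed.

Lemma integrable_rdot u v : L2 mu u -> L2 mu v ->
  mu.-integrable setT (EFin \o (fun x => rdot (u x) (v x))).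
Proof.
move=> /L2P[mu_ uoo] /L2P[mv voo].
have H w : cmeasurable w -> (l2sq w < +oo)%E ->
    mu.-integrable setT (EFin \o (fun x => rdot (w x) (w x))).
  move=> mw woo; apply/integrableP; split.
    exact/measurable_EFinP/measurable_rdot.
  under eq_integral => x _ do rewrite /= ger0_norm ?rdot_ge0//.
  exact: woo.
apply: (le_integrable measurableT _ _ (integrableD measurableT (H u mu_ uoo) (H v mv voo))).
  exact/measurable_EFinP/measurable_rdot.
move=> x _ /=; rewrite lee_fin (le_trans (normr_rdot_le _ _))//.
by rewrite ler_norm.
Qed.

Lemma l2sqE u : L2 mu u -> l2sq u = (rip u u)%:E.
Proof.
by move=> Lu; rewrite /rip /Rintegral fineK// integrable_fin_num//; exact: integrable_rdot.
Qed.

Lemma ripC u v : rip u v = rip v u.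
Proof. by apply: eq_Rintegral => x _; exact: rdotC. Qed.

Lemma rip_ge0 u : 0 <= rip u u.
Proof. by apply: Rintegral_ge0 => x _; exact: rdot_ge0. Qed.

Lemma L2_0 : L2 mu (0 : T -> R[i]).
Proof.
apply/L2P; split; first exact: cmeasurable0.
by rewrite /l2sq integral0_eq// => x _; rewrite /rdot /= mul0r addr0.
Qed.

Lemma L2D u v : L2 mu u -> L2 mu v -> L2 mu (u + v).
Proof.
move=> Lu Lv; have /L2P[mu_ uoo] := Lu; have /L2P[mv voo] := Lv.
apply/L2P; split; first exact: cmeasurableD.
have fge0 w x : (0 <= (rdot (w x) (w x))%:E)%E by rewrite lee_fin rdot_ge0.
apply: (@le_lt_trans _ _ (2%:E * l2sq u + 2%:E * l2sq v)%E); last first.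
  rewrite lte_add_pinfty// lte_mul_pinfty//.
rewrite /l2sq -!ge0_integralZl_EFin//; try exact/measurable_EFinP/measurable_rdot.
have mz w : cmeasurable w -> measurable_fun setT (fun x => (2%:E * (rdot (w x) (w x))%:E)%E).
  by move=> mw; apply: measurable_funeM; exact/measurable_EFinP/measurable_rdot.
rewrite -ge0_integralD//; try exact: mz; try by move=> x _; rewrite mule_ge0.
apply: ge0_le_integral => //.
- by apply/measurable_EFinP/measurable_rdot; exact: cmeasurableD.
- by apply: emeasurable_funD; exact: mz.
- move=> x _; rewrite -!EFinM -EFinD lee_fin [(u + v) x]/(u x + v x).
  case: (u x) => a b; case: (v x) => c e; rewrite /rdot /=.
  suff : 0 <= (a - c) ^+ 2 + (b - e) ^+ 2 by nra.
  by rewrite addr_ge0 ?sqr_ge0.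
Qed.

Lemma L2ZC (c : R[i]) u : L2 mu u -> L2 mu (c *: u).
Proof.
move=> /L2P[mu_ uoo]; apply/L2P; split; first exact: cmeasurableZ.
rewrite /l2sq (_ : (\int[mu]_x _) = (rdot c c)%:E * l2sq u)%E; last first.
  rewrite /l2sq -ge0_integralZl_EFin ?rdot_ge0//.
  - apply: eq_integral => x _; rewrite -EFinM [(c *: u) x]/(c * u x).
    by case: c (u x) => a b [e f]; rewrite /rdot /=; congr EFin; ring.
  - by move=> x _; rewrite lee_fin rdot_ge0.
  - exact/measurable_EFinP/measurable_rdot.
by rewrite lte_mul_pinfty ?lee_fin ?rdot_ge0.
Qed.

Lemma L2Z a u : L2 mu u -> L2 mu (a%:C%C *: u). Proof. exact: L2ZC. Qed.

Lemma L2N u : L2 mu u -> L2 mu (- u).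
Proof. by move=> Lu; rewrite -scaleN1r; exact: L2ZC. Qed.

Lemma L2B u v : L2 mu u -> L2 mu v -> L2 mu (u - v).
Proof. by move=> Lu Lv; exact/L2D/L2N. Qed.

Lemma ripDl u v w : L2 mu u -> L2 mu v -> L2 mu w -> rip (u + v) w = rip u w + rip v w.
Proof.
move=> Lu Lv Lw; rewrite /rip -RintegralD//; try exact: integrable_rdot.
by apply: eq_Rintegral => x _; exact: rdotDl.
Qed.

Lemma ripZl a u w : L2 mu u -> L2 mu w -> rip (a%:C%C *: u) w = a * rip u w.
Proof.
move=> Lu Lw; rewrite /rip -RintegralZl//; last exact: integrable_rdot.
by apply: eq_Rintegral => x _; exact: rdotZl.
Qed.

Lemma ripNl u w : L2 mu u -> L2 mu w -> rip (- u) w = - rip u w.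
Proof.
move=> Lu Lw; rewrite -(mulN1r (rip u w)) -ripZl//; congr rip; apply/funext => x.
by rewrite -[LHS]/(- u x) -[RHS]/((-1)%:C%C * u x) rmorphN rmorph1 mulN1r.
Qed.

Lemma ripBl u v w : L2 mu u -> L2 mu v -> L2 mu w -> rip (u - v) w = rip u w - rip v w.
Proof. by move=> Lu Lv Lw; rewrite ripDl ?ripNl//; exact: L2N. Qed.

Lemma ripDr u v w : L2 mu u -> L2 mu v -> L2 mu w -> rip w (u + v) = rip w u + rip w v.
Proof. by move=> *; rewrite ripC ripDl// ripC [rip v _]ripC. Qed.

Lemma ripZr a u w : L2 mu u -> L2 mu w -> rip w (a%:C%C *: u) = a * rip w u.
Proof. by move=> *; rewrite ripC ripZl// ripC. Qed.

Lemma ripNr u w : L2 mu u -> L2 mu w -> rip w (- u) = - rip w u.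
Proof. by move=> *; rewrite ripC ripNl// ripC. Qed.

Lemma ripBr u v w : L2 mu u -> L2 mu v -> L2 mu w -> rip w (u - v) = rip w u - rip w v.
Proof. by move=> *; rewrite ripC ripBl// ripC [rip v _]ripC. Qed.

Lemma eq_rip u u' v v' : cmeasurable u -> cmeasurable u' -> cmeasurable v -> cmeasurable v' ->
  u = u' %[ae mu] -> v = v' %[ae mu] -> rip u v = rip u' v'.
Proof.
move=> mu1 mu2 mv1 mv2 uu vv; congr fine; apply: ae_eq_integral => //.
- exact/measurable_EFinP/measurable_rdot.
- exact/measurable_EFinP/measurable_rdot.
- by apply: filterS2 uu vv => x uu vv _; rewrite uu ?vv.
Qed.

Lemma rip_eq0 u : L2 mu u -> rip u u = 0 -> u = (fun=> 0) %[ae mu].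
Proof.
move=> Lu u0.
have : (\int[mu]_x `|(rdot (u x) (u x))%:E| = 0)%E.
  under eq_integral => x _ do rewrite gee0_abs ?lee_fin ?rdot_ge0//.
  by rewrite -/(l2sq u) l2sqE// u0.
move=> /ae_eq_integral_abs => /(_ measurableT) H.
have /H : measurable_fun setT (fun x => (rdot (u x) (u x))%:E).
  by apply/measurable_EFinP/measurable_rdot; case: Lu.
by apply: filterS => x /(_ I) /= [] /rdot_eq0 ->.
Qed.

Lemma rip_cauchy u v : L2 mu u -> L2 mu v -> rip u v ^+ 2 <= rip u u * rip v v.
Proof.
move=> Lu Lv; set U := rip u u; set V := rip v v; set B := rip u v.
have U0 : 0 <= U := rip_ge0 u; have V0 : 0 <= V := rip_ge0 v.
have P t : 0 <= U + t * (2 * B) + t ^+ 2 * V.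
  have LZ := L2Z t Lv; have := rip_ge0 (u + t%:C%C *: v).
  have LD := L2D Lu LZ; rewrite !(ripDl, ripDr, ripZl, ripZr)// (ripC v u).
  by rewrite -/U -/V -/B; congr (_ <= _); ring.
have [V0'|] := ltP 0 V.
  have := P (- (B / V)); rewrite -(pmulr_rge0 _ V0').
  suff -> : V * (U + - (B / V) * (2 * B) + (- (B / V)) ^+ 2 * V) = U * V - B ^+ 2.
    by rewrite subr_ge0.
  by field; rewrite gt_eqF.
move=> V1; have {V0 V1}VE : V = 0 by apply/eqP; rewrite eq_le V1 V0.
have [->|B0] := eqVneq B 0; first by rewrite expr0n mulr_ge0// VE.
(* When V = 0 the quadratic is affine in t, and this t makes it equal to -1. *)
have := P (- ((U + 1) / (2 * B))); rewrite VE mulr0 addr0 mulNr divfK ?mulf_neq0//.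
by rewrite opprD addrA subrr add0r ler0N1.
Qed.

Lemma ripD_sqr u v : L2 mu u -> L2 mu v ->
  rip (u + v) (u + v) = rip u u + 2 * rip u v + rip v v.
Proof.
move=> Lu Lv; have Luv := L2D Lu Lv.
by rewrite !(ripDl, ripDr)// (ripC v u); ring.
Qed.

Lemma ripB_sqr u v : L2 mu u -> L2 mu v ->
  rip (u - v) (u - v) = rip u u - 2 * rip u v + rip v v.
Proof.
move=> Lu Lv; have Luv := L2B Lu Lv.
by rewrite !(ripBl, ripBr)// (ripC v u); ring.
Qed.

Lemma eq_L2 u v : L2 mu u -> cmeasurable v -> u = v %[ae mu] -> L2 mu v.
Proof.
move=> /L2P[mu_ uoo] mv uv; apply/L2P; split => //.
rewrite (_ : l2sq v = l2sq u)//; apply: ae_eq_integral => //.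
- exact/measurable_EFinP/measurable_rdot.
- exact/measurable_EFinP/measurable_rdot.
- by apply: filterS uv => x uv _; rewrite uv.
Qed.

Lemma l2norm_sqrt u : L2 mu u -> l2norm mu u = (Num.sqrt (rip u u))%:E.
Proof.
move=> Lu; have := l2norm_sqr u; rewrite l2sqE//.
have : (0 <= l2norm mu u)%E by exact: Lnorm_ge0.
case: Lu => _; case: (l2norm mu u) => // r _; rewrite lee_fin => r0.
by rewrite -EFin_expe => -[<-]; rewrite sqrtr_sqr ger0_norm.
Qed.

End RealInnerProduct.

(** * Spectral gaps of self-adjoint operators *)

Section SelfAdjoint.
Context d (T : measurableType d) (R : realType).
Variable mu : {measure set T -> \bar R}.
Implicit Types (u v w : T -> R[i]).
Variable A : l2op T R.
Hypothesis saA : selfadjoint mu A.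

Definition opshift (z : R) u : T -> R[i] := app A u - z%:C%C *: u.

Lemma dom_L2 u : dom A u -> L2 mu u.
Proof. by case: saA => -[[+ _] _ _] _ _; exact. Qed.

Lemma app_L2 u : dom A u -> L2 mu (app A u).
Proof. by case: saA => -[[_ +] _ _] _ _; exact. Qed.

Lemma opshift_L2 z u : dom A u -> L2 mu (opshift z u).
Proof. by move=> du; apply: L2B; [exact: app_L2|exact/L2Z/dom_L2]. Qed.

Lemma L2_cmeasurable u : L2 mu u -> cmeasurable u. Proof. by case. Qed.

(** This is the adjoint clause of [selfadjoint], read from right to left for v in the domain and w =
    A v. *)
Lemma rip_app_sym u v : dom A u -> dom A v -> rip mu (app A u) v = rip mu u (app A v).
Proof.
move=> du dv; rewrite -!Re_inner; congr complex.Re.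
case: saA => _ _ /(_ v (app A v) (dom_L2 dv) (app_L2 dv)) [_ H].
by apply: H => //; split => //; exact: filterE.
Qed.

Lemma rip_opshift_sym z u v : dom A u -> dom A v ->
  rip mu (opshift z u) v = rip mu u (opshift z v).
Proof.
move=> du dv.
have := dom_L2 du; have := dom_L2 dv; have := app_L2 du; have := app_L2 dv => *.
by rewrite ripBl ?ripBr ?ripZl ?ripZr ?rip_app_sym//; exact: L2Z.
Qed.

Lemma dom_lin (a : R) u v : dom A u -> dom A v -> dom A (a%:C%C *: u + v).
Proof. by move=> du dv; case: saA => -[_ _ H] _ _; case: (H a%:C%C u v du dv). Qed.

Lemma app_lin (a : R) u v : dom A u -> dom A v ->
  app A (a%:C%C *: u + v) = a%:C%C *: app A u + app A v %[ae mu].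
Proof. by move=> du dv; case: saA => -[_ _ H] _ _; case: (H a%:C%C u v du dv). Qed.

Lemma eq_dom u v : dom A u -> cmeasurable v -> u = v %[ae mu] -> dom A v.
Proof. by move=> du mv uv; case: saA => -[_ H _] _ _; case: (H u v du mv uv). Qed.

Lemma eq_app u v : dom A u -> cmeasurable v -> u = v %[ae mu] ->
  app A u = app A v %[ae mu].
Proof. by move=> du mv uv; case: saA => -[_ H _] _ _; case: (H u v du mv uv). Qed.

Lemma resolvent_below (z : R) : resolvent_set mu A z%:C%C ->
  exists2 c, 0 < c & forall u, dom A u -> c * rip mu u u <= rip mu (opshift z u) (opshift z u).
Proof.
(* The constant in [resolvent_set] has no prescribed sign; its maximum with 1 is positive. *)
move=> [_ [c H]]; pose e := Num.max 1 c.
have e0 : 0 < e by rewrite lt_max ltr01.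
exists (e ^- 2); first by rewrite invr_gt0 exprn_gt0.
move=> u du; have := H u du; rewrite -/(opshift z u) !l2norm_sqrt//; last first.
- exact: dom_L2.
- exact: opshift_L2.
rewrite -EFinM lee_fin => {}H; rewrite mulrC ler_pdivrMr ?exprn_gt0//.
have : Num.sqrt (rip mu u u) <= e * Num.sqrt (rip mu (opshift z u) (opshift z u)).
  by apply: le_trans H _; rewrite ler_wpM2r ?sqrtr_ge0// le_max lexx orbT.
rewrite -ler_sqr ?nnegrE ?mulr_ge0 ?sqrtr_ge0 ?(ltW e0)// exprMn.
by rewrite !sqr_sqrtr ?rip_ge0// mulrC.
Qed.

(* For T self-adjoint, |T| bounded below by exactly t makes T^2 - t^2 = (T - t) (T + t) fail to be
   bounded below, so that t or -t is in the spectrum: apply this to almost minimizing vectors in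
   the range of T. *)
Lemma selfadjoint_gap (m h : R) :
  0 < h -> (forall z, m - h < z < m + h -> resolvent_set mu A z%:C%C) ->
  forall u, dom A u -> h ^+ 2 * rip mu u u <= rip mu (opshift m u) (opshift m u).
Proof.
move=> h0 gap u0 du0; rewrite leNgt; apply/negP => small0.
(* s = sup S is the square of the best lower bound of T = A - m. The hypothesis to be refuted gives
   s < h ^+ 2, so m + sqrt s and m - sqrt s both lie in the gap. *)
pose S := [set t : R | 0 <= t /\
  forall u, dom A u -> t * rip mu u u <= rip mu (opshift m u) (opshift m u)].
have [|c c0 below0] := @resolvent_below m; first by apply: gap; lra.
have q0 : 0 < rip mu u0 u0.
  rewrite lt_neqAle rip_ge0 andbT eq_sym; apply/eqP => E.
  by move: small0; rewrite E mulr0 ltNge rip_ge0.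
have ubS : ubound S (rip mu (opshift m u0) (opshift m u0) / rip mu u0 u0).
  by move=> t [_ /(_ _ du0)]; rewrite ler_pdivlMr.
have supS : has_sup S.
  by split; [exists c; split => //; exact: ltW | exists (rip mu (opshift m u0) (opshift m u0) / rip mu u0 u0)].
pose s := sup S.
have cs : c <= s by apply: ub_le_sup; [case: supS | split=> //; exact: ltW].
have s0 : 0 < s := lt_le_trans c0 cs.
have sh : s < h ^+ 2.
  apply: (@le_lt_trans _ _ (rip mu (opshift m u0) (opshift m u0) / rip mu u0 u0)).
    by apply: sup_le_ub => //; case: supS.
  by rewrite ltr_pdivrMr.
pose t := Num.sqrt s; have t0 : 0 < t by rewrite sqrtr_gt0.
have tt : t ^+ 2 = s by rewrite sqr_sqrtr// ltW.
have th : t < h by rewrite -(ltr_sqr) ?nnegrE ?ltW// tt.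
have [cp cp0 belowp] : exists2 c, 0 < c & forall u, dom A u ->
    c * rip mu u u <= rip mu (opshift (m + t) u) (opshift (m + t) u).
  by apply: resolvent_below; apply: gap; lra.
have [cn cn0 belown] : exists2 c, 0 < c & forall u, dom A u ->
    c * rip mu u u <= rip mu (opshift (m - t) u) (opshift (m - t) u).
  by apply: resolvent_below; apply: gap; lra.
have cc0 : 0 < cp * cn by rewrite mulr_gt0.
(* At the end |(T - t) (T + t) w|^2 is at most e (s + e) |w|^2 and at least cp cn |w|^2; this e
   makes the two incompatible. *)
have [e e0 ee] : exists2 e, 0 < e & e * (s + e) < cp * cn.
  exists (Num.min 1 (cp * cn / (s + 2))).
    by rewrite lt_min ltr01 divr_gt0//; lra.
  set e := Num.min _ _.
  have e1 : e <= 1 by rewrite ge_min lexx.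
  have e2 : e <= cp * cn / (s + 2) by rewrite ge_min lexx orbT.
  have e3 : 0 < e by rewrite lt_min ltr01 divr_gt0//; lra.
  have : e * (s + 2) <= cp * cn by rewrite -ler_pdivlMr//; lra.
  by apply: lt_le_trans; rewrite ltr_pM2l//; lra.
have [u du usmall] : exists2 u, dom A u &
    rip mu (opshift m u) (opshift m u) < (s + e) * rip mu u u.
  apply: contrapT => nex.
  have : S (s + e).
    split=> [|u du]; first by lra.
    by rewrite leNgt; apply/negP => ?; apply: nex; exists u.
  by move=> /(ub_le_sup (proj2 supS)); rewrite -/s; lra.
have sle v : dom A v -> s * rip mu v v <= rip mu (opshift m v) (opshift m v).
  move=> dv; have [->|vn0] := eqVneq (rip mu v v) 0; first by rewrite mulr0 rip_ge0.
  have v0 : 0 < rip mu v v by rewrite lt_neqAle eq_sym vn0 rip_ge0.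
  rewrite -ler_pdivlMr//; apply: sup_le_ub; first by case: supS.
  by move=> r [_ /(_ _ dv)]; rewrite ler_pdivlMr.
have Lu := dom_L2 du; have LTu := opshift_L2 m du.
(* As m is in the resolvent set, u = T w. From <T u, w> = |u|^2 and Cauchy-Schwarz, w is almost
   minimizing too: |T w|^2 = |u|^2 <= (s + e) |w|^2. *)
have [w dw Tw] : exists2 w, dom A w & opshift m w = u %[ae mu].
  by have [|+ _] := gap m; [lra | move=> /(_ u Lu)].
have Lw := dom_L2 dw; have LTw := opshift_L2 m dw.
have cm := L2_cmeasurable.
have TwE : rip mu (opshift m w) (opshift m w) = rip mu u u.
  by apply: eq_rip => //; exact: cm.
have TuwE : rip mu (opshift m u) w = rip mu u u.
  by rewrite rip_opshift_sym//; apply: eq_rip => //; try exact: cm; exact: filterE.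
have ws : s * rip mu w w <= rip mu u u by rewrite -TwE; exact: sle.
have ge0w := rip_ge0 mu w; have ge0u := rip_ge0 mu u.
have uw : rip mu u u <= (s + e) * rip mu w w.
  have := rip_cauchy LTu Lw; rewrite TuwE => C.
  have [->|un0] := eqVneq (rip mu u u) 0; first by rewrite mulr_ge0//; lra.
  have u0' : 0 < rip mu u u by rewrite lt_neqAle eq_sym un0.
  rewrite -(ler_pM2l u0') -expr2 (le_trans C)// mulrCA mulrA ler_wpM2r//.
  exact: ltW.
(* y = (T + t) w lies in the domain because u does, and (T - t) y = T u - s w since t^2 = s. *)
pose y := t%:C%C *: w + u; have dy : dom A y := dom_lin t dw du.
have Ly := dom_L2 dy.
have yE : rip mu (opshift (m - t) w) (opshift (m - t) w) = rip mu y y.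
  apply: eq_rip; try exact/cm/opshift_L2; try exact: cm.
    apply: filterS Tw => x + _ => /(_ I).
    rewrite -[opshift m w x]/(app A w x - m%:C%C * w x) -[y x]/(t%:C%C * w x + u x).
    by move=> <-; rewrite -[LHS]/(app A w x - (m - t)%:C%C * w x) rmorphB; ring.
  apply: filterS Tw => x + _ => /(_ I).
  rewrite -[opshift m w x]/(app A w x - m%:C%C * w x) -[y x]/(t%:C%C * w x + u x).
  by move=> <-; rewrite -[LHS]/(app A w x - (m - t)%:C%C * w x) rmorphB; ring.
have TyE : rip mu (opshift (m + t) y) (opshift (m + t) y) =
    rip mu (opshift m u - s%:C%C *: w) (opshift m u - s%:C%C *: w).
  have E : opshift (m + t) y = opshift m u - s%:C%C *: w %[ae mu].
    apply: filterS2 Tw (app_lin t dw du) => x + + _ => /(_ I) + /(_ I).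
    rewrite -[opshift m w x]/(app A w x - m%:C%C * w x).
    move=> Tw Ty; have {}Ty : app A y x = t%:C%C * app A w x + app A u x := Ty.
    rewrite -[LHS]/(app A y x - (m + t)%:C%C * (t%:C%C * w x + u x)) Ty.
    rewrite -[RHS]/(app A u x - m%:C%C * u x - s%:C%C * w x) -tt -Tw rmorphD rmorphXn/=.
    by ring.
  have LT := L2B LTu (L2Z s Lw).
  have LS := opshift_L2 (m + t) dy.
  exact: (eq_rip (cm _ LS) (cm _ LT) (cm _ LS) (cm _ LT) E E).
have := belown w dw; rewrite yE => b1.
have := belowp y dy; rewrite TyE ripB_sqr//; last exact: L2Z.
rewrite !(ripZr, ripZl)//; last exact: L2Z.
rewrite TuwE => b2.
have w0 : 0 < rip mu w w.
  rewrite lt_neqAle ge0w andbT eq_sym; apply/eqP => E.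
  move: usmall; rewrite (_ : rip mu u u = 0) ?mulr0 ?ltNge ?rip_ge0//.
  by apply/eqP; rewrite eq_le ge0u andbT (le_trans uw)// E mulr0.
have : cp * cn * rip mu w w <= e * (s + e) * rip mu w w.
  apply: (@le_trans _ _ (e * rip mu u u)); last by rewrite -mulrA ler_pM2l.
  apply: (@le_trans _ _ (cp * rip mu y y)); first by rewrite -mulrA ler_pM2l.
  apply: le_trans b2 _; have : s * (s * rip mu w w) <= s * rip mu u u by rewrite ler_pM2l.
  lra.
by rewrite ler_pM2r// leNgt ee.
Qed.

End SelfAdjoint.

Section SpectralBound.
Context d (T : measurableType d) (R : realType).
Variable mu : {measure set T -> \bar R}.
Variables (A : l2op T R) (I : Type) (o : I) (lam : I -> R) (n : nat).
Hypotheses (saA : selfadjoint mu A) (specA : spectrum mu A = [set (lam k)%:C%C | k in setT]).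
Hypotheses (lamo : lam o = 0) (Rn0 : Rellich R n < 0).

(** Finiteness of the supremum excludes both degenerate cases: no index other than [o] (the empty
    set has supremum -oo), and some lam k equal to - R_n (the inverse of 0 is +oo). Then s = 1 /
    sqrt M. *)
Lemma Mmax_fin_num_gap : Mmax n o lam \is a fin_num ->
  exists2 s, 0 < s & fine (Mmax n o lam) = s ^- 2 /\
    forall k, k <> o -> s <= `|lam k + Rellich R n|.
Proof.
move=> finM; set M := fine (Mmax n o lam).
have ub k : k <> o -> (((lam k + Rellich R n)%:E ^+ 2)^-1 <= M%:E)%E.
  by move=> ko; rewrite fineK//; apply: ereal_sup_ubound; exists k.
have ub' k : k <> o -> lam k + Rellich R n != 0 /\ (lam k + Rellich R n) ^- 2 <= M.
  move=> /ub; have [->|l0] := eqVneq (lam k + Rellich R n) 0.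
    by rewrite -EFin_expe expr0n inve0.
  by rewrite -EFin_expe inver (negbTE (expf_neq0 2 l0)) lee_fin.
have [[k0 k0o]|nk] := pselect (exists k, k <> o); last first.
  move: finM; rewrite /Mmax [X in ereal_sup X](_ : _ = set0) ?ereal_sup0//.
  by apply/seteqP; split => // x [k /= ko _]; apply: nk; exists k.
have M0 : 0 < M.
  have [l0 lM] := ub' _ k0o; apply: lt_le_trans lM.
  by rewrite invr_gt0 exprn_even_gt0.
exists (Num.sqrt M)^-1; first by rewrite invr_gt0 sqrtr_gt0.
split; first by rewrite exprVn invrK sqr_sqrtr// ltW.
move=> k /ub'[l0 /ler_wsqrtr H].
rewrite -[leRHS]invrK lef_pV2 ?posrE ?sqrtr_gt0 ?invr_gt0 ?normr_gt0//.
by apply: le_trans H; rewrite -exprVn sqrtr_sqr normfV.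
Qed.

(* [(1 - R s^-1)^2 (A + R)^2 - A^2] is a quadratic polynomial in [A] whose roots [l1 < l2] enclose no
   point of the spectrum: it is nonnegative by the gap lemma. *)
Lemma spectral_bound u : Mmax n o lam \is a fin_num -> dom A u ->
  rip mu (app A u) (app A u) <= (1 - Rellich R n * Num.sqrt (fine (Mmax n o lam))) ^+ 2 *
    rip mu (opshift A (- Rellich R n) u) (opshift A (- Rellich R n) u).
Proof.
move=> /Mmax_fin_num_gap[s s0 [-> gap]] du.
rewrite -exprVn sqrtr_sqr ger0_norm ?invr_ge0 ?(ltW s0)//.
move: (Rellich R n) Rn0 gap => r r0 gap; set C := 1 - _.
(* Since s C = s - r, the roots of C^2 (x + r)^2 = x^2 solve (s - r) (x + r) = s x, giving l2, or (s
   - r) (x + r) = - s x, giving l1. The eigenvalue 0 lies below l1; the other lam k are at distance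
   at least s from - r, hence above l2 or below l1. *)
pose l2 := s - r; pose l1 := - r * (s - r) / (2 * s - r).
have sr : 0 < 2 * s - r by lra.
have l1E : l1 * (2 * s - r) = - r * (s - r) by rewrite mulfVK// gt_eqF.
have l10 : 0 < l1 by rewrite divr_gt0// mulr_gt0//; lra.
have l12 : l1 < l2.
  by rewrite -(ltr_pM2r sr) l1E /l2; nra.
have l1s : - r - s < l1.
  by rewrite -(ltr_pM2r sr) l1E; nra.
have Lu := dom_L2 saA du; have LAu := app_L2 saA du.
have G := @selfadjoint_gap _ _ _ mu A saA ((l1 + l2) / 2) ((l2 - l1) / 2).
have {G} := G _ _ u du.
have -> : 0 < (l2 - l1) / 2 by lra.
move=> /(_ isT) G.
have {G} : ((l2 - l1) / 2) ^+ 2 * rip mu u u <=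
    rip mu (opshift A ((l1 + l2) / 2) u) (opshift A ((l1 + l2) / 2) u).
  apply: G => z /andP[z1 z2]; apply: contrapT => nres.
  have : spectrum mu A z%:C%C by [].
  rewrite specA => -[k _] [zk].
  have [ko|/gap] := pselect (k = o).
    by move: z1; rewrite -zk ko lamo; lra.
  by rewrite zk leNgt ltr_norml => /negP; apply; rewrite /l2 in z1 z2; apply/andP; split; lra.
have Lsu := L2Z _ Lu.
rewrite /opshift !ripB_sqr// !(ripZl, ripZr)//.
set a := rip mu (app A u) (app A u); set b := rip mu (app A u) u; set c := rip mu u u.
move=> G.
have {}G : 0 <= a - (l1 + l2) * b + l1 * l2 * c by nra.
have sC : s * C = l2 by rewrite /C /l2; field; rewrite gt_eqF.
rewrite -(ler_pM2l (exprn_gt0 2 s0)) (mulrA (s ^+ 2)) -exprMn sC -subr_ge0.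
rewrite (_ : _ - _ = - r * ((2 * s - r) * (a - (l1 + l2) * b + l1 * l2 * c))).
  by rewrite mulr_ge0 ?mulr_ge0//; lra.
have -> : l1 = - r * (s - r) / (2 * s - r) by [].
by rewrite /l2; field; rewrite gt_eqF.
Qed.

End SpectralBound.

(** * Polar coordinates *)

Section LebesgueScaling.
Variable R : realType.
Local Notation leb := (@lebesgue_measure R).

(** The rescaled push-forward agrees with Lebesgue measure on half-open intervals, which determine
    it. *)
Lemma lebesgue_measure_scale (c : R) (A : set (measurableTypeR R)) : 0 < c -> measurable A ->
  leb A = (c%:E * leb (( *%R c : measurableTypeR R -> measurableTypeR R) @^-1` A))%E.
Proof.
move=> c0 mA.
have mc : measurable_fun setT ( *%R c : measurableTypeR R -> measurableTypeR R).
  exact: mulrl_measurable.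
pose cn := NngNum (ltW c0).
pose nu : {measure set (measurableTypeR R) -> \bar R} :=
  mscale cn (pushforward leb ( *%R c : measurableTypeR R -> measurableTypeR R)).
rewrite (@lebesgue_measure_unique _ (nu mc))//.
move=> _ [[a b] _ <-]; rewrite /nu /= /mscale /= /pushforward.
rewrite (_ : _ @^-1` _ = `]a / c, b / c]%classic); last first.
  by apply/seteqP; split => x /=; rewrite !in_itv/= ltr_pdivrMr// ler_pdivlMr// mulrC.
rewrite !lebesgue_measure_itv/= !lte_fin ltr_pM2r ?invr_gt0//.
case: ifPn => ab; last by rewrite mule0.
by rewrite -!EFinD -EFinM -mulrBl mulrC divfK ?gt_eqF.
Qed.

Lemma ge0_integral_scale (c : R) (f : R -> \bar R) : 0 < c ->
  measurable_fun setT f -> (forall x, 0 <= f x)%E ->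
  (\int[leb]_x f (c * x)%R = c^-1%:E * \int[leb]_x f x)%E.
Proof.
move=> c0 mf f0.
have mc : measurable_fun setT ( *%R c : measurableTypeR R -> measurableTypeR R).
  exact: mulrl_measurable.
pose cn := NngNum (ltW c0).
pose nu : {measure set (measurableTypeR R) -> \bar R} :=
  mscale cn (pushforward leb ( *%R c : measurableTypeR R -> measurableTypeR R)).
rewrite [in RHS](eq_measure_integral (nu mc)); last first.
  by move=> A mA _; exact: (lebesgue_measure_scale c0 mA).
rewrite ge0_integral_mscale// muleA -EFinM mulVf ?gt_eqF// mul1e.
by rewrite ge0_integral_pushforward.
Qed.

End LebesgueScaling.

Section Dilations.
Variable R : realType.
Local Notation leb := (@lebesgue_measure R).
Local Notation lebn := (@lebesgue_eucl R).

Lemma ge0_integral_tcons n (F : Eucl R n.+1 -> \bar R) :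
  measurable_fun setT F -> (forall x, 0 <= F x)%E ->
  (\int[lebn n.+1]_x F x = \int[leb]_a \int[lebn n]_b F (tcons (a, b)))%E.
Proof.
move=> mF F0.
pose nu : {measure set (Eucl R n.+1) -> \bar R} :=
  pushforward (leb \x lebn n)%E (@tcons R n).
rewrite (eq_measure_integral (nu (@measurable_tcons R n)))//.
rewrite ge0_integral_pushforward//; last exact: measurable_tcons.
rewrite preimage_setT fubini_tonelli1//; last by move=> x; exact: F0.
by apply: measurableT_comp => //; exact: measurable_tcons.
Qed.

Lemma measurable_dilate n d (T : measurableType d) (g : T -> R) (h : T -> Eucl R n) :
  measurable_fun setT g -> measurable_fun setT h ->
  measurable_fun setT (fun t => dilate (g t) (h t)).
Proof.
move=> mg mh; apply/measurable_fun_tnthP => i.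
rewrite (_ : _ \o _ = fun t => g t * tnth (h t) i); last first.
  by apply/funext => x /=; rewrite tnth_mktuple.
apply: measurable_funM => //.
by apply: (@measurableT_comp _ _ _ _ _ _ (fun x : Eucl R n => tnth x i)) => //; exact: measurable_tnth.
Qed.

Lemma measurable_dilatel n (s : R) : measurable_fun setT (@dilate R n s).
Proof.
by apply: (@measurable_dilate n _ (Eucl R n) (fun=> s) id); [exact: measurable_cst|exact: measurable_id].
Qed.

Lemma dilate_tcons n s a (b : Eucl R n) : dilate s (tcons (a, b)) = tcons (s * a, dilate s b).
Proof.
apply: eq_from_tnth => i; rewrite tnth_mktuple.
case: (unliftP ord0 i) => [j ->|->]; last by rewrite !tnth0.
by rewrite !tnthS tnth_mktuple.
Qed.

Lemma dilate_dilate n (s t : R) (x : Eucl R n) : dilate s (dilate t x) = dilate (s * t) x.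
Proof. by apply: eq_from_tnth => i; rewrite !tnth_mktuple mulrA. Qed.

Lemma dilate1 n (x : Eucl R n) : dilate 1 x = x.
Proof. by apply: eq_from_tnth => i; rewrite !tnth_mktuple mul1r. Qed.

Lemma enorm_ge0 n (x : Eucl R n) : 0 <= enorm x. Proof. exact: sqrtr_ge0. Qed.

Lemma enorm_dilate n s (x : Eucl R n) : 0 <= s -> enorm (dilate s x) = s * enorm x.
Proof.
move=> s0; rewrite /enorm; under eq_bigr do rewrite tnth_mktuple exprMn.
by rewrite -mulr_sumr sqrtrM ?sqr_ge0// sqrtr_sqr ger0_norm.
Qed.

(** Induction on the dimension: each coordinate contributes one factor s^-1. *)
Lemma ge0_integral_dilate n (s : R) (F : Eucl R n -> \bar R) : 0 < s ->
  measurable_fun setT F -> (forall x, 0 <= F x)%E ->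
  (\int[lebn n]_x F (dilate s x) = (s ^- n)%:E * \int[lebn n]_x F x)%E.
Proof.
move=> s0; elim: n F => [|n IHn] F mF F0.
  rewrite expr0 invr1 mul1e; apply: eq_integral => x _; congr F.
  by apply: eq_from_tnth => -[].
have Ft0 p : (0 <= (F \o @tcons R n) p)%E by exact: F0.
have mFd : measurable_fun setT (F \o dilate s).
  by apply: measurableT_comp => //; exact: measurable_dilatel.
have mt : measurable_fun setT (F \o @tcons R n).
  by apply: measurableT_comp => //; exact: measurable_tcons.
rewrite [LHS](@ge0_integral_tcons _ (F \o dilate s))//; last by move=> x; exact: F0.
under eq_integral.
  move=> a _; under eq_integral do rewrite /= dilate_tcons.
  rewrite (IHn (fun b => F (tcons (s * a, b))))//; last first.
    exact: (measurable_fun_pair2 (s * a : measurableTypeR R) mt).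
  over.
rewrite ge0_integralZl_EFin ?invr_ge0 ?exprn_ge0 ?ltW//; last 2 first.
- by move=> a _; exact: integral_ge0.
- apply: (@measurableT_comp _ _ _ _ _ _ (fun a : measurableTypeR R => \int[lebn n]_b F (tcons (a, b)))%E).
    exact: (measurable_fun_fubini_tonelli_F (F \o @tcons R n) mt Ft0).
  exact: mulrl_measurable.
rewrite (ge0_integral_scale (f := fun a => \int[lebn n]_b F (tcons (a, b)))%E)//; last 2 first.
- exact: (measurable_fun_fubini_tonelli_F (F \o @tcons R n) mt Ft0).
- by move=> a; exact: integral_ge0.
by rewrite muleA -EFinM -invfM -exprSr -ge0_integral_tcons.
Qed.

Lemma ge0_integral_mrestr d (T : measurableType d) (mu : {measure set T -> \bar R})
    (D : set T) (mD : measurable D) (f : T -> \bar R) :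
  measurable_fun setT f -> (forall x, 0 <= f x)%E ->
  (\int[mrestr mu mD]_x f x = \int[mu]_(x in D) f x)%E.
Proof.
move=> mf f0.
rewrite [LHS](ge0_negligible_integral (N := ~` D))//; last 2 first.
- exact: measurableC.
- by rewrite /= /mrestr setICl measure0.
rewrite setTD setCK; apply: eq_measure_integral => A mA AD.
by rewrite /= /mrestr setIidl.
Qed.

Lemma ge0_integral_surface n (G : Eucl R n -> \bar R) :
  measurable_fun setT G -> (forall x, 0 <= G x)%E ->
  (\int[\sigma_(R, n)]_x G x =
   n%:R%:E * \int[lebn n]_(x in @punctured_ball R n) G (direction x))%E.
Proof.
move=> mG G0; rewrite ge0_integral_mscale//; congr (_ * _)%E.
pose nu : {measure set (Eucl R n) -> \bar R} :=
  pushforward (mrestr (lebn n) (@measurable_punctured_ball R n)) (@direction R n).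
rewrite (eq_measure_integral (nu (@measurable_direction R n)))//.
rewrite ge0_integral_pushforward//; last exact: measurable_direction.
rewrite preimage_setT ge0_integral_mrestr//; last by move=> x; exact: G0.
by apply: measurableT_comp => //; exact: measurable_direction.
Qed.

Lemma is_derive_powV n (s : R) : s != 0 ->
  is_derive s 1 (fun s => - (s ^- n.+1) / n.+1%:R) (s ^- n.+2).
Proof.
move=> s0.
have H : is_derive s (1 : R) (fun s => s ^+ n.+1) (n.+1%:R * s ^+ n).
  have -> : (fun s : R => s ^+ n.+1) = id ^+ n.+1 by rewrite exprfctE.
  apply: is_derive_eq.
  by rewrite -[LHS]/((n.+1%:R * s ^+ n) * 1) mulr1.
have H2 := @is_deriveV R (fun s => s ^+ n.+1) s _ 1 (expf_neq0 n.+1 s0) H.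
rewrite (_ : (fun s => _) = (fun s => - n.+1%:R^-1 * (s ^+ n.+1)^-1)); last first.
  by apply/funext => t; rewrite mulNr mulrC mulNr.
apply: (is_derive_eq (is_deriveZ (- n.+1%:R^-1) H2)).
rewrite -[LHS]/(- n.+1%:R^-1 * (- (s ^+ n.+1) ^- 2 * (n.+1%:R * s ^+ n))).
rewrite !exprS; field.
by rewrite s0 /= expf_neq0//= addrC natr1 pnatr_eq0.
Qed.

Lemma integral_powV_tail n (a : R) : 0 < a ->
  (\int[leb]_s (if a < s then s ^- n.+2 else 0)%:E = (a ^- n.+1 / n.+1%:R)%:E)%E.
Proof.
move=> a0.
have cX k : {within `[a, +oo[, continuous (fun s : R => s ^- k)}.
  apply: continuous_in_subspaceT => s /set_mem/=; rewrite in_itv/= andbT => as_.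
  apply: cvgV; first by rewrite expf_neq0// gt_eqF// (lt_le_trans a0).
  exact: exprn_continuous.
transitivity (\int[leb]_(s in `[a, +oo[) (s ^- n.+2)%:E)%E.
  rewrite -integral_itv_obnd_cbnd; last first.
    apply/measurable_EFinP; apply: (@measurable_funS _ _ _ _ `[a, +oo[%classic) => //.
      by apply: subset_itvr; rewrite bnd_simp.
    by apply: subspace_continuous_measurable_fun => //; exact: cX.
  rewrite [RHS]integral_mkcond; apply: eq_integral => s _.
  rewrite patchE; case: ifPn => as_; first by rewrite mem_set//= in_itv/= as_.
  by rewrite memNset//= in_itv/= andbT; apply/negP.
have dF x : a <= x -> is_derive x 1 (fun s => - (s ^- n.+1) / n.+1%:R) (x ^- n.+2).
  by move=> ax; apply: is_derive_powV; rewrite gt_eqF// (lt_le_trans a0).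
rewrite (@ge0_continuous_FTC2y _ _ (fun s => - (s ^- n.+1) / n.+1%:R) a 0).
- by rewrite -EFinD mulNr opprK add0r.
- by move=> x ax; rewrite invr_ge0 exprn_ge0// (le_trans (ltW a0)).
- exact: cX.
- rewrite -[X in _ --> X](mul0r n.+1%:R^-1); apply: cvgM; last exact: cvg_cst.
  rewrite -[X in _ --> X]oppr0; apply: cvgN.
  apply: (@squeeze_cvgr _ _ _ _ (fun=> 0) (fun x : R => x^-1)).
  + near=> x; have x1 : 1 <= x by near: x; apply: nbhs_pinfty_ge; rewrite num_real.
    have x0 : 0 < x by apply: lt_le_trans x1.
    apply/andP; split; first by rewrite invr_ge0 exprn_ge0// ltW.
    rewrite lef_pV2 ?posrE ?exprn_gt0//.
    by rewrite exprS -[leLHS]mulr1 ler_wpM2l ?exprn_ege1// ltW.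
  + exact: cvg_cst.
  + apply/gtr0_cvgV0; last exact: cvg_id.
    by near=> x; near: x; apply: nbhs_pinfty_gt; rewrite num_real.
- by move=> x /ltW /dF [].
- have /derivable1_diffP/differentiable_continuous : derivable (fun s : R => - (s ^- n.+1) / n.+1%:R) a 1.
    by case: (dF a (lexx a)).
  by move=> /cvg_at_right_filter.
- move=> x; rewrite in_itv/= andbT => /ltW/dF H.
  by rewrite derive1E; case: H.
Unshelve. all: by end_near. Qed.

Lemma measurable_ifE d (T : measurableType d) (b : T -> bool) (f : T -> \bar R) :
  measurable_fun setT b -> measurable_fun setT f ->
  measurable_fun setT (fun x => if b x then f x else 0%E).
Proof. by move=> mb mf; apply: measurable_fun_ifT => //; exact: measurable_cst. Qed.

(** The origin is removed through the hyperplane where the first coordinate vanishes, which is null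
    by the iterated construction of the measure. *)
Lemma null_enorm n (F : Eucl R n.+1 -> \bar R) :
  measurable_fun setT F -> (forall x, 0 <= F x)%E ->
  (\int[lebn n.+1]_x F x = \int[lebn n.+1]_x (if (0 < enorm x)%R then F x else 0))%E.
Proof.
move=> mF F0.
pose N : set (Eucl R n.+1) := [set x | tnth x ord0 = 0].
have mN : measurable N.
  have := @measurable_tnth _ (measurableTypeR R) n.+1 ord0 => /(_ measurableT [set 0]).
  by rewrite setTI; apply; exact: measurable_set1.
have N0 : lebn n.+1 N = 0%E.
  rewrite -[N]setIT -integral_indic//.
  rewrite (@ge0_integral_tcons _ (fun x => (\1_N x)%:E)); last 2 first.
  - by apply/measurable_EFinP; exact: measurable_indic.
  - by move=> x; rewrite lee_fin.
  have E a : (\int[lebn n]_b (\1_N (tcons (a, b)))%:E)%E =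
      ((fun a : measurableTypeR R => \int[lebn n]_b (\1_N (tcons (a, b)))%:E)%E \_ [set 0]) a.
    rewrite patchE; case: ifPn => //; rewrite notin_setE => a_neq0.
    apply: integral0_eq => b _; rewrite indicE memNset//= /N /= tnth0.
    by under eq_integral do rewrite E; rewrite -integral_mkcond integral_set1.
apply: ge0_ae_eq_integral => //.
- apply: measurable_ifE => //.
  by apply: measurable_fun_ltr => //; exact: measurable_enorm.
- by move=> x _; case: ifP.
- exists N; split => // x /=; apply: contra_notP => Nx _.
  rewrite ifT// sqrtr_gt0 big_ord_recl ltr_pwDl//; last by rewrite sumr_ge0// => i _; exact: sqr_ge0.
  by rewrite exprn_even_gt0//=; apply/eqP.
Qed.

(** As the surface measure is obtained by coning, the right side is N = n+1 times the integral of
    r^n F(r y / |y|) over r > 0 and 0 < |y| < 1. Substituting r = |y| s for fixed y gives [K2], then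
    x = s y for fixed s gives [K3]. What remains is the integral of s^-(n+2) over s > |x|, namely
    |x|^-(n+1) / (n+1), which cancels N and the weight |x|^(n+1). Only scalings and Tonelli's
    theorem are involved. *)
Lemma ge0_integral_polar n (F : Eucl R n.+1 -> \bar R) :
  measurable_fun setT F -> (forall x, 0 <= F x)%E ->
  (\int[lebn n.+1]_x F x = \int[leb]_(r in `]0%R, +oo[)
     ((r ^+ n)%:E * \int[\sigma_(R, n.+1)]_x F (dilate r x)))%E.
Proof.
move=> mF F0; set N := n.+1.
have menorm := @measurable_enorm R N.
have mdir := @measurable_direction R N.
have mfst := @measurable_fst _ _ (measurableTypeR R) (Eucl R N).
have msnd := @measurable_snd _ _ (measurableTypeR R) (Eucl R N).
have men2 : measurable_fun setT (fun p : measurableTypeR R * Eucl R N => enorm p.2).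
  exact: measurableT_comp.
pose K (p : measurableTypeR R * Eucl R N) : \bar R :=
  if 0 < p.1 then if (0 < enorm p.2) && (enorm p.2 < 1) then
    ((p.1 ^+ n)%:E * F (dilate p.1 (direction p.2)))%E else 0%E else 0%E.
have mK : measurable_fun setT K.
  apply: measurable_ifE; first exact: measurable_fun_ltr.
  apply: measurable_ifE; first by apply: measurable_and; exact: measurable_fun_ltr.
  apply: emeasurable_funM; first exact/measurable_EFinP/measurable_funX.
  apply: measurableT_comp => //.
  by apply: measurable_dilate => //; exact: measurableT_comp.
have K0 p : (0 <= K p)%E.
  rewrite /K; case: ifPn => // p0; case: ifPn => // _.
  by rewrite mule_ge0// lee_fin exprn_ge0// ltW.
transitivity (N%:R%:E * \int[leb]_r \int[lebn N]_y K (r, y))%E; last first.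
  rewrite -ge0_integralZl//; last 2 first.
  - exact: (measurable_fun_fubini_tonelli_F K).
  - by move=> r _; exact: integral_ge0.
  rewrite [RHS]integral_mkcond; apply: eq_integral => r _.
  rewrite patchE; case: ifPn => [|/negP r0]; last first.
    rewrite integral0_eq ?mule0// => y _; rewrite /K /= ifN//.
    by apply/negP => r1; apply: r0; rewrite inE/= in_itv/= r1.
  rewrite inE/= in_itv/= andbT => r0.
  rewrite ge0_integral_surface//; last first.
    by apply: measurableT_comp => //; exact: measurable_dilatel.
  rewrite muleCA; congr (_ * _)%E.
  rewrite -ge0_integralZl_EFin//; last 3 first.
  - exact: measurable_punctured_ball.
  - apply: measurable_funTS; apply: (measurableT_comp mF).
    exact: measurable_dilate.
  - by rewrite exprn_ge0// ltW.
  rewrite [RHS]integral_mkcond; apply: eq_integral => y _; rewrite /K /= r0 patchE.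
  by have -> : (y \in @punctured_ball R N) = (0 < enorm y < 1) by apply/idP/idP; rewrite inE.
rewrite (fubini_tonelli K mK K0).
pose K2 (p : measurableTypeR R * Eucl R N) : \bar R :=
  if 0 < p.1 then if (0 < enorm p.2) && (enorm p.2 < 1) then
    ((p.1 ^+ n * enorm p.2 ^+ N)%:E * F (dilate p.1 p.2))%E else 0%E else 0%E.
have mK2 : measurable_fun setT K2.
  apply: measurable_ifE; first exact: measurable_fun_ltr.
  apply: measurable_ifE; first by apply: measurable_and; exact: measurable_fun_ltr.
  apply: emeasurable_funM; last exact/(measurableT_comp mF)/measurable_dilate.
  by apply/measurable_EFinP/measurable_funM; exact: measurable_funX.
have K20 p : (0 <= K2 p)%E.
  rewrite /K2; case: ifPn => // p0; case: ifPn => // _.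
  by rewrite mule_ge0// lee_fin mulr_ge0// exprn_ge0// ?enorm_ge0// ltW.
transitivity (N%:R%:E * \int[leb]_s \int[lebn N]_y K2 (s, y))%E; last first.
  rewrite (fubini_tonelli K2 mK2 K20); apply: congr1; apply: eq_integral => y _.
  have [y0|y0] := ltP 0 (enorm y); last first.
    by apply: eq_integral => r _; rewrite /K /K2 /= (ltNge 0 (enorm y)) y0; case: ifP.
  transitivity (\int[leb]_r ((enorm y)^-1%:E * K2 (((enorm y)^-1 * r)%R, y)))%E; last first.
    apply: eq_integral => r _; rewrite /K /K2 /= y0 pmulr_rgt0 ?invr_gt0//.
    case: ifPn => r0; last by rewrite mule0.
    case: ifPn => y1; last by rewrite mule0.
    rewrite /direction dilate_dilate (mulrC r) muleA -EFinM; congr (_%:E * _)%E.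
    rewrite exprMn exprVn /N exprS; field.
    by rewrite expf_neq0 gt_eqF.
  rewrite ge0_integralZl_EFin//; last 2 first.
  - apply: (@measurableT_comp _ _ _ _ _ _ (fun s : measurableTypeR R => K2 (s, y))).
      exact: measurable_fun_pair1.
    exact: mulrl_measurable.
  - by rewrite invr_ge0 enorm_ge0.
  rewrite (ge0_integral_scale (f := fun s : R => K2 (s, y))) ?invr_gt0//; last exact: measurable_fun_pair1.
  by rewrite invrK muleA -EFinM mulVf ?gt_eqF// mul1e.
(* The power -1 of [powR] agrees with the inverse for s > 0, and it is measurable on the whole
   line. *)
pose K3 (p : measurableTypeR R * Eucl R N) : \bar R :=
  if 0 < p.1 then if (0 < enorm p.2) && (enorm p.2 < p.1) then
    (((p.1 `^ (-1)) ^+ n.+2 * enorm p.2 ^+ N)%:E * F p.2)%E else 0%E else 0%E.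
have mK3 : measurable_fun setT K3.
  apply: measurable_ifE; first exact: measurable_fun_ltr.
  apply: measurable_ifE; first by apply: measurable_and; exact: measurable_fun_ltr.
  apply: emeasurable_funM; last exact: measurableT_comp.
  apply/measurable_EFinP/measurable_funM; last exact: measurable_funX.
  by apply: measurable_funX; exact: (measurableT_comp (measurable_powR _)).
have K30 p : (0 <= K3 p)%E.
  rewrite /K3; case: ifPn => // p0; case: ifPn => // _.
  by rewrite mule_ge0// lee_fin mulr_ge0 ?exprn_ge0// ?powR_ge0 ?enorm_ge0.
transitivity (N%:R%:E * \int[leb]_s \int[lebn N]_x K3 (s, x))%E; last first.
  apply: congr1; apply: eq_integral => s _.
  have [s0|s0] := ltP 0 s; last first.
    by apply: eq_integral => x _; rewrite /K2 /K3 /= (ltNge 0 s) s0.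
  pose G x : \bar R := ((s ^+ N)%:E * K3 (s, x))%E.
  have mG : measurable_fun setT G.
    by apply: measurable_funeM; exact: measurable_fun_pair2.
  have G0 x : (0 <= G x)%E by rewrite mule_ge0// lee_fin exprn_ge0// ltW.
  transitivity (\int[lebn N]_x G (dilate s x))%E.
    rewrite ge0_integral_dilate// ge0_integralZl_EFin ?exprn_ge0 ?ltW//; last exact: measurable_fun_pair2.
    by rewrite muleA -EFinM mulVf ?mul1e// expf_neq0// gt_eqF.
  apply: eq_integral => x _; rewrite /G /K2 /K3 /= s0 enorm_dilate ?ltW// pmulr_rgt0//.
  rewrite -[in RHS](gtr_pMr _ s0).
  case: ifPn => x0; last by rewrite mule0.
  rewrite muleA -EFinM; congr (_%:E * _)%E.
  rewrite powR_inv1 ?ltW// exprVn exprMn /N !exprS; field.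
  by rewrite expf_neq0 gt_eqF.
rewrite (fubini_tonelli K3 mK3 K30) (null_enorm mF F0) -ge0_integralZl//; last 2 first.
- exact: (measurable_fun_fubini_tonelli_G K3).
- by move=> r _; exact: integral_ge0.
apply: eq_integral => x _; rewrite /K3 /=.
case: ifPn => x0; last first.
  by rewrite integral0_eq ?mule0// => s _; case: ifP.
transitivity (N%:R%:E * \int[leb]_s (((enorm x ^+ N)%:E * F x) * (if enorm x < s then s ^- n.+2 else 0)%:E))%E.
  rewrite ge0_integralZl//; last 3 first.
  - rewrite (_ : (fun _ => _) =
        (fun s => if enorm x < s then ((s `^ (-1)) ^+ n.+2)%:E else 0%E)); last first.
      apply/funext => s; case: ifPn => // xs.
      by rewrite powR_inv1 ?exprVn// (le_trans (ltW x0))// ltW.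
    apply: measurable_ifE; first exact: measurable_fun_ltr.
    by apply/measurable_EFinP/measurable_funX; exact: measurable_powR.
  - move=> s _; case: ifPn => // xs.
    by rewrite lee_fin invr_ge0 exprn_ge0// ltW// (lt_trans x0).
  - by rewrite mule_ge0// lee_fin exprn_ge0// enorm_ge0.
  rewrite integral_powV_tail// -muleA !(muleCA _ (F x)) -!EFinM.
  rewrite /N [X in n.+1%:R * X]mulrA divff ?expf_neq0 ?gt_eqF// mul1r divff ?pnatr_eq0//.
  by rewrite mule1.
apply: congr1; apply: eq_integral => s _; case: ifPn => xs; last first.
  by rewrite mule0; case: ifP.
have s0 : 0 < s := lt_trans x0 xs.
by rewrite s0 powR_inv1 ?ltW// exprVn /= muleAC -EFinM mulrC.
Qed.

End Dilations.

Section Slices.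
Variables (R : realType) (n : nat).
Local Notation leb := (@lebesgue_measure R).
Local Notation E := (Eucl R n.+1).
Local Notation mu := (lebesgue_eucl R n.+1).
Local Notation sigma := (\sigma_(R, n.+1)).

(** Rewritten over the punctured ball, the integral is a Tonelli section for the sigma-finite
    [lebesgue_eucl], hence measurable in r. *)
Lemma measurable_integral_slice (F : E -> \bar R) :
  measurable_fun setT F -> (forall x, 0 <= F x)%E ->
  measurable_fun setT (fun r : R => \int[sigma]_x F (dilate r x))%E.
Proof.
move=> mF F0.
rewrite (_ : (fun r => _) = (fun r => n.+1%:R%:E *
    \int[mu]_y ((fun y => F (dilate r (direction y))) \_ (@punctured_ball R n.+1)) y))%E; last first.
  apply/funext => r; rewrite ge0_integral_surface// -?integral_mkcond//.
  by apply: measurableT_comp => //; exact: measurable_dilatel.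
apply: measurable_funeM.
pose K (p : measurableTypeR R * E) : \bar R :=
  if (0 < enorm p.2) && (enorm p.2 < 1) then F (dilate p.1 (direction p.2)) else 0%E.
have mK : measurable_fun setT K.
  have men2 : measurable_fun setT (fun p : measurableTypeR R * E => enorm p.2).
    by apply: (measurableT_comp (@measurable_enorm R n.+1)); exact: measurable_snd.
  apply: measurable_ifE; first by apply: measurable_and; exact: measurable_fun_ltr.
  apply: (measurableT_comp mF); apply: measurable_dilate; first exact: measurable_fst.
  by apply: (measurableT_comp (@measurable_direction R n.+1)); exact: measurable_snd.
have K0 p : (0 <= K p)%E by rewrite /K; case: ifP.
have := measurable_fun_fubini_tonelli_F (m2 := mu) K mK K0; congr (measurable_fun _ _).
apply/funext => r; apply: eq_integral => y _; rewrite /K /= patchE.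
by have -> : (y \in @punctured_ball R n.+1) = (0 < enorm y < 1) by apply/idP/idP; rewrite inE.
Qed.

Lemma surface_ae_norm : \forall x \ae sigma, enorm x = 1.
Proof.
have mA : measurable [set x : E | enorm x != 1].
  rewrite (_ : mkset _ = @enorm R n.+1 @^-1` (~` [set 1])); last first.
    by apply/seteqP; split => x /= /eqP.
  rewrite -[X in measurable X]setTI; apply: measurable_enorm => //.
  by apply: measurableC; exact: measurable_set1.
exists [set x : E | enorm x != 1]; split => //; last by move=> x /= /eqP.
rewrite -[X in sigma X]setIT -integral_indic// ge0_integral_surface//; last first.
  by apply/measurable_EFinP; exact: measurable_indic.
rewrite integral0_eq ?mule0// => x /andP[x0 _]; rewrite indicE memNset//=.
rewrite /direction enorm_dilate ?invr_ge0 ?enorm_ge0// mulVf ?eqxx//.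
by rewrite gt_eqF.
Qed.

Lemma slice_radial (a : R -> R) (u : E -> R[i]) r : 0 < r ->
  slice (fun x => (a (enorm x))%:C%C * u x) r = (a r)%:C%C *: slice u r %[ae sigma].
Proof.
move=> r0; apply: filterS surface_ae_norm => x x1 _.
by rewrite /slice enorm_dilate ?ltW// x1 mulr1.
Qed.

Lemma cmeasurable_slice (u : E -> R[i]) r : cmeasurable u -> cmeasurable (slice u r).
Proof.
by move=> [ru iu]; split; [apply: (measurableT_comp ru)|apply: (measurableT_comp iu)];
  exact: measurable_dilatel.
Qed.

Lemma measurable_l2sq_slice (u : E -> R[i]) : cmeasurable u ->
  measurable_fun setT (fun r : R => l2sq sigma (slice u r)).
Proof.
move=> mu_; apply: (@measurable_integral_slice (fun x => (rdot (u x) (u x))%:E)).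
  exact/measurable_EFinP/measurable_rdot.
by move=> x; rewrite lee_fin rdot_ge0.
Qed.

Lemma l2sq_polar (u : E -> R[i]) : cmeasurable u ->
  (l2sq mu u = \int[leb]_(r in `]0%R, +oo[) ((r ^+ n)%:E * l2sq sigma (slice u r)))%E.
Proof.
move=> mu_; rewrite /l2sq ge0_integral_polar//; first exact/measurable_EFinP/measurable_rdot.
by move=> x; rewrite lee_fin rdot_ge0.
Qed.

Lemma measurable_polar_density (u : E -> R[i]) (D : set R) : cmeasurable u ->
  measurable_fun D (fun r : R => ((r ^+ n)%:E * l2sq sigma (slice u r))%E).
Proof.
move=> mu_; apply: measurable_funTS; apply: emeasurable_funM; last exact: measurable_l2sq_slice.
by apply/measurable_EFinP; exact: exprn_measurable.
Qed.

Lemma polar_density_ge0 (u : E -> R[i]) r : 0 < r -> (0 <= (r ^+ n)%:E * l2sq sigma (slice u r))%E.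
Proof. by move=> r0; rewrite mule_ge0 ?l2sq_ge0// lee_fin exprn_ge0// ltW. Qed.

(** Polarization: the claim is equivalent to |u + v|^2 + |u' - v'|^2 <= |u - v|^2 + |u' + v'|^2.
    These are integrals of nonnegative functions, to which polar coordinates apply, whereas [rip]
    has a signed integrand. *)
Lemma rip_le_slices (u v u' v' : E -> R[i]) :
  L2 mu u -> L2 mu v -> L2 mu u' -> L2 mu v' ->
  {ae leb, forall r, 0 < r -> [/\ L2 sigma (slice u r), L2 sigma (slice v r),
    L2 sigma (slice u' r), L2 sigma (slice v' r) &
    rip sigma (slice u r) (slice v r) <= rip sigma (slice u' r) (slice v' r)]} ->
  rip mu u v <= rip mu u' v'.
Proof.
move=> Lu Lv Lu' Lv' H.
have cm (w : E -> R[i]) : L2 mu w -> cmeasurable w by case.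
have Lp := L2D Lu Lv; have Lm := L2B Lu Lv.
have Lp' := L2D Lu' Lv'; have Lm' := L2B Lu' Lv'.
suff : (l2sq mu (u + v)%R + l2sq mu (u' - v')%R <= l2sq mu (u - v)%R + l2sq mu (u' + v')%R)%E.
  by rewrite !l2sqE// -!EFinD lee_fin !(ripB_sqr, ripD_sqr)//; lra.
rewrite !l2sq_polar; try exact: cm.
have mp w : cmeasurable w -> measurable_fun (`]0, +oo[%classic : set R)
    (fun r : R => ((r ^+ n)%:E * l2sq sigma (slice w r))%E).
  exact: measurable_polar_density.
have p0 (w : E -> R[i]) r : `]0, +oo[%classic r -> (0 <= (r ^+ n)%:E * l2sq sigma (slice w r))%E.
  by rewrite /= in_itv/= andbT; exact: polar_density_ge0.
have D w1 w2 (c1 : cmeasurable w1) (c2 : cmeasurable w2) :=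
  ge0_integralD leb (measurable_itv `]0, +oo[) (p0 w1) (mp w1 c1) (p0 w2) (mp w2 c2).
rewrite -(D _ _ (cm _ Lp) (cm _ Lm')) -(D _ _ (cm _ Lm) (cm _ Lp')) {D}.
apply: ae_ge0_le_integral => //.
- by move=> r r0; rewrite adde_ge0// p0.
- by apply: emeasurable_funD; apply: mp; exact: cm.
- by move=> r r0; rewrite adde_ge0// p0.
- by apply: emeasurable_funD; apply: mp; exact: cm.
have F : Filter (nbhs (almost_everywhere leb)) by exact: ae_filter_ringOfSetsType.
apply: filterS H => r H; rewrite /= in_itv/= andbT => r0; have [Su Sv Su' Sv' le] := H r0.
rewrite -!ge0_muleDr ?l2sq_ge0//; apply: lee_wpmul2l; first by rewrite lee_fin exprn_ge0// ltW.
rewrite -![slice (_ + _) r]/(slice _ r + slice _ r) -![slice (- _) r]/(- slice _ r).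
have := L2D Su Sv; have := L2B Su Sv; have := L2D Su' Sv'; have := L2B Su' Sv' => *.
by rewrite !l2sqE// -!EFinD lee_fin !(ripB_sqr, ripD_sqr)//; lra.
Qed.

(** Only radii in (0, b] contribute, and r^n <= b^n there. *)
Lemma l2sq_le_bounded (u : E -> R[i]) (b K : R) : cmeasurable u -> 0 <= b -> 0 <= K ->
  {ae leb, forall r, 0 < r -> (l2sq sigma (slice u r) <= K%:E)%E} ->
  {ae leb, forall r, b < r -> (l2sq sigma (slice u r) = 0)%E} ->
  (l2sq mu u <= (K * b ^+ n.+1)%:E)%E.
Proof.
move=> mu_ b0 K0 HK H0; rewrite l2sq_polar//.
apply: (@le_trans _ _ (\int[leb]_(r in `]0%R, +oo[) (((b ^+ n * K)%:E * (\1_(`[0, b]) r)%:E)))%E).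
  apply: ae_ge0_le_integral => //.
  - by move=> r; rewrite /= in_itv/= andbT; exact: polar_density_ge0.
  - exact: measurable_polar_density.
  - by move=> r _; rewrite mule_ge0// lee_fin ?mulr_ge0 ?exprn_ge0.
  - by apply: measurable_funeM; apply/measurable_EFinP; exact: measurable_indic.
  have F : Filter (nbhs (almost_everywhere leb)) by exact: ae_filter_ringOfSetsType.
  apply: filterS2 HK H0 => r HK H0; rewrite /= in_itv/= andbT => r0.
  have [rb|rb] := leP r b; last by rewrite H0// mule0 mule_ge0// lee_fin ?mulr_ge0 ?exprn_ge0.
  rewrite indicE mem_set/= ?in_itv/= ?(ltW r0)// mule1 EFinM.
  apply: lee_pmul; rewrite ?l2sq_ge0 ?HK//; first by rewrite lee_fin exprn_ge0// ltW.
  by rewrite lee_fin lerXn2r ?nnegrE// ltW.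
rewrite ge0_integralZl_EFin ?mulr_ge0 ?exprn_ge0//; last first.
  by apply/measurable_EFinP; exact: measurable_indic.
rewrite integral_indic//.
apply: (@le_trans _ _ ((b ^+ n * K)%:E * leb `[0%R, b]%classic)%E).
  apply: lee_wpmul2l; first by rewrite lee_fin mulr_ge0 ?exprn_ge0.
  by apply: le_measure; rewrite ?inE//; exact: measurableI.
rewrite lebesgue_measure_itv/= lte_fin; case: ifPn => b0'; last first.
  by rewrite mule0 lee_fin mulr_ge0 ?exprn_ge0.
by rewrite -EFinB -EFinM lee_fin subr0 mulrAC -exprSr mulrC.
Qed.

(** Identities known for almost every radius are needed at r and at e^t r simultaneously. *)
Lemma ae_scale (c : R) (P : set R) : 0 < c ->
  {ae leb, forall r, P r} -> {ae leb, forall r, P (c * r)}.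
Proof.
move=> c0 [A [mA A0 PA]]; exists (( *%R c) @^-1` A); split.
- rewrite -[X in measurable X]setTI.
  exact: (@mulrl_measurable R setT c measurableT _ mA).
- have := lebesgue_measure_scale c0 mA; rewrite A0 => /esym/eqP.
  by rewrite mule_eq0 eqe gt_eqF//= => /eqP.
- by move=> r /= /PA.
Qed.

End Slices.

(** * Radial derivatives *)

Lemma is_derive_near (R : realType) (F : R -> R) (r l : R) :
  (forall e, 0 < e -> \forall h \near 0^', `|h^-1 * (F (r + h) - F r) - l| < e) ->
  is_derive r (1 : R) F l.
Proof.
move=> H.
have cF : h^-1 *: ((F \o shift r) (h *: (1 : R)) - F r) @[h --> 0^'] --> l.
  apply/cvgrPdist_lt => e e0; apply: filterS (H e e0) => h.
  by rewrite distrC /= -[h%:A]/(h * 1) mulr1 (addrC h r).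
by split; [apply/cvg_ex; exists l|exact/cvg_lim].
Qed.

Lemma ripD_le d (T : measurableType d) (R : realType) (mu : {measure set T -> \bar R}) u v :
  L2 mu u -> L2 mu v -> rip mu (u + v) (u + v) <= 2 * rip mu u u + 2 * rip mu v v.
Proof.
move=> Lu Lv; have := rip_ge0 mu (u - v).
by rewrite ripB_sqr// ripD_sqr//; lra.
Qed.

Section RadialCalculus.
Variables (R : realType) (n : nat).
Local Notation E := (Eucl R n).
Local Notation sigma := (\sigma_(R, n)).
Implicit Types (f g : E -> R[i]).

(** The quantity whose norm tends to 0 in [is_radial_derivative]; it is estimated through [rip], so
    that bounds stay in R. *)
Definition quot_err f g r (h : R) : E -> R[i] :=
  (h^-1)%:C%C *: (slice f (r + h) - slice f r) - slice g r.

Lemma near_pos_shift (r : R) : 0 < r -> \forall h \near 0^', 0 < r + h.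
Proof.
move=> r0; apply: filterS (dnbhs0_lt r0) => h.
by rewrite ltr_norml; lra.
Qed.

Lemma dnbhs0_neq_lt (e : R) : 0 < e -> \forall h \near (0 : R)^', h != 0 /\ `|h| < e.
Proof.
move=> e0; apply: filterI (dnbhs0_lt e0).
by exists 1 => //= x _.
Qed.

Lemma quot_err_small f g : L2slices f -> is_radial_derivative f g ->
  forall r e, 0 < r -> 0 < e -> \forall h \near 0^', rip sigma (quot_err f g r h) (quot_err f g r h) < e.
Proof.
move=> [_ Lf] [[_ Lg] fg] r e r0 e0.
have /fine_cvgP[_] := fg r r0.
move=> /cvgrPdist_lt/(_ (Num.sqrt e)); rewrite sqrtr_gt0 => /(_ e0) H.
apply: filterS2 (near_pos_shift r0) H => h rh0.
have LE : L2 sigma (quot_err f g r h).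
  by apply: L2B; [apply: L2Z; apply: L2B; exact: Lf|exact: Lg].
rewrite /= -[X in l2norm _ X]/(quot_err f g r h) l2norm_sqrt//= sub0r normrN ger0_norm ?sqrtr_ge0//.
by rewrite ltr_sqrt.
Qed.

Lemma is_derive_rip f g (v : E -> R[i]) (r : R) : L2slices f -> is_radial_derivative f g ->
  L2 sigma v -> 0 < r ->
  is_derive r (1 : R) (fun r : R => rip sigma (slice f r) v) (rip sigma (slice g r) v).
Proof.
move=> Lf fg Lv r0; have [_ Lf'] := Lf; have [[_ Lg'] _] := fg.
apply: is_derive_near => e e0.
have v0 := rip_ge0 sigma v.
have ev0 : 0 < e ^+ 2 / (rip sigma v v + 1) by rewrite divr_gt0 ?exprn_gt0//; lra.
apply: filterS2 (near_pos_shift r0) (quot_err_small Lf fg r0 ev0) => h rh0 H.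
have L1 := Lf' _ r0; have Lrh := Lf' _ rh0; have L3 := Lg' _ r0.
have L4 := L2B Lrh L1; have L5 := L2Z h^-1 L4; have L6 := L2B L5 L3.
rewrite -ripBl// -ripZl// -ripBl// -/(quot_err f g r h).
rewrite -ltr_sqr ?nnegrE ?(ltW e0)// real_normK ?num_real//.
apply: le_lt_trans (rip_cauchy L6 Lv) _; move: H; rewrite ltr_pdivlMr; last by lra.
apply: le_lt_trans; have := rip_ge0 sigma (quot_err f g r h).
by rewrite -/(quot_err f g r h); nra.
Qed.

(** The squared norm is even differentiable, with derivative 2 <g, f>. Continuity gives a bound on
    the compact radial support by the extreme value theorem. *)
Lemma continuous_rip_slice f g (r : R) : L2slices f -> is_radial_derivative f g -> 0 < r ->
  {for r, continuous (fun r : R => rip sigma (slice f r) (slice f r))}.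
Proof.
move=> Lf fg r0; have [_ Lf'] := Lf; have [[_ Lg'] _] := fg.
apply/differentiable_continuous/derivable1_diffP.
suff [] : is_derive r (1 : R) (fun r : R => rip sigma (slice f r) (slice f r))
    (2 * rip sigma (slice g r) (slice f r)) by [].
apply: is_derive_near => e e0.
have L1 := Lf' _ r0; have L3 := Lg' _ r0.
set qf := rip sigma (slice f r) (slice f r); set qg := rip sigma (slice g r) (slice g r).
have qf0 : 0 <= qf by exact: rip_ge0.
have qg0 : 0 <= qg by exact: rip_ge0.
(* These thresholds make each of the two terms of the identity below at most e / 2. *)
have d10 : 0 < Num.min 1 ((e / 4) ^+ 2 / (qf + 1)).
  by rewrite lt_min ltr01 divr_gt0 ?exprn_gt0 ?divr_gt0//; lra.
have d20 : 0 < e / (4 * (1 + qg)) by rewrite divr_gt0// mulr_gt0//; lra.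
apply: filterS3 (near_pos_shift r0) (quot_err_small Lf fg r0 d10) (dnbhs0_neq_lt d20) => h rh0.
rewrite lt_min => /andP[HE1 HE2] [h0 Hh].
have Lrh := Lf' _ rh0; have L4 := L2B Lrh L1; have L5 := L2Z h^-1 L4; have L6 := L2B L5 L3.
have -> : h^-1 * (rip sigma (slice f (r + h)) (slice f (r + h)) - qf) - 2 * rip sigma (slice g r) (slice f r) =
    2 * rip sigma (quot_err f g r h) (slice f r) + h * rip sigma (quot_err f g r h + slice g r) (quot_err f g r h + slice g r).
  rewrite /quot_err subrK ripZl ?ripZr ?ripBl ?ripZl ?ripBr ?ripBl// (ripC _ (slice f r) (slice f (r + h))) -/qf.
  by field.
move: HE1 HE2; rewrite -/(quot_err f g r h) in L6 *; set err := quot_err f g r h in L6 *.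
have C := rip_cauchy L6 L1; have D := ripD_le L6 L3.
have E0 := rip_ge0 sigma err; have F0 := rip_ge0 sigma (err + slice g r).
rewrite ltr_pdivlMr; last by lra.
move=> HE1 HE2.
apply: le_lt_trans (ler_normD _ _) _; rewrite !normrM.
have b1 : `|2 : R| * `|rip sigma err (slice f r)| < e / 2.
  rewrite (ger0_norm (_ : 0 <= 2 :> R))//.
  suff : `|rip sigma err (slice f r)| < e / 4 by lra.
  rewrite -ltr_sqr ?nnegrE ?divr_ge0 ?(ltW e0)// real_normK ?num_real//.
  by apply: le_lt_trans C _; rewrite -/qf; nra.
have b2 : `|h| * `|rip sigma (err + slice g r) (err + slice g r)| <= e / 2.
  rewrite (ger0_norm F0); move: Hh; rewrite ltr_pdivlMr; last by rewrite mulr_gt0//; lra.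
  move=> Hh; apply: le_trans (ler_wpM2l (normr_ge0 h) D) _; rewrite -/qg.
  by have := normr_ge0 h; nra.
by lra.
Qed.

(** Off the closed interval, f vanishes at r and at every nearby r + h, so the error of the
    difference quotient reduces to - g there, up to null sets. *)
Lemma radial_derivative_support f g (a b : R) : L2slices f -> is_radial_derivative f g ->
  (forall r, 0 < r -> ~ (a <= r <= b) -> rip sigma (slice f r) (slice f r) = 0) ->
  forall r, 0 < r -> ~ (a <= r <= b) -> rip sigma (slice g r) (slice g r) = 0.
Proof.
move=> Lf fg f0 r r0 rab; have [_ Lf'] := Lf; have [[_ Lg'] _] := fg.
have L1 := Lf' _ r0; have L3 := Lg' _ r0.
apply/eqP; rewrite eq_le rip_ge0 andbT; apply/ler_addgt0Pl => e e0; rewrite addr0.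
have e20 : 0 < e / 2 by rewrite divr_gt0.
have near_out : \forall h \near 0^', ~ (a <= r + h <= b).
  have [ra|ra] := ltP r a.
    have ra0 : 0 < a - r by lra.
    apply: filterS (dnbhs0_lt ra0) => h; rewrite ltr_norml => /andP[_ ?] /andP[? _]; lra.
  have rb : 0 < r - b by rewrite subr_gt0 ltNge; apply/negP => rb; apply: rab; rewrite ra rb.
  by apply: filterS (dnbhs0_lt rb) => h; rewrite ltr_norml => /andP[? _] /andP[_ ?]; lra.
have [h [rh0 [nab H]]] := filter_ex (filterI (near_pos_shift r0)
  (filterI near_out (quot_err_small Lf fg r0 e20))).
have Lrh := Lf' _ rh0.
have L4 := L2B Lrh L1; have L5 := L2Z h^-1 L4; have L6 := L2B L5 L3.
have q0 : rip sigma (slice f (r + h) - slice f r) (slice f (r + h) - slice f r) = 0.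
  apply/eqP; rewrite eq_le rip_ge0 andbT; have := rip_ge0 sigma (slice f (r + h) + slice f r).
  by rewrite ripB_sqr// ripD_sqr// !f0//; lra.
have := ripD_le L5 (L2N L6); rewrite (ripNl L6 (L2N L6)) (ripNr L6 L6) opprK.
rewrite -/(quot_err f g r h) (_ : _ - quot_err f g r h = slice g r); last first.
  by rewrite opprB addrC subrK.
by rewrite ripZl ?ripZr// q0 -/(quot_err f g r h); lra.
Qed.

Lemma rip_slice_bounded f g (a b : R) : L2slices f -> is_radial_derivative f g -> 0 < a -> a <= b ->
  (forall r, 0 < r -> ~ (a <= r <= b) -> rip sigma (slice f r) (slice f r) = 0) ->
  exists2 K, 0 <= K & forall r, 0 < r -> rip sigma (slice f r) (slice f r) <= K.
Proof.
move=> Lf fg a0 ab f0.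
have : {within `[a, b], continuous (fun r : R => rip sigma (slice f r) (slice f r))}.
  apply: continuous_in_subspaceT => r /set_mem/=; rewrite in_itv/= => /andP[ar _].
  by apply: (continuous_rip_slice Lf fg); exact: lt_le_trans ar.
move=> /(EVT_max ab)[c cab H].
exists (rip sigma (slice f c) (slice f c)); first exact: rip_ge0.
move=> r r0; have [rab|rab] := boolP (r \in `[a, b]); first exact: H.
by rewrite f0 ?rip_ge0//; move: rab; rewrite in_itv/= => /negP.
Qed.

End RadialCalculus.

(** * Scalar Taylor estimates and the exact difference inequality *)

Lemma mvt_bound (R : realType) (f df : R -> R) (a b K : R) : a <= b ->
  (forall x, is_derive x (1 : R) f (df x)) -> (forall x, a <= x <= b -> `|df x| <= K) ->
  `|f b - f a| <= K * (b - a).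
Proof.
move=> ab fdf dfK.
have cf : {within `[a, b], continuous f}.
  apply: continuous_in_subspaceT => x _.
  by apply/differentiable_continuous/derivable1_diffP; case: (fdf x).
have [c] := MVT_segment ab (fun x _ => fdf x) cf.
rewrite in_itv/= => cab ->; rewrite normrM (ger0_norm (_ : 0 <= b - a)) ?subr_ge0//.
by rewrite ler_wpM2r ?subr_ge0//; exact: dfK.
Qed.

Lemma is_derive_oppcomp (R : realType) (f df : R -> R) (t : R) :
  (forall x, is_derive x (1 : R) f (df x)) ->
  is_derive t (1 : R) (fun t => f (- t)) (- df (- t)).
Proof.
move=> fdf; rewrite -[X in is_derive _ _ _ X]mulrN1.
apply: (@is_derive1_comp R f -%R); exact: is_deriveNid.
Qed.

(** The coefficients are those of a second difference plus twice a centred first difference. The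
    bound on P3 controls the former up to 2 K h, the bound on P2 controls the latter up to 2 K h. *)
Lemma taylor_difference (R : realType) (P0 P1 P2 P3 : R -> R) (K h : R) :
  (forall t, is_derive t (1 : R) P0 (P1 t)) -> (forall t, is_derive t (1 : R) P1 (P2 t)) ->
  (forall t, is_derive t (1 : R) P2 (P3 t)) ->
  (forall t, `|t| <= 1 -> `|P2 t| <= K) -> (forall t, `|t| <= 1 -> `|P3 t| <= K) ->
  0 < h -> h <= 1 ->
  `|(h ^- 2 + h^-1) * P0 h - 2 * h ^- 2 * P0 0 + (h ^- 2 - h^-1) * P0 (- h) - (P2 0 + 2 * P1 0)|
    <= 4 * K * h.
Proof.
move=> d0 d1 d2 K2 K3 h0 h1.
have B (f df : R -> R) t : (forall t, is_derive t (1 : R) f (df t)) ->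
    (forall t, `|t| <= 1 -> `|df t| <= K) -> `|t| <= h -> `|f t - f 0| <= K * h.
  move=> fdf dfK th; have Kge0 : 0 <= K by apply: le_trans (dfK 0 _); rewrite ?normr0.
  have [t0|t0] := leP 0 t.
    rewrite ger0_norm// in th; apply: (@le_trans _ _ (K * (t - 0))).
      by apply: mvt_bound fdf _ => // x /andP[x0 xt]; apply: dfK; rewrite ger0_norm//; lra.
    by rewrite subr0 ler_wpM2l.
  rewrite ltr0_norm// in th; rewrite distrC; apply: (@le_trans _ _ (K * (0 - t))).
    apply: mvt_bound fdf _; first exact: ltW.
    by move=> x /andP[tx x0]; apply: dfK; rewrite ler0_norm//; lra.
  by rewrite sub0r ler_wpM2l.
have K0 : 0 <= K by apply: le_trans (K2 0 _); rewrite ?normr0.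
have S1 : `|P0 h - P0 (- h) - 2 * P1 0 * h| <= 2 * K * h * h.
  pose H t := P0 t - P0 (- t) - (2 * P1 0) * t.
  have dH t : is_derive t (1 : R) H (P1 t - - P1 (- t) - (2 * P1 0)).
    have dN := is_derive_oppcomp t d0; have dt := d0 t.
    rewrite /H; apply: is_derive_eq.
    by rewrite -[(2 * P1 0) *: _]/((2 * P1 0) * 1) mulr1.
  have -> : P0 h - P0 (- h) - 2 * P1 0 * h = H h - H 0.
    by rewrite /H oppr0 mulr0; ring.
  rewrite -[in leRHS](subr0 h); apply: mvt_bound dH _; first exact: ltW.
  rewrite subr0 => t /andP[t0 th].
  have b1 : `|P1 t - P1 0| <= K * h by apply: B d1 K2 _; rewrite ger0_norm.
  have b2 : `|P1 (- t) - P1 0| <= K * h by apply: B d1 K2 _; rewrite normrN ger0_norm.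
  rewrite (_ : _ - _ = (P1 t - P1 0) + (P1 (- t) - P1 0)); last by ring.
  by apply: le_trans (ler_normD _ _) _; lra.
have S2 : `|P0 h + P0 (- h) - P2 0 * h ^+ 2 - 2 * P0 0| <= 2 * K * h * h * h.
  pose G t := P1 t - P1 (- t) - (2 * P2 0) * t.
  have dG t : is_derive t (1 : R) G (P2 t - - P2 (- t) - (2 * P2 0)).
    have dN := is_derive_oppcomp t d1; have dt := d1 t.
    rewrite /G; apply: is_derive_eq.
    by rewrite -[(2 * P2 0) *: _]/((2 * P2 0) * 1) mulr1.
  have bG t : 0 <= t <= h -> `|G t| <= 2 * K * h * h.
    move=> /andP[t0 th]; have -> : G t = G t - G 0 by rewrite /G oppr0 mulr0; ring.
    apply: (@le_trans _ _ (2 * K * h * (t - 0))); last first.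
      by rewrite subr0 ler_wpM2l// !mulr_ge0// ltW.
    apply: mvt_bound dG _ => // s /andP[s0 st].
    have b1 : `|P2 s - P2 0| <= K * h by apply: B d2 K3 _; rewrite ger0_norm//; lra.
    have b2 : `|P2 (- s) - P2 0| <= K * h by apply: B d2 K3 _; rewrite normrN ger0_norm//; lra.
    rewrite (_ : _ - _ = (P2 s - P2 0) + (P2 (- s) - P2 0)); last by ring.
    by apply: le_trans (ler_normD _ _) _; lra.
  pose F t := P0 t + P0 (- t) - P2 0 * (t * t).
  have dF t : is_derive t (1 : R) F (G t).
    have dN := is_derive_oppcomp t d0; have dt := d0 t.
    rewrite /F /G; apply: is_derive_eq.
    rewrite -[_ *: (_ + _)]/(P2 0 * (t * 1 + t * 1)); ring.
  have -> : P0 h + P0 (- h) - P2 0 * h ^+ 2 - 2 * P0 0 = F h - F 0.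
    by rewrite /F oppr0 mulr0; ring.
  rewrite -[in leRHS](subr0 h); apply: mvt_bound dF _; first exact: ltW.
  by rewrite subr0.
have -> : (h ^- 2 + h^-1) * P0 h - 2 * h ^- 2 * P0 0 + (h ^- 2 - h^-1) * P0 (- h) - (P2 0 + 2 * P1 0) =
    h ^- 2 * (P0 h + P0 (- h) - P2 0 * h ^+ 2 - 2 * P0 0) + h^-1 * (P0 h - P0 (- h) - 2 * P1 0 * h).
  by field; rewrite gt_eqF.
apply: le_trans (ler_normD _ _) _; rewrite !normrM.
rewrite (ger0_norm (_ : 0 <= h ^- 2)) ?invr_ge0 ?exprn_ge0 ?(ltW h0)//.
rewrite (ger0_norm (_ : 0 <= h^-1)) ?invr_ge0 ?(ltW h0)//.
have -> : 4 * K * h = h ^- 2 * (2 * K * h * h * h) + h^-1 * (2 * K * h * h).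
  by field; rewrite gt_eqF.
by apply: lerD; rewrite ler_wpM2l// invr_ge0 ?exprn_ge0// ltW.
Qed.

Section Scalarization.
Variables (R : realType) (k r : R) (phi : nat -> R -> R).
Hypotheses (r0 : 0 < r)
  (dphi : forall j (s : R), (j < 3)%N -> 0 < s -> is_derive s (1 : R) (phi j) (phi j.+1 s)).

(** Combinations of s^i phi_i(s) at s = r e^t, times e^(k t). When phi_i is the i-th derivative of
    phi_0, such combinations contain e^(k t) phi_0(r e^t) and its t-derivatives up to the third, so
    differentiation only acts on the coefficients. *)
Definition euler_comb (c0 c1 c2 c3 t : R) : R :=
  expR (k * t) * (c0 * phi 0%N (r * expR t) + c1 * ((r * expR t) * phi 1%N (r * expR t))
    + c2 * ((r * expR t) ^+ 2 * phi 2%N (r * expR t)) + c3 * ((r * expR t) ^+ 3 * phi 3%N (r * expR t))).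

Lemma is_derive_euler_comb (c0 c1 c2 t : R) :
  is_derive t (1 : R) (euler_comb c0 c1 c2 0)
    (euler_comb (k * c0) (k * c1 + c0 + c1) (k * c2 + c1 + 2 * c2) c2 t).
Proof.
have re0 : 0 < r * expR t by rewrite mulr_gt0 ?expR_gt0.
have drho : is_derive t (1 : R) (fun t => r * expR t) (r * expR t).
  by apply: is_derive_eq; rewrite -[_ *: _]/(r * expR t).
have dphit j : (j < 3)%N -> is_derive t (1 : R) (fun t => phi j (r * expR t)) (phi j.+1 (r * expR t) * (r * expR t)).
  by move=> j3; apply: is_derive1_comp; exact: dphi.
have d0 := dphit 0%N isT; have d1 := dphit 1%N isT; have d2 := dphit 2%N isT.
have dk : is_derive t (1 : R) (fun t => expR (k * t)) (k * expR (k * t)).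
  apply: (is_derive_eq (@is_derive1_comp R expR (fun t => k * t) t _ _ _ _)).
  by rewrite mulrC; congr (_ * _); rewrite -[RHS]mulr1.
rewrite (_ : euler_comb c0 c1 c2 0 = (fun t => expR (k * t) * (c0 * phi 0%N (r * expR t) +
   c1 * ((r * expR t) * phi 1%N (r * expR t)) + c2 * ((r * expR t) * (r * expR t) * phi 2%N (r * expR t))))).
  apply: is_derive_eq.
  by rewrite /GRing.scale /= /euler_comb; ring.
by apply/funext => s; rewrite /euler_comb mul0r addr0 expr2.
Qed.

(** For |k| <= 1, 15 bounds the coefficient sums up to the third derivative of e^(k t) phi_0(r e^t),
    and expR 1 bounds e^(k t). *)
Lemma euler_comb_bound (c0 c1 c2 c3 M t : R) : `|k| <= 1 -> `|t| <= 1 ->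
  `|c0| + `|c1| + `|c2| + `|c3| <= 15 ->
  (forall j s, (j <= 3)%N -> 0 < s -> `|s ^+ j * phi j s| <= M) ->
  `|euler_comb c0 c1 c2 c3 t| <= expR 1 * (15 * M).
Proof.
move=> k1 t1 c15 HM.
have re0 : 0 < r * expR t by rewrite mulr_gt0 ?expR_gt0.
have b j : (j <= 3)%N -> `|(r * expR t) ^+ j * phi j (r * expR t)| <= M by move=> j3; exact: HM.
have b0 := b 0%N isT; have b1 := b 1%N isT; have b2 := b 2%N isT; have b3 := b 3%N isT.
rewrite expr0 mul1r in b0; rewrite expr1 in b1.
rewrite normrM (ger0_norm (expR_ge0 _)).
have M0 : 0 <= M by exact: le_trans b0.
apply: ler_pM; rewrite ?expR_ge0 ?normr_ge0//.
  rewrite ler_expR; apply: le_trans (ler_norm _) _; rewrite normrM.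
  by rewrite -[leRHS]mulr1; apply: ler_pM.
apply: le_trans (ler_wpM2r M0 c15).
rewrite !mulrDl; do 3 (apply: (le_trans (ler_normD _ _)); apply: lerD; last by rewrite normrM ler_wpM2l).
by rewrite normrM ler_wpM2l.
Qed.

End Scalarization.

(** X and Y stand for the two dilates of V, with b = h^-2 and c = h^-1. Expanding, |W|^2 - 2 <AV -
    rho V, W> equals (b^2 - b) |X + Y - 2 V|^2 + 4 b (<V, AV> - <X, AV>) + 2 (2 - rho) b |X - V|^2.
    The three terms, discrete forms of |V''|^2, <V', A V'> and |V'|^2, are nonnegative. *)
Lemma second_difference_ineq d (T : measurableType d) (R : realType) (mu : {measure set T -> \bar R})
    (V X Y AV : T -> R[i]) (G1 G2 b c rho : R) :
  L2 mu V -> L2 mu X -> L2 mu Y -> L2 mu AV ->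
  rip mu X X = rip mu V V -> rip mu Y Y = rip mu V V ->
  rip mu X V = G1 -> rip mu Y V = G1 -> rip mu X Y = G2 ->
  rip mu Y AV = rip mu X AV -> rip mu X AV <= rip mu V AV ->
  1 <= b -> c ^+ 2 = b -> 0 <= rho -> rho <= 2 ->
  forall W, W = (b + c)%:C%C *: X - (2 * b)%:C%C *: V + (b - c)%:C%C *: Y ->
  rip mu (AV - rho%:C%C *: V) (AV - rho%:C%C *: V) <=
  rip mu (AV - rho%:C%C *: V - W) (AV - rho%:C%C *: V - W).
Proof.
move=> LV LX LY LA XX YY XV YV XY YA XA b1 cb rho0 rho2 W0 ->.
set G0 := rip mu V V in XX YY *.
have LZX a := L2Z a LX; have LZY a := L2Z a LY; have LZV a := L2Z a LV.
have LT := L2B LA (LZV rho).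
have LL := L2B (LZX (b + c)) (LZV (2 * b)).
have LW := L2D LL (LZY (b - c)).
set W := _ + (b - c)%:C%C *: Y in LW *.
have LXY := L2D LX LY.
rewrite [leRHS]ripB_sqr//.
have y1 : 0 <= 2 * G0 - 2 * G1.
  by have := rip_ge0 mu (X - V); rewrite ripB_sqr// XX XV -/G0; lra.
have y2 : 0 <= 6 * G0 - 8 * G1 + 2 * G2.
  have := rip_ge0 mu (X + Y - 2%:C%C *: V).
  by rewrite ripB_sqr// ripD_sqr// ripZl// !ripZr// ripDl// XX YY XV YV XY -/G0; lra.
have E1 : rip mu (AV - rho%:C%C *: V) W =
    2 * b * (rip mu X AV - rip mu V AV) - rho * (2 * b * (G1 - G0)).
  rewrite ripBl// /W !ripZl// !(ripBr, ripDr)// !ripZr//.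
  by rewrite !(ripC mu AV) YA (ripC mu V X) (ripC mu V Y) XV YV -/G0; ring.
have E2 : rip mu W W = (6 * b ^+ 2 + 2 * b) * G0 - 8 * b ^+ 2 * G1 + 2 * (b ^+ 2 - b) * G2.
  rewrite /W ripD_sqr// ripB_sqr// ripBl// !ripZl// !ripZr// (ripC mu V Y) XX YY XV YV XY -/G0.
  by rewrite -cb; ring.
rewrite E1 E2.
have P1 : 0 <= b * (rip mu V AV - rip mu X AV) by rewrite mulr_ge0//; lra.
have P2 : 0 <= (b ^+ 2 - b) * (6 * G0 - 8 * G1 + 2 * G2).
  by rewrite mulr_ge0// subr_ge0 expr2 ler_peMr//; lra.
have P3 : 0 <= (2 - rho) * (b * (2 * G0 - 2 * G1)) by rewrite mulr_ge0 ?mulr_ge0//; lra.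
by nra.
Qed.

(** * The dilation group *)

Section Dilation.
Variables (R : realType) (n : nat).
Local Notation E := (Eucl R n.+1).
Local Notation mu := (lebesgue_eucl R n.+1).
Local Notation sigma := (\sigma_(R, n.+1)).

(* The unitary group of dilations of L^2(R^(n+1)), parametrized additively: s = e^h. *)
Definition dilation (h : R) (u : E -> R[i]) : E -> R[i] :=
  fun x => (expR (h * (n.+1%:R / 2)))%:C%C * u (dilate (expR h) x).

Lemma slice_dilation h (u : E -> R[i]) r :
  slice (dilation h u) r = (expR (h * (n.+1%:R / 2)))%:C%C *: slice u (r * expR h).
Proof.
apply/funext => x; rewrite /slice /dilation /= dilate_dilate mulrC.
by rewrite -[RHS]/(_ * _) mulrC (mulrC r).
Qed.

Lemma cmeasurable_dilation h (u : E -> R[i]) : cmeasurable u -> cmeasurable (dilation h u).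
Proof.
move=> [ru iu]; apply: (@cmeasurableZ _ _ _ _ (fun x => u (dilate (expR h) x))).
by split; [apply: (measurableT_comp ru)|apply: (measurableT_comp iu)]; exact: measurable_dilatel.
Qed.

Lemma l2sq_dilation h (u : E -> R[i]) : cmeasurable u -> l2sq mu (dilation h u) = l2sq mu u.
Proof.
move=> mu_; rewrite /l2sq.
have md : measurable_fun setT (fun x => (rdot (u x) (u x))%:E).
  exact/measurable_EFinP/measurable_rdot.
transitivity (\int[mu]_x ((expR h ^+ n.+1)%:E * (rdot (u (dilate (expR h) x)) (u (dilate (expR h) x)))%:E))%E.
  apply: eq_integral => x _; rewrite -EFinM /dilation rdotZl rdotC rdotZl mulrA.
  by rewrite -expRM_natl -expRD; congr ((expR _ * _)%:E); field.
rewrite ge0_integralZl_EFin ?exprn_ge0 ?expR_ge0//; last 2 first.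
- by move=> x _; rewrite lee_fin rdot_ge0.
- by apply: (measurableT_comp md); exact: measurable_dilatel.
rewrite (ge0_integral_dilate (F := fun x => (rdot (u x) (u x))%:E)) ?expR_gt0//; last first.
  by move=> x; rewrite lee_fin rdot_ge0.
by rewrite muleA -EFinM divff ?mul1e// expf_neq0// gt_eqF// expR_gt0.
Qed.

Lemma L2_dilation h (u : E -> R[i]) : L2 mu u -> L2 mu (dilation h u).
Proof.
move=> /L2P[mu_ uoo]; apply/L2P; split; first exact: cmeasurable_dilation.
by rewrite l2sq_dilation.
Qed.

Lemma dilationD h (u v : E -> R[i]) : dilation h (u + v) = dilation h u + dilation h v.
Proof. by apply/funext => x; exact: mulrDr. Qed.

Lemma rip_dilation h (u v : E -> R[i]) : L2 mu u -> L2 mu v ->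
  rip mu (dilation h u) (dilation h v) = rip mu u v.
Proof.
move=> Lu Lv.
have q w : L2 mu w -> rip mu (dilation h w) (dilation h w) = rip mu w w.
  by move=> Lw; apply/EFin_inj; rewrite -!l2sqE ?l2sq_dilation//; [case: Lw|exact: L2_dilation].
have := q _ (L2D Lu Lv); rewrite dilationD !ripD_sqr ?q//; try exact: L2_dilation.
by lra.
Qed.

Lemma dilation_comp h h' (u : E -> R[i]) : dilation h (dilation h' u) = dilation (h + h') u.
Proof.
apply/funext => x; rewrite /dilation dilate_dilate mulrA -rmorphM -expRD -expRD -mulrDl.
by rewrite (addrC h').
Qed.

Lemma dilation0 (u : E -> R[i]) : dilation 0 u = u.
Proof. by apply/funext => x; rewrite /dilation mul0r expR0 mul1r dilate1. Qed.

Lemma rip_dilation_adj h (u v : E -> R[i]) : L2 mu u -> L2 mu v ->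
  rip mu (dilation h u) v = rip mu u (dilation (- h) v).
Proof.
move=> Lu Lv; rewrite -(rip_dilation (- h) (L2_dilation h Lu) Lv).
by rewrite dilation_comp addNr dilation0.
Qed.

Definition dilation_diff h (u : E -> R[i]) : E -> R[i] :=
  (h ^- 2 + h^-1)%:C%C *: dilation h u - (2 * h ^- 2)%:C%C *: u
  + (h ^- 2 - h^-1)%:C%C *: dilation (- h) u.

Lemma L2_dilation_diff h (u : E -> R[i]) : L2 mu u -> L2 mu (dilation_diff h u).
Proof.
move=> Lu; apply: L2D; last exact/L2Z/L2_dilation.
by apply: L2B; apply: L2Z => //; exact: L2_dilation.
Qed.

(* In the variable t = log r, [dilation_diff h] discretizes d^2/dt^2 + 2 d/dt, whose square norm
   dominates 2 rho times the Dirichlet form when rho <= 2. *)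
Lemma dilation_diff_ineq (h rho : R) (V AV : E -> R[i]) : 0 < h -> h <= 1 -> 0 <= rho -> rho <= 2 ->
  L2 mu V -> L2 mu AV ->
  (forall t, rip mu (dilation t V) AV = rip mu V (dilation t AV)) ->
  (forall t, rip mu (dilation t V) AV <= rip mu V AV) ->
  rip mu (AV - rho%:C%C *: V) (AV - rho%:C%C *: V) <=
  rip mu (AV - rho%:C%C *: V - dilation_diff h V) (AV - rho%:C%C *: V - dilation_diff h V).
Proof.
move=> h0 h1 rho0 rho2 LV LA sym pos.
have b1 : 1 <= h ^- 2 by rewrite invf_ge1 ?exprn_gt0// exprn_ile1// ltW.
apply: (@second_difference_ineq _ _ _ mu V (dilation h V) (dilation (- h) V) AV
  (rip mu (dilation h V) V) (rip mu (dilation (h + h) V) V) (h ^- 2) h^-1 rho LV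
  (L2_dilation h LV) (L2_dilation (- h) LV) LA
  (rip_dilation h LV LV) (rip_dilation (- h) LV LV) (erefl _) _ _ _ (pos h) b1 _ rho0 rho2 _ (erefl _)).
- by rewrite rip_dilation_adj// opprK ripC.
- rewrite -(rip_dilation h (L2_dilation h LV) (L2_dilation (- h) LV)).
  by rewrite !dilation_comp subrr dilation0.
- by rewrite sym -rip_dilation_adj.
- by rewrite exprVn.
Qed.

End Dilation.

(** * From difference quotients to the radial part *)

Lemma rip_comb4 d (T : measurableType d) (R : realType) (mu : {measure set T -> \bar R})
    (a b c : R) (u v w z e : T -> R[i]) :
  L2 mu u -> L2 mu v -> L2 mu w -> L2 mu z -> L2 mu e ->
  rip mu (a%:C%C *: u - b%:C%C *: v + c%:C%C *: w - z) e =
  a * rip mu u e - b * rip mu v e + c * rip mu w e - rip mu z e.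
Proof.
move=> Lu Lv Lw Lz Le; have LA := L2Z a Lu; have LB := L2Z b Lv; have LC := L2Z c Lw.
have LAB := L2B LA LB; have LABC := L2D LAB LC.
by rewrite ripBl// ripDl// ripBl// !ripZl.
Qed.

Section Consistency.
Variables (R : realType) (n : nat).
Local Notation leb := (@lebesgue_measure R).
Local Notation E := (Eucl R n.+1).
Local Notation mu := (lebesgue_eucl R n.+1).
Local Notation sigma := (\sigma_(R, n.+1)).
Local Notation k := ((n.+1%:R - 4) / 2 : R).

Lemma measurable_enormV m : measurable_fun setT (fun x : E => enorm x ^- m).
Proof.
rewrite (_ : (fun _ => _) = fun x : E => (enorm x `^ (-1)) ^+ m); last first.
  by apply/funext => x; rewrite powR_inv1 ?enorm_ge0// exprVn.
apply: measurable_funX.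
exact: (measurableT_comp (measurable_powR _) (@measurable_enorm R n.+1)).
Qed.

Definition hardy_weight (f : E -> R[i]) : E -> R[i] := fun x => (enorm x ^- 2)%:C%C * f x.

Lemma cmeasurable_hardy_weight f : cmeasurable f -> cmeasurable (hardy_weight f).
Proof. by apply: cmeasurable_mulr; exact: measurable_enormV. Qed.

Lemma slice_hardy_weight f r : 0 < r ->
  slice (hardy_weight f) r = (r ^- 2)%:C%C *: slice f r %[ae sigma].
Proof. exact: (@slice_radial R n (fun r => r ^- 2)). Qed.

Lemma L2_slice_hardy_weight f r : 0 < r -> cmeasurable f -> L2 sigma (slice f r) ->
  L2 sigma (slice (hardy_weight f) r).
Proof.
move=> r0 mf Lf; apply: (eq_L2 (L2Z (r ^- 2) Lf)).
  exact/cmeasurable_slice/cmeasurable_hardy_weight.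
by apply: filterS (slice_hardy_weight f r0) => x H /H.
Qed.

Lemma rip_slice_hardy_weight f e r : 0 < r -> cmeasurable f -> L2 sigma (slice f r) -> L2 sigma e ->
  rip sigma (slice (hardy_weight f) r) e = r ^- 2 * rip sigma (slice f r) e.
Proof.
move=> r0 mf Lf Le; rewrite -ripZl//; apply: eq_rip.
- by case: (L2_slice_hardy_weight r0 mf Lf).
- by case: (L2Z (r ^- 2) Lf).
- by case: Le.
- by case: Le.
- exact: slice_hardy_weight.
- exact: filterE.
Qed.

Variables (D : nat -> E -> R[i]) (a b M : R).
Hypotheses (LD : forall j, (j <= 3)%N -> L2slices (D j))
  (dD : forall j, (j < 3)%N -> is_radial_derivative (D j) (D j.+1))
  (a0 : 0 < a) (ab : a <= b) (k1 : `|k| <= 1) (M0 : 0 <= M)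
  (suppD : forall j r, (j <= 3)%N -> 0 < r -> ~ (a <= r <= b) ->
     rip sigma (slice (D j) r) (slice (D j) r) = 0)
  (HM : forall j r, (j <= 3)%N -> 0 < r ->
     (r ^+ j) ^+ 2 * rip sigma (slice (D j) r) (slice (D j) r) <= M ^+ 2).

Local Notation V := (hardy_weight (D 0%N)).

(* Delta_r f + R |x|^-2 f, for f = D 0%N. *)
Definition radial_part : E -> R[i] := fun x =>
  D 2%N x + ((n.+1%:R - 1) / enorm x)%:C%C * D 1%N x + (Rellich R n.+1)%:C%C * V x.

Lemma cmeasurable_radial_part : cmeasurable radial_part.
Proof.
have m0 : cmeasurable (D 0%N) by case: (LD (j := 0%N)).
have m1 : cmeasurable (D 1%N) by case: (LD (j := 1%N)).
have m2 : cmeasurable (D 2%N) by case: (LD (j := 2%N)).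
apply: cmeasurableD; last by apply: cmeasurableZ; exact: cmeasurable_hardy_weight.
apply: cmeasurableD => //; apply: cmeasurable_mulr => //.
by apply: measurable_funM; [exact: measurable_cst|exact: (measurable_enormV 1)].
Qed.

Lemma slice_radial_part r : 0 < r -> slice radial_part r =
  slice (D 2%N) r + ((n.+1%:R - 1) / r)%:C%C *: slice (D 1%N) r
  + (Rellich R n.+1 * r ^- 2)%:C%C *: slice (D 0%N) r %[ae sigma].
Proof.
move=> r0; apply: filterS (@surface_ae_norm R n) => x x1 _.
rewrite /slice /radial_part /hardy_weight enorm_dilate ?ltW// x1 mulr1 mulrA -rmorphM.
by [].
Qed.

Lemma L2_slice_radial_part r : 0 < r -> L2 sigma (slice radial_part r).
Proof.
move=> r0; have L j : (j <= 3)%N -> L2 sigma (slice (D j) r) by move=> j3; case: (LD j3) => _; exact.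
have LS := L2D (L2D (L 2%N isT) (L2Z ((n.+1%:R - 1) / r) (L 1%N isT)))
  (L2Z (Rellich R n.+1 * r ^- 2) (L 0%N isT)).
apply: (eq_L2 LS); first exact/cmeasurable_slice/cmeasurable_radial_part.
by apply: filterS (slice_radial_part r0) => x H I; rewrite H.
Qed.

Lemma L2_slice_dilation_hardy t r : 0 < r -> L2 sigma (slice (dilation t V) r).
Proof.
move=> r0; rewrite slice_dilation; apply/L2Z/L2_slice_hardy_weight.
- by rewrite mulr_gt0 ?expR_gt0.
- by case: (LD (j := 0%N)).
- by case: (LD (j := 0%N)) => // _; apply; rewrite mulr_gt0 ?expR_gt0.
Qed.

Section Pairing.
Variables (e : E -> R[i]) (r : R).
Hypotheses (Le : L2 sigma e) (r0 : 0 < r).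
Local Notation phi := (fun j s => rip sigma (slice (D j) s) e).

(** The unitary factor e^(t (n+1) / 2) and the weight (r e^t)^-2 combine into r^-2 e^(k t), with k =
    (n+1) / 2 - 2. *)
Lemma rip_slice_dilation_hardy t :
  rip sigma (slice (dilation t V) r) e = r ^- 2 * euler_comb k r phi 1 0 0 0 t.
Proof.
have rt0 : 0 < r * expR t by rewrite mulr_gt0 ?expR_gt0.
have [m0 L0] := LD (j := 0%N) isT.
rewrite slice_dilation ripZl//; last exact/L2_slice_hardy_weight/L0.
rewrite rip_slice_hardy_weight//; last exact: L0.
rewrite /euler_comb !mul0r !addr0 mul1r !mulrA; congr (_ * _).
have -> : t * n.+1%:R / 2 = k * t + t + t by field.
rewrite !expRD exprMn; field.
by rewrite !gt_eqF ?expR_gt0.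
Qed.

(** The bracket is P'' + 2 P' at t = 0, that is k (k + 2) phi_0 + (2 k + 3) r phi_1 + r^2 phi_2;
    here k (k + 2) = R_(n+1) and 2 k + 3 = n because k = (n - 3) / 2. *)
Lemma rip_slice_radial_part :
  rip sigma (slice radial_part r) e = r ^- 2 *
    (euler_comb k r phi (k * k) (k + (k + 1)) 1 0 0 + 2 * euler_comb k r phi k 1 0 0 0).
Proof.
have [_ L0] := LD (j := 0%N) isT; have [_ L1] := LD (j := 1%N) isT; have [_ L2'] := LD (j := 2%N) isT.
have l0 := L0 _ r0; have l1 := L1 _ r0; have l2 := L2' _ r0.
have L1' := L2Z ((n.+1%:R - 1) / r) (L1 _ r0).
have L0' := L2Z (Rellich R n.+1 * r ^- 2) (L0 _ r0).
have LS := L2D (L2' _ r0) L1'; have LS' := L2D LS L0'.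
transitivity (rip sigma (slice (D 2%N) r + ((n.+1%:R - 1) / r)%:C%C *: slice (D 1%N) r
  + (Rellich R n.+1 * r ^- 2)%:C%C *: slice (D 0%N) r) e).
  apply: eq_rip.
  - by case: (L2_slice_radial_part r0).
  - by case: LS'.
  - by case: Le.
  - by case: Le.
  - exact: slice_radial_part.
  - exact: filterE.
rewrite !ripDl// !ripZl//.
rewrite /euler_comb mulr0 expR0 mulr1 /Rellich; field.
by rewrite gt_eqF.
Qed.

End Pairing.

Lemma rip_slice_le (r : R) (e : E -> R[i]) j : (j <= 3)%N -> 0 < r -> L2 sigma e ->
  `|r ^+ j * rip sigma (slice (D j) r) e| <= M * Num.sqrt (rip sigma e e).
Proof.
move=> j3 r0 Le; have [_ Lj] := LD j3; have C := rip_cauchy (Lj _ r0) Le.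
rewrite -ler_sqr ?nnegrE ?mulr_ge0 ?sqrtr_ge0// real_normK ?num_real//.
rewrite !exprMn sqr_sqrtr ?rip_ge0//; apply: le_trans (ler_wpM2l (sqr_ge0 _) C) _.
by rewrite mulrA ler_wpM2r ?rip_ge0//; exact: HM.
Qed.

Definition consistency_error h : E -> R[i] := dilation_diff h V - radial_part.

Lemma L2_slice_consistency_error h r : 0 < r -> L2 sigma (slice (consistency_error h) r).
Proof.
move=> r0; have Ld t := L2_slice_dilation_hardy t r0.
apply: L2B; last exact: L2_slice_radial_part.
apply: L2D; last exact/L2Z/Ld.
apply: L2B; first exact/L2Z/Ld.
by apply: L2Z; rewrite -[V]dilation0; exact: Ld.
Qed.

Lemma rip_slice_consistency_error h r (e : E -> R[i]) : 0 < r -> L2 sigma e ->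
  let phi j s := rip sigma (slice (D j) s) e in let P := euler_comb k r phi 1 0 0 0 in
  rip sigma (slice (consistency_error h) r) e = r ^- 2 *
    ((h ^- 2 + h^-1) * P h - 2 * h ^- 2 * P 0 + (h ^- 2 - h^-1) * P (- h) -
     (euler_comb k r phi (k * k) (k + (k + 1)) 1 0 0 + 2 * euler_comb k r phi k 1 0 0 0)).
Proof.
move=> r0 Le phi P; have Ld t := L2_slice_dilation_hardy t r0.
have LV : L2 sigma (slice V r) by have := Ld 0; rewrite dilation0.
have Lr := L2_slice_radial_part r0.
rewrite /consistency_error /dilation_diff.
rewrite -[slice _ r]/((h ^- 2 + h^-1)%:C%C *: slice (dilation h V) r - (2 * h ^- 2)%:C%C *: slice V r
  + (h ^- 2 - h^-1)%:C%C *: slice (dilation (- h) V) r - slice radial_part r).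
rewrite (rip_comb4 _ _ _ (Ld h) LV (Ld (- h)) Lr Le) (rip_slice_dilation_hardy Le r0 h) (rip_slice_dilation_hardy Le r0 (- h)).
have := rip_slice_dilation_hardy Le r0 0; rewrite dilation0 => ->.
rewrite (rip_slice_radial_part Le r0).
have factor (a1 a2 a3 x y z w : R) : a1 * (r ^- 2 * x) - a2 * (r ^- 2 * y) + a3 * (r ^- 2 * z) - r ^- 2 * w =
  r ^- 2 * (a1 * x - a2 * y + a3 * z - w) by ring.
exact: factor.
Qed.

(** Paired with the error e itself, Taylor's estimate bounds |e|^2 by a multiple of h |e|, and one
    factor |e| cancels. This turns scalar estimates into a norm estimate. *)
Lemma consistency_error_le h r : 0 < h -> h <= 1 -> 0 < r ->
  rip sigma (slice (consistency_error h) r) (slice (consistency_error h) r)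
    <= (r ^- 2 * (60 * expR 1 * M) * h) ^+ 2.
Proof.
move=> h0 h1 r0; have Le := L2_slice_consistency_error h r0.
set e := slice _ r in Le *; pose phi j s := rip sigma (slice (D j) s) e.
have dphi j (s : R) : (j < 3)%N -> 0 < s -> is_derive s (1 : R) (phi j) (phi j.+1 s).
  move=> j3 s0; apply: is_derive_rip => //; [exact/LD/ltnW|exact: dD].
pose P0 := euler_comb k r phi 1 0 0 0.
pose P1 := euler_comb k r phi k 1 0 0.
pose P2 := euler_comb k r phi (k * k) (k + (k + 1)) 1 0.
(* For |k| <= 1 the four coefficients are at most 1, 7, 6 and 1 in absolute value, with sum 15; the
   constant 60 of the statement is 15 times the 4 of [taylor_difference]. *)
pose P3 := euler_comb k r phi (k * (k * k)) (k * (k + (k + 1)) + k * k + (k + (k + 1))) (k + (k + (k + 1)) + 2) 1.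
have d0 t : is_derive t (1 : R) P0 (P1 t).
  apply: (is_derive_eq (is_derive_euler_comb k r0 dphi 1 0 0 t)).
  by congr (euler_comb _ _ _ _ _ _ _ _); ring.
have d1 t : is_derive t (1 : R) P1 (P2 t).
  apply: (is_derive_eq (is_derive_euler_comb k r0 dphi k 1 0 t)).
  by congr (euler_comb _ _ _ _ _ _ _ _); ring.
have d2 t : is_derive t (1 : R) P2 (P3 t).
  apply: (is_derive_eq (is_derive_euler_comb k r0 dphi (k * k) (k + (k + 1)) 1 t)).
  by congr (euler_comb _ _ _ _ _ _ _ _); ring.
have kk : -1 <= k <= 1 by rewrite -ler_norml.
set K := expR 1 * (15 * (M * Num.sqrt (rip sigma e e))).
have bM j s : (j <= 3)%N -> 0 < s -> `|s ^+ j * phi j s| <= M * Num.sqrt (rip sigma e e).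
  by move=> j3 s0; exact: rip_slice_le.
have nk (c d : R) : -d <= c <= d -> `|c| <= d by rewrite ler_norml.
have b2 t : `|t| <= 1 -> `|P2 t| <= K.
  move=> t1; apply: euler_comb_bound => //.
  rewrite normr1 normr0.
  have := nk (k * k) 1; have := nk (k + (k + 1)) 3; nra.
have b3 t : `|t| <= 1 -> `|P3 t| <= K.
  move=> t1; apply: euler_comb_bound => //.
  rewrite normr1.
  have kk2 : 0 <= k * k <= 1.
    by rewrite -expr2 sqr_ge0 -real_normK ?num_real// exprn_ile1.
  have h1' : `|k * (k * k)| <= 1.
    have kkn : `|k * k| <= 1 by rewrite ger0_norm; case/andP: kk2.
    by rewrite normrM; exact: mulr_ile1 (normr_ge0 _) (normr_ge0 _) k1 kkn.
  have h2' : `|k * (k + (k + 1)) + k * k + (k + (k + 1))| <= 7.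
    rewrite (_ : _ + _ = 3 * (k * k) + 3 * k + 1); last by ring.
    by apply: nk; lra.
  have h3' : `|k + (k + (k + 1)) + 2| <= 6 by apply: nk; lra.
  lra.
have T := taylor_difference d0 d1 d2 b2 b3 h0 h1.
have : rip sigma e e <= r ^- 2 * (4 * K * h).
  rewrite {1}/e rip_slice_consistency_error// ler_wpM2l ?invr_ge0 ?exprn_ge0 ?(ltW r0)//.
  exact: le_trans (ler_norm _) T.
rewrite /K => H.
have {H} H : rip sigma e e <= r ^- 2 * (60 * expR 1 * M) * h * Num.sqrt (rip sigma e e).
  apply: le_trans H _; rewrite le_eqVlt; apply/orP; left; apply/eqP; ring.
have [->|e_neq0] := eqVneq (rip sigma e e) 0; first exact: sqr_ge0.
have s0 : 0 < Num.sqrt (rip sigma e e).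
  by rewrite sqrtr_gt0 lt_neqAle eq_sym e_neq0 rip_ge0.
rewrite -[leLHS](sqr_sqrtr (rip_ge0 sigma e)) ler_sqr ?nnegrE ?(ltW s0)//.
  by rewrite -(ler_pM2r s0) -expr2 sqr_sqrtr// rip_ge0.
by rewrite !mulr_ge0 ?invr_ge0 ?exprn_ge0 ?expR_ge0// ltW.
Qed.

Lemma rip_slice_out (e : E -> R[i]) j s : (j <= 3)%N -> 0 < s -> L2 sigma e ->
  ~ (a <= s <= b) -> rip sigma (slice (D j) s) e = 0.
Proof.
move=> j3 s0 Le sab; have [_ Lj] := LD j3; have := rip_cauchy (Lj _ s0) Le.
by rewrite suppD// mul0r => H; apply/eqP; rewrite -sqrf_eq0 eq_le H sqr_ge0.
Qed.

Lemma euler_comb_out (e : E -> R[i]) (c0 c1 c2 c3 : R) r t : 0 < r -> L2 sigma e ->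
  ~ (a <= r * expR t <= b) ->
  euler_comb k r (fun j s => rip sigma (slice (D j) s) e) c0 c1 c2 c3 t = 0.
Proof.
move=> r0 Le out; have rt0 : 0 < r * expR t by rewrite mulr_gt0 ?expR_gt0.
by rewrite /euler_comb !rip_slice_out// !mulr0 !addr0 mulr0.
Qed.

(** Dilations by e^t with |t| <= 1 enlarge the radial support [a, b] to at most [a / e, b e]. *)
Lemma consistency_error_out h r : 0 < h -> h <= 1 -> 0 < r ->
  r * expR 1 < a \/ b * expR 1 < r ->
  rip sigma (slice (consistency_error h) r) (slice (consistency_error h) r) = 0.
Proof.
move=> h0 h1 r0 out; have Le := L2_slice_consistency_error h r0.
have out' t : -1 <= t <= 1 -> ~ (a <= r * expR t <= b).
  move=> /andP[t1 t2]; case: out => [ra|rb].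
    have : r * expR t <= r * expR 1 by rewrite ler_pM2l// ler_expR.
    by move=> H /andP[+ _]; rewrite leNgt (le_lt_trans H).
  have H : b < r * expR (-1) by rewrite expRN ltr_pdivlMr ?expR_gt0.
  have : r * expR (-1) <= r * expR t by rewrite ler_pM2l// ler_expR.
  by move=> H' /andP[_]; rewrite leNgt (lt_le_trans H H').
rewrite {1}(rip_slice_consistency_error h r0 Le) !euler_comb_out//.
  by rewrite !mulr0 !addr0 !subr0 mulr0.
all: by apply: out'; lra.
Qed.

(** The first factor bounds r^-2 on the enlarged support r >= a / e. *)
Definition consistency_const : R := (expR 1 / a) ^+ 2 * (60 * expR 1 * M).

Lemma l2sq_consistency_error h : 0 < h -> h <= 1 ->
  (l2sq mu (consistency_error h) <= ((consistency_const * h) ^+ 2 * (b * expR 1) ^+ n.+1)%:E)%E.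
Proof.
move=> h0 h1; have b0 : 0 < b := lt_le_trans a0 ab.
have m0 : cmeasurable (D 0%N) by case: (LD (j := 0%N)).
have mV := cmeasurable_hardy_weight m0.
apply: l2sq_le_bounded.
- rewrite /consistency_error -scaleN1r addrC; apply: cmeasurable_lin; first exact: cmeasurable_radial_part.
  rewrite /dilation_diff; apply: cmeasurableD; last exact/cmeasurableZ/cmeasurable_dilation.
  rewrite -scaleN1r addrC; apply: cmeasurable_lin; first exact: cmeasurableZ.
  exact/cmeasurableZ/cmeasurable_dilation.
- by rewrite mulr_ge0 ?expR_ge0// ltW.
- exact: sqr_ge0.
- apply: aeW => r r0; rewrite l2sqE ?lee_fin; last exact: L2_slice_consistency_error.
  have [ra|ra] := ltP (r * expR 1) a.
    by rewrite consistency_error_out ?sqr_ge0//; left.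
  apply: le_trans (consistency_error_le h0 h1 r0) _.
  have X0 : 0 <= 60 * expR 1 * M by rewrite !mulr_ge0 ?expR_ge0.
  rewrite ler_sqr ?nnegrE ?mulr_ge0 ?invr_ge0 ?exprn_ge0 ?divr_ge0 ?expR_ge0 ?(ltW r0) ?(ltW h0) ?(ltW a0)//.
  rewrite /consistency_const; do 2 rewrite ler_wpM2r ?(ltW h0)//.
  rewrite -exprVn lerXn2r ?nnegrE ?invr_ge0 ?divr_ge0 ?expR_ge0 ?(ltW r0) ?(ltW a0)//.
  by rewrite ler_pdivlMr// mulrC ler_pdivrMr// mulrC.
- apply: aeW => r rb; have r0 : 0 < r.
    by apply: lt_trans rb; rewrite mulr_gt0 ?expR_gt0.
  rewrite l2sqE; last exact: L2_slice_consistency_error.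
  by rewrite consistency_error_out//; right.
Qed.

Lemma L2_consistency_error h : 0 < h -> h <= 1 -> L2 mu (consistency_error h).
Proof.
move=> h0 h1; apply/L2P; split; last exact: le_lt_trans (l2sq_consistency_error h0 h1) (ltry _).
have m0 : cmeasurable (D 0%N) by case: (LD (j := 0%N)).
have mV := cmeasurable_hardy_weight m0.
rewrite /consistency_error -scaleN1r addrC; apply: cmeasurable_lin; first exact: cmeasurable_radial_part.
rewrite /dilation_diff; apply: cmeasurableD; last exact/cmeasurableZ/cmeasurable_dilation.
rewrite -scaleN1r addrC; apply: cmeasurable_lin; first exact: cmeasurableZ.
exact/cmeasurableZ/cmeasurable_dilation.
Qed.

Lemma L2_hardy_weight : L2 mu V.
Proof.
have [m0 L0] := LD (j := 0%N) isT; have b0 : 0 < b := lt_le_trans a0 ab.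
apply/L2P; split; first exact: cmeasurable_hardy_weight.
have LV r : 0 < r -> L2 sigma (slice V r) by move=> r0; exact/L2_slice_hardy_weight/L0.
have qV r : 0 < r -> rip sigma (slice V r) (slice V r) = r ^- 2 * (r ^- 2 * rip sigma (slice (D 0%N) r) (slice (D 0%N) r)).
  move=> r0; rewrite (rip_slice_hardy_weight r0 m0 (L0 r r0) (LV r r0)) ripC.
  by rewrite (rip_slice_hardy_weight r0 m0 (L0 r r0) (L0 r r0)).
apply: (@le_lt_trans _ _ ((a ^- 2 * (a ^- 2 * M ^+ 2)) * b ^+ n.+1)%:E); last exact: ltry.
have aa0 : 0 <= a ^- 2 by rewrite invr_ge0 exprn_ge0// ltW.
apply: l2sq_le_bounded.
- exact: cmeasurable_hardy_weight.
- exact: ltW.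
- by rewrite !mulr_ge0 ?exprn_ge0.
- apply: aeW => r r0; rewrite l2sqE ?qV ?lee_fin//; last exact: LV.
  have [rab|rab] := boolP (a <= r <= b); last first.
    by rewrite suppD ?mulr0 ?mulr_ge0 ?exprn_ge0//; exact/negP.
  have [ar _] := andP rab.
  have rr0 : 0 <= r ^- 2 by rewrite invr_ge0 exprn_ge0// ltW.
  have ra : r ^- 2 <= a ^- 2.
    by rewrite lef_pV2 ?posrE ?exprn_gt0// lerXn2r ?nnegrE// ltW.
  have := HM (j := 0%N) isT r0; rewrite expr0 expr1n mul1r => H.
  by apply: ler_pM; rewrite ?mulr_ge0 ?rip_ge0//; apply: ler_pM; rewrite ?rip_ge0.
- apply: aeW => r br; have r0 : 0 < r by exact: lt_trans br.
  rewrite l2sqE ?qV ?suppD ?mulr0//; last exact: LV.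
  by apply/negP; rewrite negb_and -!ltNge br orbT.
Qed.

(** The step h = 1 exhibits it as a difference of two functions already known to be in L^2. *)
Lemma L2_radial_part : L2 mu radial_part.
Proof.
have -> : radial_part = dilation_diff 1 V - consistency_error 1.
  by rewrite /consistency_error opprB addrC subrK.
apply: L2B; first exact/L2_dilation_diff/L2_hardy_weight.
exact: L2_consistency_error.
Qed.

(** Write T = AV + R_n V. The consistency error is O(h) in L^2, so the exact inequality for
    [dilation_diff h] gives |T|^2 <= |T - radial_part|^2 + O(h); then h tends to 0. *)
Lemma hardy_radial_ineq (AV : E -> R[i]) : Rellich R n.+1 <= 0 -> -2 <= Rellich R n.+1 ->
  L2 mu AV ->
  (forall t, rip mu (dilation t V) AV = rip mu V (dilation t AV)) ->
  (forall t, rip mu (dilation t V) AV <= rip mu V AV) ->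
  rip mu (AV + (Rellich R n.+1)%:C%C *: V) (AV + (Rellich R n.+1)%:C%C *: V) <=
  rip mu (AV + (Rellich R n.+1)%:C%C *: V - radial_part) (AV + (Rellich R n.+1)%:C%C *: V - radial_part).
Proof.
move=> rho0 rho2 LA sym pos; have LV := L2_hardy_weight; have Lw := L2_radial_part.
have b0 : 0 < b := lt_le_trans a0 ab.
set T := AV + _; have TE : T = AV - (- Rellich R n.+1)%:C%C *: V.
  by rewrite rmorphN scaleNr opprK.
have LT : L2 mu T by apply: L2D => //; exact: L2Z.
have LQ := L2B LT Lw; set Q := rip mu (T - radial_part) (T - radial_part).
have Q0 : 0 <= Q by exact: rip_ge0.
pose C := consistency_const ^+ 2 * (b * expR 1) ^+ n.+1.
have C0 : 0 <= C by rewrite mulr_ge0 ?sqr_ge0// exprn_ge0// mulr_ge0 ?expR_ge0// ltW.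
have step h : 0 < h -> h <= 1 -> rip mu T T <= Q + h * (2 * Num.sqrt (Q * C) + C).
  move=> h0 h1.
  have := @dilation_diff_ineq R n h (- Rellich R n.+1) V AV h0 h1.
  rewrite -TE oppr_ge0 lerNl => /(_ rho0 rho2 LV LA sym pos) /le_trans; apply.
  have Le := L2_consistency_error h0 h1.
  have -> : T - dilation_diff h V = (T - radial_part) - consistency_error h.
    by rewrite /consistency_error opprB addrA subrK.
  rewrite ripB_sqr// -/Q.
  have qe : rip mu (consistency_error h) (consistency_error h) <= h ^+ 2 * C.
    have := l2sq_consistency_error h0 h1; rewrite l2sqE// lee_fin => /le_trans; apply.
    by rewrite exprMn /C mulrAC mulrC.
  have ce : `|rip mu (T - radial_part) (consistency_error h)| <= h * Num.sqrt (Q * C).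
    rewrite -ler_sqr ?nnegrE ?(mulr_ge0 (ltW h0) (sqrtr_ge0 _))// real_normK ?num_real//.
    apply: le_trans (rip_cauchy LQ Le) _; rewrite exprMn (sqr_sqrtr (mulr_ge0 Q0 C0)).
    by rewrite mulrCA ler_wpM2l.
  move: ce; rewrite ler_norml => /andP[ce _].
  have hh : h ^+ 2 * C <= h * C by rewrite ler_wpM2r// expr2 ler_piMr// ltW.
  by lra.
rewrite leNgt; apply/negP => QT.
pose c := 2 * Num.sqrt (Q * C) + C; have c0 : 0 <= c by apply: addr_ge0 => //; exact: mulr_ge0 (sqrtr_ge0 _).
pose h := Num.min 1 ((rip mu T T - Q) / (c + 1)).
have h0 : 0 < h by rewrite lt_min ltr01 divr_gt0 ?subr_gt0//; lra.
have h1 : h <= 1 by rewrite ge_min lexx.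
have : h * (c + 1) <= rip mu T T - Q by rewrite -ler_pdivlMr ?ge_min ?lexx ?orbT//; lra.
have := step h h0 h1; rewrite -/c; lra.
Qed.

End Consistency.

(** * The Rellich inequality for admissible functions *)

Lemma rip0l d (T : measurableType d) (R : realType) (mu : {measure set T -> \bar R}) (v : T -> R[i]) :
  rip mu 0 v = 0.
Proof.
rewrite /rip /Rintegral integral0_eq// => x _.
by rewrite /rdot -[(0 : T -> R[i]) x]/(0 : R[i]) /= !mul0r addr0.
Qed.

Section OperatorScaling.
Context d (T : measurableType d) (R : realType).
Variables (mu : {measure set T -> \bar R}) (A : l2op T R).
Hypothesis saA : selfadjoint mu A.

(** [linear_operator] speaks of c u + v, so c u is written (c - 1) u + u. *)
Lemma dom_scale (c : R) u : dom A u -> dom A (c%:C%C *: u).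
Proof.
move=> du; have -> : c%:C%C *: u = (c - 1)%:C%C *: u + u.
  by rewrite rmorphB rmorph1 scalerBl scale1r subrK.
exact: (dom_lin saA (c - 1) du du).
Qed.

Lemma app_scale (c : R) u : dom A u -> app A (c%:C%C *: u) = c%:C%C *: app A u %[ae mu].
Proof.
move=> du; have E : c%:C%C *: u = (c - 1)%:C%C *: u + u.
  by rewrite rmorphB rmorph1 scalerBl scale1r subrK.
apply: filterS (app_lin saA (c - 1) du du) => x H I; rewrite E H//.
rewrite -[LHS]/((c - 1)%:C%C * app A u x + app A u x) -[RHS]/(c%:C%C * app A u x).
by rewrite rmorphB rmorph1; ring.
Qed.

End OperatorScaling.

Section UpperBound.
Variables (R : realType) (n : nat).
Local Notation leb := (@lebesgue_measure R).
Local Notation E := (Eucl R n.+1).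
Local Notation mu := (lebesgue_eucl R n.+1).
Local Notation sigma := (\sigma_(R, n.+1)).
Variables (Lam : l2op E R).
Local Notation A := (oppop Lam).
Hypotheses (saA : selfadjoint sigma A) (posA : nonneg_operator sigma A).

Lemma rip_app_ge0 u : dom A u -> 0 <= rip sigma (app A u) u.
Proof. by move=> /posA; rewrite lecE Re_inner => /andP[_]. Qed.

(** A null u equals 1 u + u almost everywhere, so A u = A u + A u. *)
Lemma app_ae0 u : dom A u -> u = (fun=> 0) %[ae sigma] -> app A u = (fun=> 0) %[ae sigma].
Proof.
move=> du u0; have dd := dom_lin saA 1 du du.
have E1 := app_lin saA 1 du du.
have mu_ : cmeasurable (1%:C%C *: u + u).
  by have L := dom_L2 saA du; apply: cmeasurableD; [apply: cmeasurableZ|]; case: L.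
have E2 : app A u = app A (1%:C%C *: u + u) %[ae sigma].
  apply: (eq_app saA) => //; apply: filterS u0 => x u0 I.
  by rewrite -[RHS]/(1%:C%C * u x + u x) u0// mulr0 addr0.
apply: filterS2 E1 E2 => x E1 E2 I; move: (E2 I); rewrite E1//.
rewrite -[RHS]/(1%:C%C * app A u x + app A u x) mul1r => H.
by apply/(@addrI _ (app A u x)); rewrite -H addr0.
Qed.

Variables (f : E -> R[i]) (g : E -> R[i]) (a b : R).
Hypotheses (a0 : 0 < a) (ab : a <= b) (Lf : L2slices f)
  (df : forall r, 0 < r -> dom A (slice f r))
  (suppf : forall r, 0 < r -> ~ (a <= r <= b) -> slice f r = (fun=> 0) %[ae sigma])
  (fg : is_angular_action Lam f g)
  (goo : (\int[leb]_(r in `]0%R, +oo[) l2norm sigma (slice g r) ^+ 2 < +oo)%E).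

Local Notation V := (hardy_weight f).
Local Notation AV := (- hardy_weight g).

Lemma cmeasurableN d (T : measurableType d) (u : T -> R[i]) : cmeasurable u -> cmeasurable (- u).
Proof. by move=> ?; rewrite -scaleN1r; exact: cmeasurableZ. Qed.

Lemma ae_slice_angular : {ae leb, forall r, 0 < r -> L2 sigma (slice AV r) /\
  slice AV r = (r ^- 2)%:C%C *: app A (slice f r) %[ae sigma]}.
Proof.
have [mg H] := fg; have F : Filter (nbhs (almost_everywhere leb)) by exact: ae_filter_ringOfSetsType.
apply: filterS H => r H r0; have LA := app_L2 saA (df r0).
have Hae : slice AV r = (r ^- 2)%:C%C *: app A (slice f r) %[ae sigma].
  apply: filterS2 (H r0) (slice_hardy_weight g r0) => x H1 H2 I.
  rewrite -[LHS]/(- slice (hardy_weight g) r x) H2//.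
  by rewrite -[RHS]/((r ^- 2)%:C%C * - app Lam (slice f r) x) H1// mulrN.
split => //; apply: (eq_L2 (L2Z (r ^- 2) LA)).
  exact/cmeasurable_slice/cmeasurableN/cmeasurable_hardy_weight.
by apply: filterS Hae => x Hx I; rewrite Hx.
Qed.

(** On the support, r^n r^-4 <= b^n a^-4; off it, A f(r, .) vanishes together with f(r, .). The
    assumed square-integrability of r |-> A f(r, .) then concludes. *)
Lemma L2_angular : L2 mu AV.
Proof.
have [mg _] := fg; have F : Filter (nbhs (almost_everywhere leb)) by exact: ae_filter_ringOfSetsType.
have b0 : 0 < b := lt_le_trans a0 ab.
have mAV : cmeasurable AV by exact/cmeasurableN/cmeasurable_hardy_weight.
apply/L2P; split => //; rewrite l2sq_polar//.
pose B := b ^+ n * (a ^- 2) ^+ 2; have B0 : 0 <= B by rewrite mulr_ge0 ?sqr_ge0 ?exprn_ge0// ltW.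
apply: (@le_lt_trans _ _ (B%:E * \int[leb]_(r in `]0%R, +oo[) l2norm sigma (slice g r) ^+ 2)%E); last first.
  by rewrite lte_mul_pinfty// lee_fin.
have mgs : measurable_fun (`]0, +oo[%classic : set R) (fun r : R => (l2norm sigma (slice g r) ^+ 2)%E).
  rewrite (_ : (fun _ => _) = fun r : R => l2sq sigma (slice g r)); last first.
    by apply/funext => r; rewrite l2norm_sqr.
  by apply: measurable_funTS; exact: measurable_l2sq_slice.
rewrite -ge0_integralZl_EFin//; last by move=> r _; exact: sqre_ge0.
apply: ae_ge0_le_integral => //.
- by move=> r; rewrite /= in_itv/= andbT; exact: polar_density_ge0.
- exact: measurable_polar_density.
- by move=> r _; rewrite mule_ge0 ?lee_fin// sqre_ge0.
- exact: measurable_funeM.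
apply: filterS2 ae_slice_angular (proj2 fg) => r H1 H2 rin.
have r0 : 0 < r by move: rin; rewrite /= in_itv/= andbT.
have [LAV EAV] := H1 r0; rewrite l2norm_sqr.
have LA := app_L2 saA (df r0).
have Lg : L2 sigma (slice g r).
  apply: (eq_L2 (L2N LA)); first exact: cmeasurable_slice.
  apply: filterS (H2 r0) => x Hx I; rewrite -Hx//.
  by rewrite -[LHS]/(- - app Lam (slice f r) x) opprK.
rewrite !l2sqE// -!EFinM lee_fin.
have gE : rip sigma (slice g r) (slice g r) = rip sigma (app A (slice f r)) (app A (slice f r)).
  rewrite -[RHS]opprK -(ripNr LA LA) -(ripNl LA (L2N LA)); apply: eq_rip.
  - by case: Lg.
  - by case: (L2N LA).
  - by case: Lg.
  - by case: (L2N LA).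
  - apply: filterS (H2 r0) => x Hx I; rewrite -Hx//.
    by rewrite -[RHS]/(- - app Lam (slice f r) x) opprK.
  - apply: filterS (H2 r0) => x Hx I; rewrite -Hx//.
    by rewrite -[RHS]/(- - app Lam (slice f r) x) opprK.
have AVE : rip sigma (slice AV r) (slice AV r) = (r ^- 2) ^+ 2 * rip sigma (slice g r) (slice g r).
  have LZ := L2Z (r ^- 2) LA.
  rewrite gE expr2 -mulrA -(ripZl (r ^- 2) LA LA) -(ripZr (r ^- 2) LA LZ).
  by apply: eq_rip => //; [case: LAV|case: LZ|case: LAV|case: LZ].
rewrite AVE mulrA; have [rab|rab] := boolP (a <= r <= b); last first.
  suff -> : rip sigma (slice g r) (slice g r) = 0 by rewrite !mulr0.
  have A0 := app_ae0 (df r0) (suppf r0 (elimN idP rab)).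
  have m0 := @cmeasurable0 _ E R.
  rewrite gE (eq_rip (u' := 0) (v' := 0))//; try by case: LA.
  exact: rip0l.
have [ar rb] := andP rab; rewrite ler_wpM2r ?rip_ge0//.
apply: ler_pM; rewrite ?sqr_ge0 ?exprn_ge0 ?(ltW r0)//.
  by rewrite lerXn2r ?nnegrE// ltW.
have ra : r ^- 2 <= a ^- 2 by rewrite lef_pV2 ?posrE ?exprn_gt0// lerXn2r ?nnegrE// ltW.
by rewrite lerXn2r ?nnegrE ?invr_ge0 ?exprn_ge0// ltW.
Qed.

Hypothesis LV : L2 mu V.

Lemma L2_sliceV r : 0 < r -> L2 sigma (slice V r).
Proof. by move=> r0; have [m0 L0] := Lf; exact/L2_slice_hardy_weight/L0. Qed.

Lemma rip_slice_pair r s : 0 < r -> 0 < s -> L2 sigma (slice AV s) ->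
  slice AV s = (s ^- 2)%:C%C *: app A (slice f s) %[ae sigma] ->
  rip sigma (slice V r) (slice AV s) = r ^- 2 * (s ^- 2 * rip sigma (slice f r) (app A (slice f s))).
Proof.
move=> r0 s0 LAV EAV; have [m0 L0] := Lf.
rewrite (rip_slice_hardy_weight r0 m0 (L0 r r0) LAV); congr (_ * _).
have LA := app_L2 saA (df s0); have Lfr := L0 _ r0.
rewrite -ripZr//; have LZ := L2Z (s ^- 2) LA.
apply: eq_rip => //; [by case: Lfr|by case: Lfr|by case: LAV|by case: LZ|exact: filterE].
Qed.

(** Dilations act on the radius and A on the sphere: on the slice at r, both sides reduce to the
    symmetry of A for the pair f(r, .), f(e^t r, .). *)
Lemma angular_symmetric t : rip mu (dilation t V) AV = rip mu V (dilation t AV).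
Proof.
have F : Filter (nbhs (almost_everywhere leb)) by exact: ae_filter_ringOfSetsType.
have LA := L2_angular; have Ld := L2_dilation t LV; have Lda := L2_dilation t LA.
have H2 := ae_scale (expR_gt0 t) ae_slice_angular.
have H r : (0 < r -> L2 sigma (slice AV r) /\ slice AV r = (r ^- 2)%:C%C *: app A (slice f r) %[ae sigma]) ->
  (0 < expR t * r -> L2 sigma (slice AV (expR t * r)) /\
    slice AV (expR t * r) = ((expR t * r) ^- 2)%:C%C *: app A (slice f (expR t * r)) %[ae sigma]) -> 0 < r ->
  [/\ L2 sigma (slice (dilation t V) r), L2 sigma (slice AV r), L2 sigma (slice V r),
    L2 sigma (slice (dilation t AV) r) &
    rip sigma (slice (dilation t V) r) (slice AV r) = rip sigma (slice V r) (slice (dilation t AV) r)].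
  move=> H1 {}H2 r0; have rt0 : 0 < r * expR t by rewrite mulr_gt0 ?expR_gt0.
  have [L1 E1] := H1 r0; have [|L2' E2] := H2; first by rewrite mulrC.
  rewrite !slice_dilation; rewrite (mulrC (expR t)) in L2' E2.
  have L3 := L2_sliceV rt0; have L4 := L2_sliceV r0.
  split; [exact: L2Z|by []|by []|exact: L2Z|].
  rewrite (ripZl _ L3 L1) (ripZr _ L2' L4); congr (_ * _).
  rewrite (rip_slice_pair rt0 r0 L1 E1) (rip_slice_pair r0 rt0 L2' E2).
  by rewrite mulrCA; do 2 congr (_ * _); rewrite ripC; exact: (rip_app_sym saA (df r0) (df rt0)).
apply/eqP; rewrite eq_le; apply/andP; split; apply: rip_le_slices => //.
  by apply: filterS2 ae_slice_angular H2 => r H1 {}H2 r0; have [? ? ? ? ->] := H r H1 H2 r0.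
by apply: filterS2 ae_slice_angular H2 => r H1 {}H2 r0; have [? ? ? ? ->] := H r H1 H2 r0.
Qed.

(** With V_t the dilated V, unitarity and symmetry turn <V_t - V, A (V_t - V)> >= 0 into 2 <V, A V>
    - 2 <V_t, A V> >= 0. *)
Lemma angular_nonneg t : rip mu (dilation t V) AV <= rip mu V AV.
Proof.
have F : Filter (nbhs (almost_everywhere leb)) by exact: ae_filter_ringOfSetsType.
have LA := L2_angular; have Ld := L2_dilation t LV; have Lda := L2_dilation t LA.
have LB := L2B Ld LV; have LBA := L2B Lda LA.
have H2 := ae_scale (expR_gt0 t) ae_slice_angular.
suff : rip mu 0 0 <= rip mu (dilation t V - V) (dilation t AV - AV).
  rewrite ripBl// !ripBr// rip_dilation// -angular_symmetric.
  by rewrite rip0l; lra.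
have L00 := @L2_0 _ _ _ mu.
apply: rip_le_slices => //.
apply: filterS2 ae_slice_angular H2 => r H1 {}H2 r0.
have rt0 : 0 < r * expR t by rewrite mulr_gt0 ?expR_gt0.
have [L1 E1] := H1 r0; have [|L2' E2] := H2; first by rewrite mulrC.
rewrite (mulrC (expR t)) in L2' E2.
have L3 := L2_sliceV rt0; have L4 := L2_sliceV r0.
have L0s := @L2_0 _ _ _ sigma.
have LX : L2 sigma (slice (dilation t V - V) r).
  have Ls : L2 sigma (slice (dilation t V) r) by rewrite slice_dilation; exact: L2Z.
  exact: (L2B Ls L4).
have LY : L2 sigma (slice (dilation t AV - AV) r).
  have Ls : L2 sigma (slice (dilation t AV) r) by rewrite slice_dilation; exact: L2Z.
  exact: (L2B Ls L1).
split=> //.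
rewrite -[slice 0 r]/(0 : E -> R[i]) rip0l.
(* On the slice at r the increment of V is v1 + v2 up to null sets, and this vector lies in the
   domain, so nonnegativity of A applies to it. *)
set c := expR (t * (n.+1%:R / 2)).
pose al := c * (r * expR t) ^- 2.
pose v1 := (al)%:C%C *: slice f (r * expR t); pose v2 := (- r ^- 2)%:C%C *: slice f r.
have d1 : dom A v1 := dom_scale saA al (df rt0); have d2 : dom A v2 := dom_scale saA (- r ^- 2) (df r0).
have d12 : dom A (1%:C%C *: v1 + v2) := dom_lin saA 1 d1 d2.
rewrite (_ : rip _ _ _ = rip sigma (app A (1%:C%C *: v1 + v2)) (1%:C%C *: v1 + v2)).
  exact: rip_app_ge0.
rewrite ripC; apply: eq_rip.
- by case: LY.
- by case: (app_L2 saA d12).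
- by case: LX.
- by case: (dom_L2 saA d12).
- have A1 := app_scale saA al (df rt0); have A2 := app_scale saA (- r ^- 2) (df r0).
  have A12 := app_lin saA 1 d1 d2.
  apply: filterS3 (filterI E1 E2) (filterI A1 A2) A12 => x [{}E1 {}E2] [{}A1 {}A2] {}A12 I.
  rewrite A12// -[RHS]/(1%:C%C * app A v1 x + app A v2 x) A1// A2//.
  rewrite -[LHS]/(slice (dilation t AV) r x - slice AV r x) slice_dilation.
  rewrite -[LHS]/(c%:C%C * slice AV (r * expR t) x - slice AV r x) E1// E2//.
  rewrite -[LHS]/(c%:C%C * (((r * expR t) ^- 2)%:C%C * app A (slice f (r * expR t)) x) - (r ^- 2)%:C%C * app A (slice f r) x).
  rewrite -[RHS]/(1%:C%C * ((al)%:C%C * app A (slice f (r * expR t)) x) + (- r ^- 2)%:C%C * app A (slice f r) x).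
  by rewrite /al rmorphM rmorphN rmorph1; ring.
- apply: filterS2 (slice_hardy_weight f r0) (slice_hardy_weight f rt0) => x {}E1 {}E2 I.
  rewrite -[LHS]/(slice (dilation t V) r x - slice V r x) slice_dilation.
  rewrite -[LHS]/(c%:C%C * slice V (r * expR t) x - slice V r x) E1// E2//.
  rewrite -[LHS]/(c%:C%C * (((r * expR t) ^- 2)%:C%C * slice f (r * expR t) x) - (r ^- 2)%:C%C * slice f r x).
  rewrite -[RHS]/(1%:C%C * ((al)%:C%C * slice f (r * expR t) x) + (- r ^- 2)%:C%C * slice f r x).
  by rewrite /al rmorphM rmorphN rmorph1; ring.
Qed.

End UpperBound.

Section UpperBoundAdmissible.
Variables (R : realType) (n : nat).
Local Notation leb := (@lebesgue_measure R).
Local Notation E := (Eucl R n.+1).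
Local Notation mu := (lebesgue_eucl R n.+1).
Local Notation sigma := (\sigma_(R, n.+1)).
Variables (Lam : l2op E R) (I : Type) (o : I) (lam : I -> R).
Local Notation A := (oppop Lam).
Local Notation Rn := (Rellich R n.+1).

Lemma radial_bounds (D : nat -> E -> R[i]) (a b : R) : 0 < a -> a <= b ->
  (forall j, L2slices (D j)) -> (forall j, is_radial_derivative (D j) (D j.+1)) ->
  (forall r, 0 < r -> ~ (a <= r <= b) -> rip sigma (slice (D 0%N) r) (slice (D 0%N) r) = 0) ->
  (forall j r, 0 < r -> ~ (a <= r <= b) -> rip sigma (slice (D j) r) (slice (D j) r) = 0) /\
  exists2 M, 0 <= M & forall j r, (j <= 3)%N -> 0 < r ->
    (r ^+ j) ^+ 2 * rip sigma (slice (D j) r) (slice (D j) r) <= M ^+ 2.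
Proof.
move=> a0 ab LD dD supp0; have b0 : 0 < b := lt_le_trans a0 ab.
have supp j r : 0 < r -> ~ (a <= r <= b) -> rip sigma (slice (D j) r) (slice (D j) r) = 0.
  elim: j r => [//|j IH]; exact: (radial_derivative_support (LD j) (dD j) IH).
split=> //.
have /choice[K HK] j : exists K, 0 <= K /\
    forall r, 0 < r -> rip sigma (slice (D j) r) (slice (D j) r) <= K.
  by have [K K0 HK] := rip_slice_bounded (LD j) (dD j) a0 ab (supp j); exists K.
(* The summand 1 ensures M >= 1, hence M <= M ^+ 2, and the sum need only be compared with M. *)
pose M := 1 + \sum_(j < 4) (b ^+ j) ^+ 2 * K j.
have t0 (j : 'I_4) : 0 <= (b ^+ j) ^+ 2 * K j by rewrite mulr_ge0 ?sqr_ge0//; case: (HK j).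
have S0 : 0 <= \sum_(j < 4) (b ^+ j) ^+ 2 * K j by exact: sumr_ge0.
exists M; first by rewrite addr_ge0.
move=> j r j3 r0; have M1 : M <= M ^+ 2 by rewrite expr2 ler_peMr// ?addr_ge0// lerDl.
apply: le_trans M1; have [rab|rab] := boolP (a <= r <= b); last first.
  by rewrite supp ?mulr0 ?addr_ge0//; exact/negP.
have [_ rb] := andP rab.
apply: (@le_trans _ _ ((b ^+ j) ^+ 2 * K j)).
  apply: ler_pM; rewrite ?sqr_ge0 ?rip_ge0//; last by case: (HK j) => _; exact.
  have rbj : r ^+ j <= b ^+ j by rewrite lerXn2r ?nnegrE ?(ltW r0) ?(ltW b0).
  by rewrite lerXn2r ?nnegrE ?exprn_ge0 ?(ltW r0) ?(ltW b0).
have j4 : (j < 4)%N by [].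
rewrite /M (bigD1 (Ordinal j4))//= addrCA lerDl addr_ge0//.
by apply: sumr_ge0 => i _; exact: t0.
Qed.

Lemma rellich_upper (f : E -> R[i]) :
  selfadjoint sigma A -> nonneg_operator sigma A -> discrete_spectrum sigma A lam -> lam o = 0 ->
  Rn < 0 -> -2 <= Rn -> `|(n.+1%:R - 4) / 2 : R| <= 1 ->
  Mmax n.+1 o lam \is a fin_num -> admissible Lam f ->
  (l2norm mu (weighted_angular_action Lam f) ^+ 2 <=
   ((1 - Rn * Num.sqrt (fine (Mmax n.+1 o lam))) ^+ 2)%:E * l2norm mu (Lop Lam f) ^+ 2)%E.
Proof.
move=> saA posA [specA _ _] lamo Rn0 Rn2 k1 Mfin [[Lf smooth] [a [b' [a0 suppf']]] df fg goo].
set g := angular_action Lam f in fg goo *.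
(* The support condition allows b' < a; enlarging b' yields an interval with a <= b. *)
pose b := Num.max a b'; have ab : a <= b by rewrite le_max lexx.
have suppf r : 0 < r -> ~ (a <= r <= b) -> slice f r = (fun=> 0) %[ae sigma].
  move=> r0 rab; apply: suppf' => // /andP[ar rb']; apply: rab.
  by rewrite ar le_max rb' orbT.
pose D j := iter j (@radial_derivative R n.+1) f.
have dD j : is_radial_derivative (D j) (D j.+1) by exact: smooth.
have LD j : L2slices (D j) by case: j => [//|j]; case: (dD j).
have supp0 r : 0 < r -> ~ (a <= r <= b) -> rip sigma (slice (D 0%N) r) (slice (D 0%N) r) = 0.
  move=> r0 rab; have [_ L0] := Lf; have Lr := L0 _ r0; have s0 := suppf _ r0 rab.
  have m0 := @cmeasurable0 _ E R.
  by rewrite (eq_rip (u' := 0) (v' := 0))// ?rip0l//; case: Lr.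
have [supp [M M0 HM]] := radial_bounds a0 ab LD dD supp0.
have LV := L2_hardy_weight (fun j _ => LD j) a0 ab M0 (fun j r _ => supp j r) HM.
have Lw := L2_radial_part (fun j _ => LD j) (fun j _ => dD j) a0 ab k1 M0 (fun j r _ => supp j r) HM.
have LAV := L2_angular saA a0 ab df suppf fg goo.
have H := @hardy_radial_ineq R n D a b M (fun j _ => LD j) (fun j _ => dD j) a0 ab k1 M0
  (fun j r _ => supp j r) HM (- hardy_weight g) (ltW Rn0) Rn2 LAV
  (angular_symmetric saA a0 ab Lf df suppf fg goo LV)
  (angular_nonneg saA posA a0 ab Lf df suppf fg goo LV).
set T := - hardy_weight g + Rn%:C%C *: hardy_weight (D 0%N) in H.
have LT : L2 mu T by apply: L2D LAV _; exact: L2Z.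
have LopE : Lop Lam f = - (T - radial_part D).
  apply/funext => x.
  rewrite -[LHS]/(D 2%N x + ((n.+1%:R - 1) / enorm x)%:C%C * D 1%N x + hardy_weight g x).
  rewrite -[RHS]/(- (- hardy_weight g x + Rn%:C%C * hardy_weight (D 0%N) x -
    (D 2%N x + ((n.+1%:R - 1) / enorm x)%:C%C * D 1%N x + Rn%:C%C * hardy_weight (D 0%N) x))).
  by ring.
have LTw := L2B LT Lw; have LNTw := L2N LTw.
have LopQ : rip mu (Lop Lam f) (Lop Lam f) = rip mu (T - radial_part D) (T - radial_part D).
  by rewrite LopE ripNl// ripNr// opprK.
have LLop : L2 mu (Lop Lam f) by rewrite LopE.
have gQ : rip mu (hardy_weight g) (hardy_weight g) = rip mu (- hardy_weight g) (- hardy_weight g).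
  by rewrite -[in LHS](opprK (hardy_weight g)) (ripNl LAV (L2N LAV)) (ripNr LAV LAV) opprK.
have Lg : L2 mu (hardy_weight g) by rewrite -(opprK (hardy_weight g)); exact: L2N.
rewrite !l2norm_sqr -[weighted_angular_action Lam f]/(hardy_weight g) (l2sqE Lg) (l2sqE LLop).
rewrite -EFinM lee_fin gQ LopQ.
set c := 1 - _; apply: le_trans (ler_wpM2l (sqr_ge0 c) H).
have LcT := L2Z c LT.
rewrite expr2 -mulrA -(ripZl c LT LT) -(ripZr c LT LcT).
(* It remains to compare A f(r, .) with c (A + R_n) f(r, .) on almost every slice, both carrying the
   weight r^-2; this is [spectral_bound]. *)
apply: rip_le_slices => //.
have F : Filter (nbhs (almost_everywhere leb)) by exact: ae_filter_ringOfSetsType.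
apply: filterS (ae_slice_angular saA df fg) => r Hr r0; have {Hr}[LAVr EAVr] := Hr r0.
have [m0 L0] := Lf; have Lfr := L0 _ r0; have LVr := L2_slice_hardy_weight r0 m0 Lfr.
have LAf := app_L2 saA (df r r0); have LS := opshift_L2 saA (- Rn) (df r r0).
have LTr : L2 sigma (slice T r) by exact: (L2D LAVr (L2Z Rn LVr)).
have LcTr : L2 sigma (slice (c%:C%C *: T) r) by exact: (L2Z c LTr).
split=> //.
have ETr : slice (c%:C%C *: T) r = (c * r ^- 2)%:C%C *: opshift A (- Rn) (slice f r) %[ae sigma].
  apply: filterS2 EAVr (slice_hardy_weight f r0) => x E1 E2 _.
  rewrite -[LHS]/(c%:C%C * (slice (- hardy_weight g) r x + Rn%:C%C * slice (hardy_weight f) r x)).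
  rewrite E1// E2// -[RHS]/((c * r ^- 2)%:C%C * (app A (slice f r) x - (- Rn)%:C%C * slice f r x)).
  rewrite -[LHS]/(c%:C%C * ((r ^- 2)%:C%C * app A (slice f r) x + Rn%:C%C * ((r ^- 2)%:C%C * slice f r x))).
  have -> : (c * r ^- 2)%:C%C = c%:C%C * (r ^- 2)%:C%C by rewrite rmorphM.
  have -> : (- Rn)%:C%C = - Rn%:C%C by rewrite rmorphN.
  by move: (c%:C%C) ((r ^- 2)%:C%C) (Rn%:C%C) => ? ? ?; ring.
have Z1 := L2Z (r ^- 2) LAf; have Z2 := L2Z (c * r ^- 2) LS.
have cm := @L2_cmeasurable.
rewrite (eq_rip (cm _ _ _ _ _ LAVr) (cm _ _ _ _ _ Z1) (cm _ _ _ _ _ LAVr) (cm _ _ _ _ _ Z1) EAVr EAVr).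
rewrite (eq_rip (cm _ _ _ _ _ LcTr) (cm _ _ _ _ _ Z2) (cm _ _ _ _ _ LcTr) (cm _ _ _ _ _ Z2) ETr ETr).
rewrite (ripZl _ LAf Z1) (ripZr _ LAf LAf) (ripZl _ LS Z2) (ripZr _ LS LS).
have S := spectral_bound saA specA lamo Rn0 Mfin (df r r0).
have rr : 0 <= r ^- 2 * r ^- 2 by rewrite mulr_ge0 ?invr_ge0 ?exprn_ge0 ?(ltW r0).
have := ler_wpM2l rr S; rewrite -/c => {}S.
apply: le_trans (le_trans S _); first by rewrite mulrA.
by rewrite le_eqVlt; apply/orP; left; apply/eqP; ring.
Qed.

End UpperBoundAdmissible.

(** * Test functions *)

Section Bump.
Variable R : realType.
Implicit Types (p : {poly R}) (j : nat) (t : R).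

Definition unit_parabola t : R := t * (1 - t).

(** With w = t (1 - t), the family p w^-j e^(-1/w) is closed under differentiation, so derivatives
    of all orders are explicit and one differentiability lemma covers them. *)
Definition bump p j t : R :=
  if 0 < t < 1 then p.[t] * unit_parabola t ^- j * expR (- (unit_parabola t)^-1) else 0.

(** The polynomial p' w^2 - j w w' p + w' p is the derivative of p w^-j e^(-1/w) multiplied by
    w^(j+2) e^(1/w). *)
Definition bump_deriv p j : {poly R} :=
  let w := 'X * (1 - 'X) in let w' := 1 - 'X *+ 2 in
  p^`() * w ^+ 2 - w * w' * p *+ j + w' * p.

Lemma unit_parabola_gt0 t : 0 < t < 1 -> 0 < unit_parabola t.
Proof. by move=> /andP[? ?]; rewrite mulr_gt0 ?subr_gt0. Qed.

Lemma bump_out p j t : ~~ (0 < t < 1) -> bump p j t = 0.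
Proof. by rewrite /bump => /negbTE ->. Qed.

(** The Taylor term x^(j+2) / (j+2)! <= e^x at x = 1 / w leaves two spare powers of w; these make
    the derivative vanish at 0 and 1. *)
Lemma exp_flat j (w : R) : 0 < w -> w ^- j * expR (- w^-1) <= (j.+2)`!%:R * w ^+ 2.
Proof.
move=> w0; have y0 : 0 <= w^-1 by rewrite invr_ge0 ltW.
have H : w^-1 ^+ j.+2 / (j.+2)`!%:R <= expR w^-1.
  by apply: le_trans (expR_ge1Dxn j.+1 y0); rewrite lerDr.
rewrite expRN ler_pdivrMr ?expR_gt0// -mulrA.
have f0 : 0 < (j.+2)`!%:R :> R by rewrite ltr0n fact_gt0.
have : w ^- j <= (j.+2)`!%:R * (w ^+ 2 * (w^-1 ^+ j.+2 / (j.+2)`!%:R)).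
  rewrite le_eqVlt; apply/orP; left; apply/eqP.
  rewrite -addn2 exprD exprVn; field.
  by rewrite addn2 expf_neq0 ?gt_eqF.
move=> /le_trans; apply; rewrite ler_wpM2l ?(ltW f0)// ler_wpM2l ?sqr_ge0//.
Qed.

Lemma horner_bounded p : exists2 P, 0 <= P & forall t, 0 <= t <= 1 -> `|p.[t]| <= P.
Proof.
have cp : {within `[0 : R, 1], continuous (fun t => `|p.[t]|)}.
  apply: continuous_in_subspaceT => t _; apply: cvg_norm.
  by apply/differentiable_continuous/derivable1_diffP; exact: derivable_horner.
have [c _ Hc] := EVT_max ler01 cp.
by exists `|p.[c]| => // t; rewrite -[_ <= _ <= _]/(t \in `[0, 1]) => /Hc.
Qed.

Lemma bump_flat p j : exists2 C, 0 <= C &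
  forall t, `|bump p j t| <= C * t ^+ 2 /\ `|bump p j t| <= C * (1 - t) ^+ 2.
Proof.
have [P P0 HP] := horner_bounded p.
have C0 : 0 <= P * (j.+2)`!%:R by rewrite mulr_ge0.
exists (P * (j.+2)`!%:R) => // t; rewrite /bump; case: ifPn => t01; last first.
  by rewrite normr0; split; rewrite mulr_ge0 ?sqr_ge0.
have w0 := unit_parabola_gt0 t01; have [t0 t1] := andP t01.
have B : `|p.[t] * unit_parabola t ^- j * expR (- (unit_parabola t)^-1)| <= P * (j.+2)`!%:R * unit_parabola t ^+ 2.
  rewrite -mulrA normrM -mulrA; apply: ler_pM => //; first by apply: HP; rewrite !ltW.
  by rewrite ger0_norm ?exp_flat// mulr_ge0 ?expR_ge0// invr_ge0 exprn_ge0// ltW.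
have s0 : 0 < 1 - t by rewrite subr_gt0.
split; apply: le_trans B _; rewrite ler_wpM2l// lerXn2r ?nnegrE ?(ltW w0) ?(ltW t0) ?(ltW s0)//.
  by rewrite /unit_parabola ler_piMr ?(ltW t0)//; lra.
by rewrite /unit_parabola ler_piMl ?(ltW s0)// ltW.
Qed.

Lemma bump_bounded p j : exists2 C, 0 <= C & forall t, `|bump p j t| <= C.
Proof.
have [C C0 HC] := bump_flat p j; exists C => // t.
have [t01|t01] := boolP (0 < t < 1); last by rewrite bump_out ?normr0.
apply: le_trans (proj1 (HC t)) _; have [t0 t1] := andP t01.
by rewrite ler_piMr// exprn_ile1// ltW.
Qed.

Lemma is_derive_bump p j t : is_derive t (1 : R) (bump p j) (bump (bump_deriv p j) j.+2 t).
Proof.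
have [t01|t01] := boolP (0 < t < 1).
  have w0 := unit_parabola_gt0 t01; have [t0 t1] := andP t01.
  pose G := fun s : R => p.[s] * ((unit_parabola s) ^+ j)^-1 * expR (- (unit_parabola s)^-1).
  have E : \forall s \near t, G s = bump p j s.
    near=> s; rewrite /bump ifT//; apply/andP; split; near: s.
      exact: lt_nbhsr.
    exact: lt_nbhsl.
  apply: (@near_eq_is_derive _ _ _ _ _ _ _ _ E).
  have dp : is_derive t (1 : R) (horner p) p^`().[t].
    by split; [exact: derivable_horner|rewrite derivE derive1E].
  have dw : is_derive t (1 : R) unit_parabola (1 - 2 * t).
    rewrite /unit_parabola; apply: is_derive_eq.
    by rewrite /GRing.scale /=; ring.
  have dwj : is_derive t (1 : R) (fun s => unit_parabola s ^+ j) (j%:R * unit_parabola t ^+ j.-1 * (1 - 2 * t)).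
    have -> : (fun s => unit_parabola s ^+ j) = unit_parabola ^+ j by rewrite exprfctE.
    exact: is_derive_eq.
  have wn0 : unit_parabola t != 0 by rewrite gt_eqF.
  have dwjV := @is_deriveV R (fun s => unit_parabola s ^+ j) t _ 1 (expf_neq0 j wn0) dwj.
  have dwV := @is_deriveV R unit_parabola t _ 1 wn0 dw.
  have dE : is_derive t (1 : R) (fun s => expR (- (unit_parabola s)^-1))
      (expR (- (unit_parabola t)^-1) * (unit_parabola t ^- 2 * (1 - 2 * t))).
    apply: (is_derive_eq (@is_derive1_comp R expR (fun s => - (unit_parabola s)^-1) t _ _ _ _)).
    by rewrite /GRing.scale /= mulNr opprK.
  rewrite /G; apply: is_derive_eq.
  have jw : j%:R * unit_parabola t ^+ j.-1 = j%:R * unit_parabola t ^+ j / unit_parabola t.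
    case: j {G E dwj dwjV} => [|j]; first by rewrite !mul0r.
    by rewrite exprSr /= mulrA mulfK.
  rewrite -[LHS]/((p.[t] * (unit_parabola t ^+ j)^-1) *
      (expR (- (unit_parabola t)^-1) * (unit_parabola t ^- 2 * (1 - 2 * t))) +
    expR (- (unit_parabola t)^-1) *
      (p.[t] * (- (unit_parabola t ^+ j) ^- 2 * (j%:R * unit_parabola t ^+ j.-1 * (1 - 2 * t))) +
       (unit_parabola t ^+ j)^-1 * p^`().[t])).
  have q : (bump_deriv p j).[t] = p^`().[t] * unit_parabola t ^+ 2
      - (unit_parabola t * (1 - 2 * t) * p.[t]) * j%:R + (1 - 2 * t) * p.[t].
    rewrite /bump_deriv -[_ *+ j]mulr_natr !(hornerE, hornerMn) /unit_parabola.
    by ring.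
  rewrite jw /bump t01 q (_ : unit_parabola t ^+ j.+2 = unit_parabola t ^+ j * unit_parabola t ^+ 2);
    last by rewrite -exprD addn2.
  move: (unit_parabola t) wn0 (expR _) (p.[t]) (p^`().[t]) (j%:R : R) => w {}w0 X P P' J.
  by field; rewrite w0 expf_neq0.
(* Either t is outside [0, 1] and the function vanishes near t, or t is an endpoint and |bump p j (t
   + h)| <= C h^2; in both cases the derivative is 0. *)
rewrite [X in is_derive _ _ _ X]bump_out//.
have [C C0 HC] := bump_flat p j.
have b0 : bump p j t = 0 by rewrite bump_out.
have Cp : 0 < C + 1 by lra.
apply: is_derive_near => e e0.
have H0 : \forall h \near (0 : R)^', `|bump p j (t + h)| <= C * `|h| ^+ 2.
  have [tneg|tpos] := ltP t 0.
    have tn : 0 < - t by lra.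
    apply: filterS (dnbhs0_lt tn) => h; rewrite ltr_norml => /andP[_ hlt].
    by rewrite bump_out ?normr0 ?mulr_ge0 ?sqr_ge0//; lra.
  have [t1|t1] := ltP 1 t.
    have tn : 0 < t - 1 by lra.
    apply: filterS (dnbhs0_lt tn) => h; rewrite ltr_norml => /andP[hlt _].
    by rewrite bump_out ?normr0 ?mulr_ge0 ?sqr_ge0//; lra.
  apply: filterE => h; rewrite real_normK ?num_real//.
  have [->|t0] := eqVneq t 0; first by rewrite add0r; case: (HC h).
  have -> : t = 1.
    apply/eqP; rewrite eq_le t1 leNgt; apply: contra t01 => t1'.
    by rewrite t1' lt_neqAle eq_sym t0 tpos.
  by have [_] := HC (1 + h); rewrite opprD addrA subrr add0r sqrrN.
have e1 : 0 < e / (C + 1) by rewrite divr_gt0.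
apply: filterS2 H0 (dnbhs0_neq_lt e1) => h H [hn0 hlt].
rewrite b0 !subr0 normrM normfV.
have h0 : 0 < `|h| by rewrite normr_gt0.
rewrite mulrC ltr_pdivrMr//; apply: le_lt_trans H _.
rewrite expr2 mulrA ltr_pM2r//; move: hlt; rewrite ltr_pdivlMr//.
by move: h0; nra.
Unshelve. all: by end_near. Qed.

End Bump.

(** * Radial derivatives of separated functions *)

Section RadialDerivative.
Variables (R : realType) (n : nat).
Local Notation E := (Eucl R n).
Local Notation sigma := (\sigma_(R, n)).
Implicit Types (f g : E -> R[i]).

Lemma L2_quot_err f g r h : L2slices f -> L2slices g -> 0 < r -> 0 < r + h ->
  L2 sigma (quot_err f g r h).
Proof.
move=> [_ Lf] [_ Lg] r0 rh0.
by apply: L2B; [apply: L2Z; apply: L2B; exact: Lf|exact: Lg].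
Qed.

Lemma quot_err_radial_derivative f g : L2slices f -> L2slices g ->
  (forall r e, 0 < r -> 0 < e ->
     \forall h \near 0^', rip sigma (quot_err f g r h) (quot_err f g r h) < e) ->
  is_radial_derivative f g.
Proof.
move=> Lf Lg H; split=> // r r0.
have E : \forall h \near 0^', l2norm sigma (quot_err f g r h) =
    (Num.sqrt (rip sigma (quot_err f g r h) (quot_err f g r h)))%:E.
  apply: filterS (near_pos_shift r0) => h rh0.
  exact: l2norm_sqrt (L2_quot_err Lf Lg r0 rh0).
apply/fine_cvgP; split.
  by apply: filterS E => h; rewrite /= -[X in l2norm _ X]/(quot_err f g r h) => ->.
apply/cvgrPdist_lt => e e0; have e2 : 0 < e ^+ 2 by rewrite exprn_gt0.
apply: filterS2 E (H r _ r0 e2) => h E1 He.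
rewrite /= -[X in l2norm _ X]/(quot_err f g r h) E1 sub0r normrN ger0_norm ?sqrtr_ge0//=.
by rewrite -[ltRHS](ger0_norm (ltW e0)) -sqrtr_sqr ltr_sqrt.
Qed.

Lemma eq_radial_derivative f f' g : L2slices f -> L2slices f' ->
  (forall r, 0 < r -> slice f r = slice f' r %[ae sigma]) ->
  is_radial_derivative f g -> is_radial_derivative f' g.
Proof.
move=> Lf Lf' ff' fg; have [Lg _] := fg.
apply: quot_err_radial_derivative => // r e r0 e0.
apply: filterS2 (near_pos_shift r0) (quot_err_small Lf fg r0 e0) => h rh0.
have Q : quot_err f g r h = quot_err f' g r h %[ae sigma].
  apply: filterS2 (ff' _ r0) (ff' _ rh0) => x E1 E2 I.
  rewrite -[LHS]/((h^-1)%:C%C * (slice f (r + h) x - slice f r x) - slice g r x).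
  by rewrite E1// E2.
have [m _] := L2_quot_err Lf Lg r0 rh0; have [m' _] := L2_quot_err Lf' Lg r0 rh0.
by rewrite (eq_rip m m' m m' Q Q).
Qed.

(** g - g' is the difference of two errors of the same difference quotient, both tending to 0 in
    norm. *)
Lemma radial_derivative_unique f g g' : L2slices f ->
  is_radial_derivative f g -> is_radial_derivative f g' ->
  forall r, 0 < r -> slice g r = slice g' r %[ae sigma].
Proof.
move=> Lf fg fg' r r0; have [Lg _] := fg; have [Lg' _] := fg'.
have Lgr := Lg.2 r r0; have Lgr' := Lg'.2 r r0; have LB := L2B Lgr Lgr'.
suff Z : rip sigma (slice g r - slice g' r) (slice g r - slice g' r) = 0.
  apply: filterS (rip_eq0 LB Z) => x H I; apply/eqP; rewrite -subr_eq0; apply/eqP.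
  exact: H.
apply/eqP; rewrite eq_le rip_ge0 andbT leNgt; apply/negP => pos.
have e0 : 0 < rip sigma (slice g r - slice g' r) (slice g r - slice g' r) / 4 by rewrite divr_gt0.
near (0 : R)^' => h.
have rh0 : 0 < r + h by near: h; exact: near_pos_shift.
have H1 : rip sigma (quot_err f g r h) (quot_err f g r h) <
    rip sigma (slice g r - slice g' r) (slice g r - slice g' r) / 4.
  by near: h; exact: quot_err_small.
have H2 : rip sigma (quot_err f g' r h) (quot_err f g' r h) <
    rip sigma (slice g r - slice g' r) (slice g r - slice g' r) / 4.
  by near: h; exact: quot_err_small.
have L1 := L2_quot_err Lf Lg r0 rh0; have L2' := L2_quot_err Lf Lg' r0 rh0.
have D : slice g r - slice g' r = quot_err f g' r h + - quot_err f g r h.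
  rewrite /quot_err; move: (_ *: _) (slice g r) (slice g' r) => a b c.
  by rewrite opprB [RHS]addrC subrKA.
have := ripD_le L2' (L2N L1); rewrite -D ripNl ?ripNr ?opprK//; last exact: L2N.
by move: H1 H2; lra.
Unshelve. all: by end_near. Qed.

End RadialDerivative.

Section SeparatedVariables.
Variables (R : realType) (n : nat).
Local Notation leb := (@lebesgue_measure R).
Local Notation E := (Eucl R n.+1).
Local Notation sigma := (\sigma_(R, n.+1)).
Variable u : E -> R[i].
Hypothesis Lu : L2 sigma u.

Definition separated (psi : R -> R) : E -> R[i] :=
  fun x => (psi (enorm x))%:C%C * u (direction x).

Lemma slice_separated psi r : 0 < r -> slice (separated psi) r = (psi r)%:C%C *: u %[ae sigma].
Proof.
move=> r0; apply: filterS (@surface_ae_norm R n) => x x1 _.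
rewrite /slice /separated /direction enorm_dilate ?ltW// x1 mulr1 dilate_dilate.
by rewrite mulVf ?gt_eqF// dilate1.
Qed.

Lemma cmeasurable_separated psi : measurable_fun setT psi -> cmeasurable (separated psi).
Proof.
move=> mpsi; have [[mr mi] _] := Lu; apply: cmeasurable_mulr.
  by apply: measurableT_comp mpsi _; exact: measurable_enorm.
by split; [apply: (measurableT_comp mr)|apply: (measurableT_comp mi)]; exact: measurable_direction.
Qed.

Lemma L2slices_separated psi : measurable_fun setT psi -> L2slices (separated psi).
Proof.
move=> mpsi; have m := cmeasurable_separated mpsi; split=> // r r0.
apply: (eq_L2 (L2Z (psi r) Lu)); first exact: cmeasurable_slice.
by apply: filterS (slice_separated psi r0) => x H I; rewrite H.
Qed.

Lemma is_radial_derivative_separated (psi dpsi : R -> R) :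
  measurable_fun setT psi -> measurable_fun setT dpsi ->
  (forall r : R, 0 < r -> is_derive r (1 : R) psi (dpsi r)) ->
  is_radial_derivative (separated psi) (separated dpsi).
Proof.
move=> m m' D; have L := L2slices_separated m; have L' := L2slices_separated m'.
apply: quot_err_radial_derivative => // r e r0 e0.
have q0 := rip_ge0 sigma u.
have e1 : 0 < Num.sqrt (e / (rip sigma u u + 1)).
  by rewrite sqrtr_gt0 divr_gt0//; lra.
have cD : h^-1 *: ((psi \o shift r) (h *: (1 : R)) - psi r) @[h --> 0^'] --> dpsi r.
  by have [d1 d2] := D r r0; rewrite -d2; exact: d1.
move/cvgrPdist_lt : cD => /(_ _ e1) H.
apply: filterS2 (near_pos_shift r0) H => h rh0.
rewrite distrC /= -[h%:A]/(h * 1) mulr1 -[_ *: _]/(h^-1 * _) (addrC h r).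
set t := _ - dpsi r => Ht.
have Q : quot_err (separated psi) (separated dpsi) r h = t%:C%C *: u %[ae sigma].
  apply: filterS3 (slice_separated psi rh0) (slice_separated psi r0) (slice_separated dpsi r0).
  move=> x E1 E2 E3 I.
  rewrite -[LHS]/((h^-1)%:C%C * (slice (separated psi) (r + h) x - slice (separated psi) r x)
    - slice (separated dpsi) r x) E1// E2// E3//.
  rewrite -[LHS]/((h^-1)%:C%C * ((psi (r + h))%:C%C * u x - (psi r)%:C%C * u x) - (dpsi r)%:C%C * u x).
  rewrite -[RHS]/(t%:C%C * u x).
  have -> : t%:C%C = (h^-1)%:C%C * ((psi (r + h))%:C%C - (psi r)%:C%C) - (dpsi r)%:C%C.
    by rewrite /t rmorphB rmorphM rmorphB.
  by move: ((h^-1)%:C%C) ((psi (r + h))%:C%C) ((psi r)%:C%C) ((dpsi r)%:C%C) (u x) => *; ring.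
have [mq _] := L2_quot_err L L' r0 rh0; have Lt := L2Z t Lu; have [mt _] := Lt.
rewrite (eq_rip mq mt mq mt Q Q) ripZl// ripZr// mulrA -expr2.
have : t ^+ 2 < e / (rip sigma u u + 1).
  have ee : 0 <= e / (rip sigma u u + 1) by apply: divr_ge0; lra.
  by rewrite -(sqr_sqrtr ee) -(real_normK (num_real t)) ltr_sqr ?nnegrE ?sqrtr_ge0.
rewrite ltr_pdivlMr; last by lra.
by apply: le_lt_trans; rewrite mulrDr lerDl mulr1 sqr_ge0.
Qed.

(** [radial_derivative] is an arbitrary choice, so its iterates are identified only slice by slice:
    the explicit derivative of psi j is transported to the j-th iterate, which shows that a
    derivative exists, and uniqueness identifies the chosen one with it. *)
Lemma radial_derivative_separated (psi : nat -> R -> R) :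
  (forall j, measurable_fun setT (psi j)) ->
  (forall j (r : R), 0 < r -> is_derive r (1 : R) (psi j) (psi j.+1 r)) ->
  let D j := iter j (@radial_derivative R n.+1) (separated (psi 0%N)) in
  (forall j, is_radial_derivative (D j) (D j.+1)) /\
  forall j, L2slices (D j) /\
    forall r, 0 < r -> slice (D j) r = (psi j r)%:C%C *: u %[ae sigma].
Proof.
move=> m dpsi D.
have step j : L2slices (D j) /\ (forall r, 0 < r -> slice (D j) r = (psi j r)%:C%C *: u %[ae sigma]) ->
    is_radial_derivative (D j) (separated (psi j.+1)).
  move=> [LD ED]; have L := L2slices_separated (m j).
  apply: (eq_radial_derivative L LD); last by apply: is_radial_derivative_separated => //; exact: dpsi.
  move=> r r0; apply: filterS2 (ED r r0) (slice_separated (psi j) r0) => x E1 E2 I.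
  by rewrite E1// E2.
have next j : is_radial_derivative (D j) (separated (psi j.+1)) -> is_radial_derivative (D j) (D j.+1).
  by move=> H; exact: (@xgetPex _ (fun=> 0) [set g | is_radial_derivative (D j) g] (ex_intro _ _ H)).
have main j : L2slices (D j) /\
    forall r, 0 < r -> slice (D j) r = (psi j r)%:C%C *: u %[ae sigma].
  elim: j => [|j IH].
    by split; [exact: L2slices_separated|move=> r r0; exact: slice_separated].
  have H := step j IH; have H' := next j H; split; first by case: H'.
  move=> r r0; have U := radial_derivative_unique (proj1 IH) H' H r0.
  by apply: filterS2 U (slice_separated (psi j.+1) r0) => x E1 E2 I; rewrite E1// E2.
by split=> // j; exact: next (step j (main j)).
Qed.

End SeparatedVariables.

Section Profile.
Variable R : realType.
Local Notation leb := (@lebesgue_measure R).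

Fixpoint bump_poly i : {poly R} :=
  if i is i'.+1 then bump_deriv (bump_poly i') i'.*2 else 1.

(* The i-th derivative of t |-> exp (-1 / (t (1 - t))), extended by 0 outside (0, 1). *)
Definition unit_bump i : R -> R := bump (bump_poly i) i.*2.

Lemma is_derive_unit_bump i t : is_derive t (1 : R) (unit_bump i) (unit_bump i.+1 t).
Proof. exact: is_derive_bump. Qed.

Lemma unit_bump_bounded i : exists2 C, 0 <= C & forall t, `|unit_bump i t| <= C.
Proof. exact: bump_bounded. Qed.

Lemma unit_bump_out i t : ~~ (0 < t < 1) -> unit_bump i t = 0.
Proof. exact: bump_out. Qed.

Lemma unit_bump_ge t : 4^-1 <= t <= 3 / 4 -> expR (- (16 / 3)) <= unit_bump 0 t.
Proof.
move=> /andP[t1 t2]; have t01 : 0 < t < 1 by apply/andP; split; lra.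
rewrite /unit_bump /bump t01 hornerC mul1r expr0 invr1 mul1r ler_expR lerN2.
have w : 3 / 16 <= unit_parabola t by rewrite /unit_parabola; nra.
rewrite (_ : 16 / 3 = (3 / 16 : R)^-1); last by field.
by rewrite lef_pV2 ?posrE ?unit_parabola_gt0.
Qed.

Variables (mu eps : R).

(* r |-> r^mu X(eps ln r) has j-th derivative r^(mu - j) (profile_factor j 0)(eps ln r). *)
Fixpoint profile_factor j i (t : R) : R :=
  if j is j'.+1 then (mu - j'%:R) * profile_factor j' i t + eps * profile_factor j' i.+1 t
  else unit_bump i t.

Lemma is_derive_profile_factor j i t :
  is_derive t (1 : R) (profile_factor j i) (profile_factor j i.+1 t).
Proof.
elim: j i => [|j IH] i; first exact: is_derive_unit_bump.
have D1 := IH i; have D2 := IH i.+1.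
exact: is_derive_eq.
Qed.

Definition profile j (r : R) : R := expR ((mu - j%:R) * ln r) * profile_factor j 0 (eps * ln r).

Lemma is_derive_profile j (r : R) : 0 < r -> is_derive r (1 : R) (profile j) (profile j.+1 r).
Proof.
move=> r0; have dln := is_derive1_ln r0.
have dl : is_derive r (1 : R) (fun r => eps * ln r) (eps * r^-1).
  by apply: is_derive_eq; rewrite /GRing.scale /=; ring.
have dE : is_derive r (1 : R) (fun r => expR ((mu - j%:R) * ln r))
    ((mu - j%:R) * r^-1 * expR ((mu - j%:R) * ln r)).
  apply: (is_derive_eq (@is_derive1_comp R expR (fun r => (mu - j%:R) * ln r) r _ _ _ _)).
  by rewrite /GRing.scale /=; ring.
have dF := @is_derive1_comp R (profile_factor j 0) (fun r => eps * ln r) r _ _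
  (is_derive_profile_factor j 0 (eps * ln r)) dl.
rewrite /profile; apply: is_derive_eq.
rewrite -[LHS]/(expR ((mu - j%:R) * ln r) * (profile_factor j 1 (eps * ln r) * (eps * r^-1)) +
  profile_factor j 0 (eps * ln r) * ((mu - j%:R) * r^-1 * expR ((mu - j%:R) * ln r))).
have -> : (mu - j.+1%:R) * ln r = (mu - j%:R) * ln r - ln r by rewrite -natr1; ring.
by rewrite expRD expRN lnK ?posrE//=; ring.
Qed.

Lemma measurable_profile_factor j i : measurable_fun setT (profile_factor j i).
Proof.
apply: continuous_measurable_fun => t.
apply/differentiable_continuous/derivable1_diffP.
by case: (is_derive_profile_factor j i t).
Qed.

Lemma measurable_profile j : measurable_fun setT (profile j).
Proof.
apply: measurable_funM.
  apply: (measurableT_comp (@measurable_expR R)); apply: measurable_funM => //; exact: measurable_ln.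
apply: (measurableT_comp (measurable_profile_factor j 0)).
by apply: measurable_funM => //; exact: measurable_ln.
Qed.

Hypothesis eps0 : 0 < eps.

Lemma profile_factor_out j i t : ~~ (0 < t < 1) -> profile_factor j i t = 0.
Proof.
by move=> t01; elim: j i => [|j IH] i /=; rewrite ?unit_bump_out// !IH !mulr0 addr0.
Qed.

Lemma profile_out j r : 0 < r -> ~ (1 <= r <= expR eps^-1) -> profile j r = 0.
Proof.
move=> r0 H; rewrite /profile profile_factor_out ?mulr0//.
apply/negP; rewrite pmulr_rgt0// mulrC -ltr_pdivlMr// div1r => /andP[l0 l1]; apply: H.
have -> : r = expR (ln r) by rewrite lnK.
by rewrite -[leLHS]expR0 !ler_expR !ltW.
Qed.

Lemma profile0_bounded : exists2 K, 0 <= K & forall r, 0 < r -> `|profile 0 r| <= K.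
Proof.
have [C C0 HC] := unit_bump_bounded 0.
have K0 : 0 <= expR (`|mu| * eps^-1) * C by rewrite mulr_ge0 ?expR_ge0.
exists (expR (`|mu| * eps^-1) * C) => // r r0.
have [/andP[r1 r2]|/negP H] := boolP (1 <= r <= expR eps^-1); last first.
  by rewrite profile_out ?normr0.
have l0 : 0 <= ln r by rewrite ln_ge0.
have l1 : ln r <= eps^-1 by rewrite -[leRHS]expRK ler_ln ?posrE ?expR_gt0.
rewrite -[profile 0 r]/(expR ((mu - 0%:R) * ln r) * unit_bump 0 (eps * ln r)) normrM; apply: ler_pM; rewrite ?normr_ge0 ?HC//.
rewrite ger0_norm ?expR_ge0// ler_expR subr0.
apply: le_trans (ler_norm _) _; rewrite normrM (ger0_norm l0).
by rewrite ler_wpM2l.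
Qed.

End Profile.

(** In dimension n+1 the exponent is mu = (4 - (n+1)) / 2, for which mu (mu + n - 1) = - R_(n+1) and
    the coefficient 2 mu + n - 1 of X' equals 2. *)
Lemma profile_combination (R : realType) (n : nat) (l eps r : R) : 0 < r ->
  let mu := (3 - n%:R) / 2 in
  profile mu eps 2 r + n%:R / r * profile mu eps 1 r - l * r ^- 2 * profile mu eps 0 r =
  expR ((mu - 2) * ln r) * (eps * (2 * @unit_bump R 1 (eps * ln r) + eps * @unit_bump R 2 (eps * ln r))
    - (l + Rellich R n.+1) * @unit_bump R 0 (eps * ln r)).
Proof.
move=> r0 mu; rewrite /profile; have lnK' : expR (ln r) = r by rewrite lnK.
have E1 : expR ((mu - 1%:R) * ln r) = expR ((mu - 2) * ln r) * r.
  by rewrite -[X in _ = _ * X]lnK' -expRD; congr expR; ring.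
have E0 : expR ((mu - 0%:R) * ln r) = expR ((mu - 2) * ln r) * r ^+ 2.
  by rewrite -[X in _ = _ * X ^+ 2]lnK' -expRM_natl -expRD; congr expR; ring.
rewrite E1 E0 /= /Rellich -natr1.
move: (@unit_bump R 0 _) (@unit_bump R 1 _) (@unit_bump R 2 _) (expR _) => X0 X1 X2 X.
by rewrite /mu; field; rewrite gt_eqF.
Qed.

Lemma expR_lnM (R : realType) (m : nat) (r : R) : 0 < r -> expR (- m%:R * ln r) = r ^- m.
Proof. by move=> r0; rewrite mulNr expRN expRM_natl lnK. Qed.

Lemma measurable_unit_bump (R : realType) i : measurable_fun setT (@unit_bump R i).
Proof. exact: (measurable_profile_factor 0 0 0 i). Qed.

(** * Admissibility and norms of the test functions *)

Section TestFunctions.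
Variables (R : realType) (n : nat).
Local Notation leb := (@lebesgue_measure R).
Local Notation E := (Eucl R n.+1).
Local Notation mu := (lebesgue_eucl R n.+1).
Local Notation sigma := (\sigma_(R, n.+1)).
Variables (Lam : l2op E R) (l : R) (u : E -> R[i]) (eps : R).
Local Notation A := (oppop Lam).
Hypotheses (saA : selfadjoint sigma A) (du : dom A u)
  (eigu : app A u = (fun x => l%:C%C * u x) %[ae sigma]) (eps0 : 0 < eps).

Local Notation psi := (profile ((3 - n%:R) / 2) eps).
Local Notation q := (rip sigma u u).

Definition test_fun : E -> R[i] := separated u (psi 0).

Let Lu : L2 sigma u := dom_L2 saA du.

Lemma l2sq_scaled c v : cmeasurable v -> v = c%:C%C *: u %[ae sigma] ->
  l2sq sigma v = (c ^+ 2 * q)%:E.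
Proof.
move=> mv vE; have Lc := L2Z c Lu; have [mc _] := Lc.
have Lv : L2 sigma v by apply: (eq_L2 Lc mv); apply: filterS vE => x H I; rewrite H.
by rewrite (l2sqE Lv) (eq_rip mv mc mv mc vE vE) ripZl// ripZr// mulrA.
Qed.

Lemma cmeasurable_test : cmeasurable test_fun.
Proof. exact: (cmeasurable_separated Lu (measurable_profile _ _ _)). Qed.

Lemma slice_test r : 0 < r -> (psi 0 r)%:C%C *: u = slice test_fun r %[ae sigma].
Proof.
by move=> r0; apply: filterS (slice_separated u (psi 0) r0) => x H I; rewrite H.
Qed.

Lemma dom_test r : 0 < r -> dom A (slice test_fun r).
Proof.
move=> r0; apply: (eq_dom saA (dom_scale saA (psi 0 r) du) _ (slice_test r0)).
exact/cmeasurable_slice/cmeasurable_test.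
Qed.

Lemma is_angular_test : is_angular_action Lam test_fun (separated u (fun r => - (l * psi 0 r))).
Proof.
have mpsi : measurable_fun setT (fun r => - (l * psi 0 r)).
  by apply: measurableT_comp => //; apply: measurable_funM => //; exact: measurable_profile.
split; first exact: cmeasurable_separated.
apply: aeW => r r0.
have E1 := eq_app saA (dom_scale saA (psi 0 r) du) (cmeasurable_slice r cmeasurable_test) (slice_test r0).
have E2 := app_scale saA (psi 0 r) du.
have E3 := slice_separated u (fun r => - (l * psi 0 r)) r0.
apply: filterS2 (filterI E1 E2) (filterI E3 eigu) => x [H1 H2] [H3 H4] I.
rewrite H3//; apply: oppr_inj; rewrite -[LHS]/(app A (slice test_fun r) x) -H1// H2//.
rewrite -[LHS]/((psi 0 r)%:C%C * app A u x) H4//.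
rewrite -[RHS]/(- ((- (l * psi 0 r))%:C%C * u x)).
have -> : (- (l * psi 0 r))%:C%C = - (l%:C%C * (psi 0 r)%:C%C) by rewrite rmorphN rmorphM.
by move: (_%:C)%C (l%:C)%C (u x) => *; ring.
Qed.

Lemma angular_action_test : is_angular_action Lam test_fun (angular_action Lam test_fun).
Proof.
exact: (@xgetPex _ (fun=> 0) [set g | is_angular_action Lam test_fun g] (ex_intro _ _ is_angular_test)).
Qed.

(** Two functions satisfying [is_angular_action] agree on almost every slice, so the chosen one is
    computed from the explicit one. *)
Lemma slice_angular_test : {ae leb, forall r, 0 < r ->
  slice (angular_action Lam test_fun) r = (- (l * psi 0 r))%:C%C *: u %[ae sigma]}.
Proof.
have F : Filter (nbhs (almost_everywhere leb)) by exact: ae_filter_ringOfSetsType.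
apply: filterS2 (proj2 angular_action_test) (proj2 is_angular_test) => r H1 H2 r0.
apply: filterS3 (H1 r0) (H2 r0) (slice_separated u (fun r => - (l * psi 0 r)) r0).
by move=> x E1 E2 E3 I; rewrite -E1// E2// E3.
Qed.

Lemma admissible_test : admissible Lam test_fun.
Proof.
have [dD HD] := @radial_derivative_separated R n u Lu psi (measurable_profile _ _)
  (fun j r r0 => is_derive_profile _ _ j r0).
have [mg _] := angular_action_test.
split.
- by split; [exact: (proj1 (HD 0%N))|exact: dD].
- exists 1, (expR eps^-1); split => // r r0 rab.
  apply: filterS (slice_separated u (psi 0) r0) => x H I; rewrite H//.
  by rewrite -[LHS]/((psi 0 r)%:C%C * u x) (profile_out _ eps0 _ r0 rab) mul0r.
- exact: dom_test.
- exact: angular_action_test.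
have [K K0 HK] := profile0_bounded ((3 - n%:R) / 2) eps0.
have c0 : 0 <= (l * K) ^+ 2 * q by rewrite mulr_ge0 ?sqr_ge0 ?rip_ge0.
apply: (@le_lt_trans _ _ (\int[leb]_(r in `]0%R, +oo[)
    ((((l * K) ^+ 2 * q)%:E * (\1_(`[0, expR eps^-1]) r)%:E)))%E).
  apply: ae_ge0_le_integral => //.
  - by move=> r _; exact: sqre_ge0.
  - rewrite (_ : (fun _ => _) = fun r : R => l2sq sigma (slice (angular_action Lam test_fun) r)); last first.
      by apply/funext => r; rewrite l2norm_sqr.
    by apply: measurable_funTS; exact: measurable_l2sq_slice.
  - by move=> r _; rewrite mule_ge0// lee_fin.
  - by apply: measurable_funeM; apply/measurable_EFinP; exact: measurable_indic.
  have F : Filter (nbhs (almost_everywhere leb)) by exact: ae_filter_ringOfSetsType.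
  apply: filterS slice_angular_test => r H rin.
  have r0 : 0 < r by move: rin; rewrite /= in_itv/= andbT.
  rewrite l2norm_sqr (l2sq_scaled (cmeasurable_slice r mg) (H r0)) -EFinM lee_fin sqrrN.
  have [/andP[r1 r2]|/negP rab] := boolP (1 <= r <= expR eps^-1); last first.
    by rewrite (profile_out _ eps0 _ r0 rab) mulr0 expr0n mul0r mulr_ge0.
  rewrite indicE mem_set/= ?in_itv/= ?(ltW r0)// mulr1.
  rewrite ler_wpM2r ?rip_ge0// -(real_normK (num_real (l * K))) -(real_normK (num_real (l * _))).
  rewrite lerXn2r ?nnegrE ?normr_ge0// [leLHS]normrM [leRHS]normrM ler_wpM2l//.
  by rewrite (ger0_norm K0) HK.
rewrite ge0_integralZl_EFin//; last by apply/measurable_EFinP; exact: measurable_indic.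
rewrite integral_indic// lte_mul_pinfty ?lee_fin//.
apply: (@le_lt_trans _ _ (leb `[0%R, expR eps^-1]%classic)%E).
  by apply: le_measure; rewrite ?inE//; exact: measurableI.
by rewrite lebesgue_measure_itv/= lte_fin; case: ifPn => _; rewrite ltry.
Qed.

Lemma l2sq_radial (v : E -> R[i]) (phi : R -> R) : cmeasurable v -> measurable_fun setT phi ->
  {ae leb, forall r, 0 < r -> slice v r = (phi r)%:C%C *: u %[ae sigma]} ->
  l2sq mu v = (\int[leb]_(r in `]0%R, +oo[) (r ^+ n * (phi r ^+ 2 * q))%:E)%E.
Proof.
move=> mv mphi H; rewrite l2sq_polar//; apply: ae_eq_integral => //.
- exact: measurable_polar_density.
- apply/measurable_EFinP; apply: measurable_funTS; apply: measurable_funM.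
    exact: measurable_funX.
  by apply: measurable_funM => //; exact: measurable_funX.
have F : Filter (nbhs (almost_everywhere leb)) by exact: ae_filter_ringOfSetsType.
apply: filterS H => r H; rewrite /= in_itv/= andbT => r0.
by rewrite (l2sq_scaled (cmeasurable_slice r mv) (H r0)) EFinM.
Qed.

(* The weight exp(- ln r) is 1 / r; it keeps integrands measurable on all of R. *)
Definition log_integral (G : R -> R) : \bar R :=
  (\int[leb]_(r in `]0%R, +oo[) (expR (- ln r) * G (eps * ln r))%:E)%E.

(** For mu = (3 - n) / 2 the powers cancel to r^n r^(2 (mu - 2)) = r^-1, so the squared norm becomes
    an integral against dr / r, that is in ln r. *)
Lemma l2sq_radial_log (v : E -> R[i]) (G : R -> R) : cmeasurable v -> measurable_fun setT G ->
  {ae leb, forall r, 0 < r -> slice v r =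
    (expR (((3 - n%:R) / 2 - 2) * ln r) * G (eps * ln r))%:C%C *: u %[ae sigma]} ->
  l2sq mu v = log_integral (fun t => G t ^+ 2 * q).
Proof.
move=> mv mG H; rewrite (l2sq_radial mv _ H).
  apply: eq_integral => r; rewrite inE/= in_itv/= andbT => r0; congr EFin.
  have -> : r ^+ n = expR (n%:R * ln r) by rewrite expRM_natl lnK.
  rewrite exprMn -expRM_natl; move: (G _ ^+ 2) q => g q'.
  rewrite -!mulrA mulrA -expRD; by congr (expR _ * _); field.
have ml := @measurable_ln R; apply: measurable_funM.
  by apply: (measurableT_comp (@measurable_expR R)); exact: measurable_funM.
by apply: (measurableT_comp mG); exact: measurable_funM.
Qed.

Lemma l2norm_weighted_test :
  (l2norm mu (weighted_angular_action Lam test_fun) ^+ 2)%E =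
  log_integral (fun t => (- (l * unit_bump 0 t)) ^+ 2 * q).
Proof.
rewrite l2norm_sqr; have [mg _] := angular_action_test.
apply: (@l2sq_radial_log _ (fun t => - (l * unit_bump 0 t))).
- exact: (cmeasurable_hardy_weight mg).
- by apply: measurableT_comp => //; apply: measurable_funM => //; exact: measurable_unit_bump.
have F : Filter (nbhs (almost_everywhere leb)) by exact: ae_filter_ringOfSetsType.
apply: filterS slice_angular_test => r H r0.
apply: filterS2 (H r0) (slice_hardy_weight (angular_action Lam test_fun) r0) => x E1 E2 I.
rewrite [LHS]E2// -[LHS]/((r ^- 2)%:C%C * slice (angular_action Lam test_fun) r x) E1//.
rewrite -[LHS]/((r ^- 2)%:C%C * ((- (l * psi 0 r))%:C%C * u x)) mulrA -rmorphM.
rewrite -[RHS]/(_%:C%C * u x); congr (_%:C%C * _).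
rewrite -[psi 0 r]/(expR (((3 - n%:R) / 2 - 0%:R) * ln r) * unit_bump 0 (eps * ln r)).
rewrite -(expR_lnM 2 r0).
have -> : expR (((3 - n%:R) / 2 - 2) * ln r) = expR (- 2%:R * ln r) * expR (((3 - n%:R) / 2 - 0%:R) * ln r).
  by rewrite -expRD; congr expR; ring.
by ring.
Qed.

Lemma l2norm_Lop_test :
  (l2norm mu (Lop Lam test_fun) ^+ 2)%E =
  log_integral (fun t => (eps * (2 * unit_bump 1 t + eps * unit_bump 2 t)
    - (l + Rellich R n.+1) * unit_bump 0 t) ^+ 2 * q).
Proof.
rewrite l2norm_sqr; have [mg _] := angular_action_test.
have [dD HD] := @radial_derivative_separated R n u Lu psi (measurable_profile _ _)
  (fun j r r0 => is_derive_profile _ _ j r0).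
have mD j := proj1 (proj1 (HD j)).
pose v1 : E -> R[i] := fun x => ((n.+1%:R - 1) / enorm x)%:C%C * radial_derivative test_fun x.
have mv1 : cmeasurable v1.
  apply: cmeasurable_mulr (mD 1%N); apply: measurable_funM => //.
  exact: (measurable_enormV 1).
have mb := @measurable_unit_bump R.
apply: (@l2sq_radial_log _ (fun t => eps * (2 * unit_bump 1 t + eps * unit_bump 2 t)
    - (l + Rellich R n.+1) * unit_bump 0 t)).
- apply: (@cmeasurableD _ _ _ (radial_laplacian test_fun)); last exact: (cmeasurable_hardy_weight mg).
  exact: (cmeasurableD (mD 2%N) mv1).
- apply: measurable_funB; last exact: measurable_funM.
  by apply: measurable_funM => //; apply: measurable_funD; exact: measurable_funM.
have F : Filter (nbhs (almost_everywhere leb)) by exact: ae_filter_ringOfSetsType.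
apply: filterS slice_angular_test => r H r0.
have S1 := slice_radial (fun s => (n.+1%:R - 1) / s) (radial_derivative test_fun) r0.
have S0 := slice_hardy_weight (angular_action Lam test_fun) r0.
have D1 := proj2 (HD 1%N) r r0; have D2 := proj2 (HD 2%N) r r0.
apply: filterS3 (filterI S1 S0) (filterI D1 D2) (H r0) => x [E1 E0] [F1 F2] E3 I.
rewrite -[LHS]/(slice (iter 2 (@radial_derivative R n.+1) test_fun) r x + slice v1 r x +
  slice (hardy_weight (angular_action Lam test_fun)) r x) F2// E0// [X in _ + X + _]E1//.
rewrite -[LHS]/((psi 2 r)%:C%C * u x +
  ((n.+1%:R - 1) / r)%:C%C * slice (iter 1 (@radial_derivative R n.+1) test_fun) r x +
  (r ^- 2)%:C%C * slice (angular_action Lam test_fun) r x) F1// E3//.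
rewrite -[LHS]/((psi 2 r)%:C%C * u x + ((n.+1%:R - 1) / r)%:C%C * ((psi 1 r)%:C%C * u x) +
  (r ^- 2)%:C%C * ((- (l * psi 0 r))%:C%C * u x)).
rewrite -(profile_combination n l eps r0).
move: (psi 2 r) (psi 1 r) (psi 0 r) => p2 p1 p0.
rewrite !mulrA -!rmorphM -!mulrDl -!rmorphD -[RHS]/(_%:C%C * u x); congr (_%:C%C * _).
by rewrite -natr1; ring.
Qed.

End TestFunctions.

Section LogIntegral.
Variables (R : realType) (eps : R).
Hypothesis eps0 : 0 < eps.
Local Notation leb := (@lebesgue_measure R).
Implicit Types G H : R -> R.

Lemma measurable_log_weight G (D : set R) : measurable_fun setT G ->
  measurable_fun D (fun r => (expR (- ln r) * G (eps * ln r))%:E).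
Proof.
move=> mG; apply/measurable_EFinP; apply: measurable_funTS.
have ml := @measurable_ln R; apply: measurable_funM.
  by apply: (measurableT_comp (@measurable_expR R)); exact: measurableT_comp.
by apply: (measurableT_comp mG); exact: measurable_funM.
Qed.

Lemma le_log_integral G H : measurable_fun setT G -> measurable_fun setT H ->
  (forall t, 0 <= G t) -> (forall t, G t <= H t) ->
  (log_integral eps G <= log_integral eps H)%E.
Proof.
move=> mG mH G0 GH; apply: ge0_le_integral => //.
- by move=> r _; rewrite lee_fin mulr_ge0 ?expR_ge0.
- exact: measurable_log_weight.
- exact: measurable_log_weight.
- by move=> r _; rewrite lee_fin ler_wpM2l ?expR_ge0.
Qed.

Lemma log_integralZ k G : 0 <= k -> measurable_fun setT G -> (forall t, 0 <= G t) ->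
  log_integral eps (fun t => k * G t) = (k%:E * log_integral eps G)%E.
Proof.
move=> k0 mG G0; rewrite /log_integral -ge0_integralZl_EFin//.
- by apply: eq_integral => r _; rewrite -EFinM; congr EFin; ring.
- by move=> r _; rewrite lee_fin mulr_ge0 ?expR_ge0.
- exact: measurable_log_weight.
Qed.

Lemma log_integralD G H : measurable_fun setT G -> measurable_fun setT H ->
  (forall t, 0 <= G t) -> (forall t, 0 <= H t) ->
  log_integral eps (fun t => G t + H t) = (log_integral eps G + log_integral eps H)%E.
Proof.
move=> mG mH G0 H0; rewrite /log_integral -ge0_integralD//.
- by apply: eq_integral => r _; rewrite mulrDr EFinD.
- by move=> r _; rewrite lee_fin mulr_ge0 ?expR_ge0.
- exact: measurable_log_weight.
- by move=> r _; rewrite lee_fin mulr_ge0 ?expR_ge0.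
- exact: measurable_log_weight.
Qed.

Lemma integral_log_weight (a b : R) : 0 < a -> a < b ->
  (\int[leb]_(r in `[a, b]) (expR (- ln r))%:E = (ln b - ln a)%:E)%E.
Proof.
move=> a0 ab; have dl r : a <= r -> is_derive r (1 : R) (@ln R) r^-1.
  by move=> ar; apply: is_derive1_ln; exact: lt_le_trans ar.
have cl r : a <= r -> {for r, continuous (@ln R)}.
  by move=> ar; apply: continuous_ln; exact: lt_le_trans ar.
rewrite (@continuous_FTC2 _ (fun r => expR (- ln r)) (@ln R))//.
- apply: continuous_in_subspaceT => r /set_mem/=; rewrite in_itv/= => /andP[ar _].
  by apply: continuous_comp; [apply: continuousN; exact: cl|exact: continuous_expR].
- split.
  + by move=> r; rewrite in_itv/= => /andP[/ltW/dl[]].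
  + by apply: cvg_at_right_filter; exact: cl.
  + by apply: cvg_at_left_filter; apply: cl; exact: ltW.
- move=> r; rewrite in_itv/= => /andP[ar _]; have [_ D] := dl _ (ltW ar).
  by rewrite derive1E D expRN lnK// posrE (lt_trans a0).
Qed.

Lemma log_integral_indic (a b : R) : a < b ->
  log_integral eps (\1_(`[a, b])) = ((b - a) / eps)%:E.
Proof.
move=> ab; have e1 : 0 < eps^-1 by rewrite invr_gt0.
transitivity (\int[leb]_(r in `[expR (a / eps), expR (b / eps)]) (expR (- ln r))%:E)%E; last first.
  rewrite integral_log_weight ?expR_gt0//; last by rewrite ltr_expR ltr_pM2r.
  by rewrite !expRK -mulrBl.
rewrite /log_integral integral_mkcond [RHS]integral_mkcond; apply: eq_integral => r _.
rewrite !patchE; case: ifPn => [|rin].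
  rewrite inE/= in_itv/= andbT => r0; rewrite indicE.
  have E : (r \in `[expR (a / eps), expR (b / eps)]%classic) = (eps * ln r \in `[a, b]%classic).
    rewrite !mem_setE /= !in_itv/= -{1 2}(@lnK _ r)// !ler_expR.
    by rewrite ler_pdivrMr// ler_pdivlMr// mulrC.
  by rewrite E; case: (_ \in _); rewrite ?mulr1 ?mulr0.
rewrite ifF//; apply/negbTE; move: rin; apply: contra.
rewrite !inE/= !in_itv/= andbT => /andP[H _].
by apply: lt_le_trans H; exact: expR_gt0.
Qed.

End LogIntegral.

(** * Sharpness of the constant *)

Section Sharpness.
Variables (R : realType) (n : nat).
Local Notation E := (Eucl R n.+1).
Local Notation mu := (lebesgue_eucl R n.+1).
Local Notation sigma := (\sigma_(R, n.+1)).
Local Notation Rn := (Rellich R n.+1).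
Local Notation X := (@unit_bump R).

Lemma sqrD_le (s a b : R) : 0 < s -> (a + b) ^+ 2 <= (1 + s^-1) * a ^+ 2 + (1 + s) * b ^+ 2.
Proof.
move=> s0; rewrite -subr_ge0.
have -> : (1 + s^-1) * a ^+ 2 + (1 + s) * b ^+ 2 - (a + b) ^+ 2 = s^-1 * (a - s * b) ^+ 2.
  by field; rewrite gt_eqF.
by rewrite mulr_ge0 ?sqr_ge0// invr_ge0 ltW.
Qed.

Lemma measurable_unit_bump_sqr i : measurable_fun setT (fun t => X i t ^+ 2).
Proof. exact: measurable_funX (@measurable_unit_bump R i). Qed.

(** X is at least exp (-16 / 3) on [1/4, 3/4], which corresponds to an interval of length 1 / (2
    eps) in ln r. *)
Lemma log_integral_bump eps : 0 < eps -> exists j : R,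
  log_integral eps (fun t => X 0 t ^+ 2) = j%:E /\ expR (- (16 / 3)) ^+ 2 / 2 / eps <= j.
Proof.
move=> eps0; set m := expR _.
have [B B0 HB] := @unit_bump_bounded R 0.
have mX := measurable_unit_bump_sqr 0.
have m1 (a b : R) : measurable_fun setT (\1_(`[a, b]) : R -> R) by exact: measurable_indic.
have up : (log_integral eps (fun t => X 0 t ^+ 2)%R <= (B ^+ 2 / eps)%:E)%E.
  apply: (@le_trans _ _ (log_integral eps (fun t => B ^+ 2 * \1_(`[0%R, 1]) t)%R)).
    apply: le_log_integral => //; [exact: measurable_funM|by move=> t; exact: sqr_ge0|].
    move=> t; have [t01|t01] := boolP (0 < t < 1); last first.
      by rewrite unit_bump_out// expr0n mulr_ge0 ?sqr_ge0.
    have [t0 t1] := andP t01; rewrite indicE mem_set/= ?in_itv/= ?(ltW t0) ?(ltW t1)// mulr1.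
    by rewrite -(real_normK (num_real (X 0 t))) lerXn2r ?nnegrE.
  by rewrite log_integralZ ?sqr_ge0// log_integral_indic// subr0 mul1r -EFinM.
have lo : ((m ^+ 2 / 2 / eps)%:E <= log_integral eps (fun t => X 0 t ^+ 2)%R)%E.
  apply: (@le_trans _ _ (log_integral eps (fun t => m ^+ 2 * \1_(`[4^-1, 3 / 4]) t)%R)).
    rewrite log_integralZ ?sqr_ge0// log_integral_indic//; last by lra.
    by rewrite -EFinM lee_fin le_eqVlt; apply/orP; left; apply/eqP; field; rewrite gt_eqF.
  apply: le_log_integral => //; [exact: measurable_funM|by move=> t; rewrite mulr_ge0 ?sqr_ge0|].
  move=> t; rewrite indicE; case: (boolP (t \in _)) => [|_]; last by rewrite mulr0 sqr_ge0.
  rewrite inE/= in_itv/= => tin; rewrite mulr1 lerXn2r ?nnegrE ?expR_ge0//.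
    exact: le_trans (expR_ge0 _) (unit_bump_ge tin).
  exact: unit_bump_ge.
have fin : log_integral eps (fun t => X 0 t ^+ 2) \is a fin_num.
  by rewrite fin_numE; apply/andP; split; apply/eqP => Z; move: up lo; rewrite Z.
by exists (fine (log_integral eps (fun t => X 0 t ^+ 2))); rewrite fineK// -lee_fin fineK.
Qed.

(** Terms with a derivative of X carry a factor eps, squared to eps^2, over an interval of length 1
    / eps in ln r: they contribute K eps, while the main term is of order 1 / eps. The cross term is
    absorbed by Young's inequality with weight s. *)
Lemma log_integral_perturbed (c s : R) : 0 < s -> exists2 K, 0 <= K &
  forall eps : R, 0 < eps -> eps <= 1 ->
  (log_integral eps (fun t => (eps * (2 * X 1 t + eps * X 2 t) - c * X 0 t) ^+ 2)%R <=
   (1 + s)%:E * (c ^+ 2)%:E * log_integral eps (fun t => X 0 t ^+ 2)%R + (K * eps)%:E)%E.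
Proof.
move=> s0; have [B1 B10 HB1] := @unit_bump_bounded R 1.
have [B2 B20 HB2] := @unit_bump_bounded R 2.
have k0 : 0 <= (1 + s^-1) * (2 * B1 + B2) ^+ 2.
  by rewrite mulr_ge0 ?sqr_ge0// addr_ge0// invr_ge0 ltW.
exists ((1 + s^-1) * (2 * B1 + B2) ^+ 2) => // eps eps0 eps1.
have mX := measurable_unit_bump_sqr 0; have mb := @measurable_unit_bump R.
have m1 : measurable_fun setT (\1_(`[0, 1]) : R -> R) by exact: measurable_indic.
set k := _ * _ in k0 *.
have s1 : 0 <= (1 + s) * c ^+ 2 by rewrite mulr_ge0 ?sqr_ge0//; lra.
have ke : 0 <= k * eps ^+ 2 by rewrite mulr_ge0 ?sqr_ge0.
apply: (@le_trans _ _ (log_integral eps (fun t =>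
    ((1 + s) * c ^+ 2) * X 0 t ^+ 2 + (k * eps ^+ 2) * \1_(`[0%R, 1]) t)%R)).
  apply: le_log_integral => //.
  - apply: measurable_funX; apply: measurable_funB; last exact: measurable_funM.
    by apply: measurable_funM => //; apply: measurable_funD; exact: measurable_funM.
  - by apply: measurable_funD; exact: measurable_funM.
  - by move=> t; exact: sqr_ge0.
  move=> t; have [t01|t01] := boolP (0 < t < 1); last first.
    rewrite !unit_bump_out// !mulr0 addr0 mulr0 subr0 expr0n mulr0 add0r.
    by rewrite mulr_ge0.
  have [t0 t1] := andP t01; rewrite indicE mem_set/= ?in_itv/= ?(ltW t0) ?(ltW t1)// mulr1.
  apply: le_trans (sqrD_le _ _ s0) _.
  rewrite addrC sqrrN exprMn mulrA lerD2l exprMn /k -mulrA [X in _ <= _ * X]mulrC ler_wpM2l//.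
    by rewrite addr_ge0// invr_ge0 ltW.
  rewrite ler_wpM2l ?sqr_ge0//.
  rewrite -(real_normK (num_real (2 * _ + _))) lerXn2r ?nnegrE ?addr_ge0 ?mulr_ge0//.
  apply: le_trans (ler_normD _ _) _; rewrite !normrM (ger0_norm (ltW eps0)) ger0_norm//.
  apply: lerD; first by rewrite ler_wpM2l.
  by rewrite -[leRHS]mul1r; apply: ler_pM => //; exact: ltW.
have X0 t : 0 <= X 0 t ^+ 2 := sqr_ge0 _.
rewrite log_integralD//; last 4 first.
- exact: measurable_funM.
- exact: measurable_funM.
- by move=> t; rewrite mulr_ge0.
- by move=> t; rewrite mulr_ge0.
rewrite !log_integralZ// log_integral_indic// subr0 mul1r EFinM leeD2l// -EFinM lee_fin.
by rewrite le_eqVlt; apply/orP; left; apply/eqP; field; rewrite gt_eqF.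
Qed.

Variables (Lam : l2op E R).
Local Notation A := (oppop Lam).

Lemma rellich_lower (l C : R) : selfadjoint sigma A -> Defs.eigenvalue sigma A l%:C%C ->
  Rn < 0 -> 0 < l + Rn ->
  (forall f, admissible Lam f ->
     (l2norm mu (weighted_angular_action Lam f) ^+ 2 <= C%:E * l2norm mu (Lop Lam f) ^+ 2)%E) ->
  (l / (l + Rn)) ^+ 2 <= C.
Proof.
move=> saA [u [du u0 eigu]] Rn0 c0 HC; set c := l + Rn in c0 *.
have Lu := dom_L2 saA du; have l0 : 0 < l by rewrite -(subrK Rn l) -/c; move: c0; rewrite /c; lra.
have q0 : 0 < rip sigma u u.
  by rewrite lt_neqAle rip_ge0 andbT eq_sym; apply/eqP => Z; apply: u0; exact: rip_eq0.
set q := rip sigma u u in q0.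
(* Replacing C by C' >= 0 keeps the assumed inequality and allows its right side to be bounded from
   above. *)
rewrite leNgt; apply/negP => Clt; pose C' := Num.max C 0.
have C'0 : 0 <= C' by rewrite le_max lexx orbT.
have C'lt : C' < (l / c) ^+ 2 by rewrite gt_max Clt exprn_gt0// divr_gt0.
have D0 : 0 < l ^+ 2 - C' * c ^+ 2.
  by move: C'lt; rewrite expr_div_n ltr_pdivlMr ?exprn_gt0// subr_gt0.
set D := _ - _ in D0; have t0 : 0 <= C' * c ^+ 2 by rewrite mulr_ge0 ?sqr_ge0.
(* This s keeps the loss s C' c^2 at most D / 2. Below, eps keeps C' K eps at most D m / 8, less
   than the D m / 4 forced by j >= m / 2. *)
pose s := D / (2 * (C' * c ^+ 2 + 1)).
have s0 : 0 < s by rewrite divr_gt0// mulr_gt0//; lra.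
have [K K0 HK] := log_integral_perturbed c s0.
have m0 : 0 < expR (- (16 / 3)) ^+ 2 :> R by rewrite exprn_gt0 ?expR_gt0.
set m := _ ^+ 2 in m0.
pose eps := Num.min 1 (D * m / (8 * (C' * K + 1))).
have CK : 0 <= C' * K by rewrite mulr_ge0.
have eps0 : 0 < eps by rewrite lt_min ltr01 divr_gt0 ?mulr_gt0//; lra.
have eps1 : eps <= 1 by rewrite ge_min lexx.
have eps2 : eps * (8 * (C' * K + 1)) <= D * m.
  by rewrite -ler_pdivlMr ?ge_min ?lexx ?orbT// mulr_gt0//; lra.
have [j [jE jm]] := log_integral_bump eps0.
have := HC _ (admissible_test saA du eigu eps0).
rewrite (l2norm_weighted_test eps saA du eigu) (l2norm_Lop_test eps saA du eigu) -/q -/c.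
pose Z (t : R) := eps * (2 * X 1 t + eps * X 2 t) - c * X 0 t.
have mb := @measurable_unit_bump R.
have mZ : measurable_fun setT (fun t => Z t ^+ 2).
  apply: measurable_funX; apply: measurable_funB; last exact: measurable_funM.
  by apply: measurable_funM => //; apply: measurable_funD; exact: measurable_funM.
have X0 t : 0 <= X 0 t ^+ 2 := sqr_ge0 _.
have Z0 t : 0 <= Z t ^+ 2 := sqr_ge0 _.
rewrite (_ : (fun t => (- (l * X 0 t)) ^+ 2 * q) = fun t => (l ^+ 2 * q) * X 0 t ^+ 2); last first.
  by apply/funext => t; ring.
rewrite (_ : (fun t => _ * q) = fun t => q * Z t ^+ 2); last first.
  by apply/funext => t; rewrite /Z; ring.
have lq : 0 <= l ^+ 2 * q by rewrite mulr_ge0 ?sqr_ge0 ?(ltW q0).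
rewrite (log_integralZ _ lq (measurable_unit_bump_sqr 0) X0) (log_integralZ _ (ltW q0) mZ Z0) jE => ineq.
have {}HK := HK eps eps0 eps1; rewrite -/(fun t => Z t ^+ 2) jE in HK.
have {ineq} : ((l ^+ 2 * q)%:E * j%:E <=
    C'%:E * (q%:E * ((1 + s)%:E * (c ^+ 2)%:E * j%:E + (K * eps)%:E)))%E.
  apply: le_trans ineq _; apply: (@le_trans _ _ (C'%:E * (q%:E * log_integral eps (fun t => Z t ^+ 2)%R))%E).
    apply: lee_wpmul2r; last by rewrite lee_fin le_max lexx.
    apply: mule_ge0; first by rewrite lee_fin ltW.
    by apply: integral_ge0 => r _; rewrite lee_fin mulr_ge0 ?expR_ge0.
  by apply: lee_wpmul2l; rewrite ?lee_fin//; apply: lee_wpmul2l; rewrite ?lee_fin// ltW.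
rewrite -[(_ <= _)%E]/((l ^+ 2 * q * j)%:E <= (C' * (q * ((1 + s) * c ^+ 2 * j + K * eps)))%:E)%E lee_fin.
have -> : C' * (q * ((1 + s) * c ^+ 2 * j + K * eps)) = (C' * ((1 + s) * c ^+ 2 * j + K * eps)) * q by ring.
rewrite [_ * q * j]mulrAC ler_pM2r// => ineq.
have j0 : m / 2 <= j.
  apply: le_trans jm; rewrite -[leLHS]mulr1 ler_wpM2l//; first by apply: divr_ge0 => //; exact: ltW.
  by rewrite invf_ge1.
have sD : s * (C' * c ^+ 2) <= D / 2.
  have sE : s * (2 * (C' * c ^+ 2 + 1)) = D by rewrite /s divfK// gt_eqF// mulr_gt0//; lra.
  by move: sE s0; move: (C' * c ^+ 2) => T; lra.
have j1 : 0 <= j by apply: le_trans j0; rewrite divr_ge0 // ltW.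
have H1 : D / 2 * j <= C' * K * eps.
  have := ler_wpM2r j1 sD; move: ineq; rewrite /D.
  by lra.
have H2 : D / 2 * (m / 2) <= C' * K * eps.
  by apply: le_trans H1; rewrite ler_wpM2l ?divr_ge0 ?(ltW D0).
have contra (x y e P : R) : e * (8 * (P + 1)) <= x * y -> x / 2 * (y / 2) <= P * e ->
    0 < x * y -> 0 < e -> False by lra.
exact: contra eps2 H2 (mulr_gt0 D0 m0) eps0.
Qed.

End Sharpness.

Theorem theorem7 (R : realType) (n : nat) (Lam : l2op (Eucl R n) R)
    (I : Type) (o : I) (lam : I -> R)
    (hn : n = 2%N \/ n = 3%N)
    (hsa : selfadjoint \sigma_(R, n) (oppop Lam))
    (hnonneg : nonneg_operator \sigma_(R, n) (oppop Lam))
    (hspec : discrete_spectrum \sigma_(R, n) (oppop Lam) lam)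
    (ho : lam o = 0) :
  let M := Mmax n o lam in
  let C0 := (1 - Rellich R n * Num.sqrt (fine M)) ^+ 2 in
  let norm2 := l2norm (lebesgue_eucl R n) in
  (M \is a fin_num ->
   forall f, admissible Lam f ->
     (norm2 (weighted_angular_action Lam f) ^+ 2
        <= C0%:E * norm2 (Lop Lam f) ^+ 2)%E)
  /\
  (forall k0, k0 <> o -> - Rellich R n < lam k0 ->
     M = ((lam k0 + Rellich R n) ^- 2)%:E ->
     forall C : R,
       (forall f, admissible Lam f ->
          (norm2 (weighted_angular_action Lam f) ^+ 2
             <= C%:E * norm2 (Lop Lam f) ^+ 2)%E) ->
       C0 <= C).
Proof.
move=> M C0 norm2.
(* For n = 2, R_n = -1 and (n - 4) / 2 = -1; for n = 3, R_n = -3/4 and (n - 4) / 2 = -1/2. *)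
have [Rn0 Rn2 k1] : [/\ Rellich R n < 0, -2 <= Rellich R n & `|(n%:R - 4) / 2 : R| <= 1].
  case: hn => ->; rewrite /Rellich ler_norml.
    by split; [lra|lra|apply/andP; split; lra].
  by split; [lra|lra|apply/andP; split; lra].
case: n hn Lam hsa hnonneg hspec @M @C0 @norm2 Rn0 Rn2 k1 => [[]//|n] _ Lam hsa hnonneg hspec M C0 norm2 Rn0 Rn2 k1.
split=> [Mfin f|k0 k0o lk ME C HC]; first exact: rellich_upper.
have c0 : 0 < lam k0 + Rellich R n.+1 by move: lk; lra.
have [_ eig _] := hspec.
have -> : C0 = (lam k0 / (lam k0 + Rellich R n.+1)) ^+ 2.
  rewrite /C0 ME /= -exprVn sqrtr_sqr ger0_norm ?invr_ge0 ?(ltW c0)//.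
  by congr (_ ^+ 2); field; rewrite gt_eqF.
exact: (rellich_lower hsa (eig k0)).
Qed.
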